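(* Let $K$ be a number field and let $\varphi(z)\in K(z)$ be a rational function of degree $d\ge2$. Let $\gamma\in K$ be a periodic point for $\varphi$ such that $\varphi$ is not of polynomial type at $\gamma$. Let $\alpha\in K$ be a wandering point for $\varphi$, and for each $n\ge1$ write the fractional ideal $\bigl(\varphi^n(\alpha)-\gamma\bigr)=\mathfrak{A}_n\mathfrak{B}_n^{-1}$ as a quotient of relatively prime integral ideals of the ring of integers of $K$ (if $\varphi^n(\alpha)=\infty$, set $\mathfrak{A}_n=(1)$ and $\mathfrak{B}_n=(0)$). Then the Zsigmondy set $\mathcal{Z}\bigl((\mathfrak{A}_n)_{n\ge1}\bigr)$ is finite.
   Context: $\varphi$ is viewed as a morphism $\mathbb{P}^1_K\to\mathbb{P}^1_K$ and $\varphi^n$ is its $n$-th iterate. A point $\gamma$ is periodic if $\varphi^n(\gamma)=\gamma$ for some $n\ge1$; the least such $n$ is its period. A wandering point is one with infinite orbit $\{\alpha,\varphi(\alpha),\varphi^2(\alpha),\dots\}$. If $\gamma$ has period $k$, then $\varphi$ is of polynomial type at $\gamma$ if $\varphi^k(z)=\gamma+\frac{(z-\gamma)^d}{\psi(z)}$ for some $\psi(z)\in K[z]$ with $\psi(\gamma)\neq0$. For a sequence of nonzero integral ideals $(\mathfrak{A}_n)_{n\ge1}$, a prime ideal $\mathfrak{p}$ is a primitive divisor of $\mathfrak{A}_n$ if $\mathfrak{p}\mid\mathfrak{A}_n$ and $\mathfrak{p}\nmid\mathfrak{A}_i$ for all $1\le i<n$; the Zsigmondy set $\mathcal{Z}((\mathfrak{A}_n))$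 is the set of $n\ge1$ such that $\mathfrak{A}_n$ has no primitive divisor.
   Formalization: In the definition of polynomial type at a point of period k, the exponent d is read as d^k = deg(φ^k); with d = deg φ the claim fails, e.g. for φ(z)=1/z², γ=0, α=2 over Q. *)

(* Defs.v *)
From HB Require Import structures.
From mathcomp Require Import all_boot all_order all_algebra all_field.
Set Implicit Arguments. Unset Strict Implicit. Unset Printing Implicit Defensive.
Import Order.TTheory GRing.Theory Num.Theory.
Local Open Scope ring_scope.

(* A number field is a finite field extension K of Q: K : fieldExtType rat.
   A rational function phi = f/g in K(z) is given by coprime f, g : {poly K}.
   P^1(K) = option K, with None = infinity. *)

Section Dyn.
Variable K : fieldExtType rat.
Implicit Types (f g p F G psi : {poly K}).

Definition ratdeg f g : nat := (maxn (size f) (size g)).-1.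

Definition rat_eval f g (x : option K) : option K :=
  match x with
  | Some z => if g.[z] == 0 then None else Some (f.[z] / g.[z])
  | None => if (size g < size f)%N then None
            else if size f == size g then Some (lead_coef f / lead_coef g)
            else Some 0
  end.

Definition rat_iter f g (n : nat) (x : option K) : option K :=
  iter n (rat_eval f g) x.

(* homogenised substitution: p(F/G) * G^D = sum_i p_i F^i G^(D-i) *)
Definition homog (D : nat) p F G : {poly K} :=
  \sum_(i < D.+1) (p`_i)%:P * F ^+ i * G ^+ (D - i).

(* numerator/denominator pair of the n-th iterate phi^n as a rational
   function: phi^0 = X/1, phi^(n+1) = phi o phi^n *)
Definition iter_pair f g (n : nat) : {poly K} * {poly K} :=
  iter n (fun FG => (homog (ratdeg f g) f FG.1 FG.2,
                     homog (ratdeg f g) g FG.1 FG.2)) ('X, 1).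

Definition is_period f g (gam : K) (k : nat) : Prop :=
  (0 < k)%N /\ rat_iter f g k (Some gam) = Some gam /\
  forall j, (0 < j < k)%N -> rat_iter f g j (Some gam) <> Some gam.

Definition periodic f g (gam : K) : Prop := exists k, is_period f g gam k.

(* phi is of polynomial type at the periodic point gam of period k:
   phi^k(z) = gam + (z - gam)^D / psi(z) as rational functions, psi(gam) <> 0,
   where D = d^k = deg phi^k; identity of rational functions written by
   cross-multiplication. *)
Definition polynomial_type f g (gam : K) : Prop :=
  exists k, is_period f g gam k /\
   exists psi, psi.[gam] != 0 /\
     (iter_pair f g k).1 * psi =
     (gam%:P * psi + ('X - gam%:P) ^+ (ratdeg f g ^ k)) * (iter_pair f g k).2.

Definition wandering f g (alpha : K) : Prop :=
  injective (fun n : nat => rat_iter f g n (Some alpha)).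

Definition integral (x : K) : Prop :=
  exists p : {poly int}, p \is monic /\ root (map_poly (fun z : int => z%:~R) p) x.

Definition prime_ideal (P : K -> Prop) : Prop :=
  (forall x, P x -> integral x) /\
  P 0 /\
  (forall x y, P x -> P y -> P (x + y)) /\
  (forall a x, integral a -> P x -> P (a * x)) /\
  ~ P 1 /\
  (forall x y, integral x -> integral y -> P (x * y) -> P x \/ P y) /\
  (exists x, P x /\ x != 0).

(* A_n : numerator ideal of (phi^n(alpha) - gam), i.e. x O_K cap O_K,
   and (1) = O_K if phi^n(alpha) = infinity *)
Definition numer_ideal f g (gam alpha : K) (n : nat) : K -> Prop :=
  fun y => integral y /\
    match rat_iter f g n (Some alpha) with
    | None => True
    | Some z => exists b, integral b /\ y = (z - gam) * b
    end.

(* divisibility of an integral ideal A by a prime P (Dedekind: P | A <-> A ⊆ P) *)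
Definition ideal_dvd (P A : K -> Prop) : Prop := forall y, A y -> P y.

Definition primitive_divisor f g (gam alpha : K) (n : nat) (P : K -> Prop) : Prop :=
  prime_ideal P /\ ideal_dvd P (numer_ideal f g gam alpha n) /\
  forall i, (1 <= i < n)%N -> ~ ideal_dvd P (numer_ideal f g gam alpha i).

Definition in_zsigmondy f g (gam alpha : K) (n : nat) : Prop :=
  (1 <= n)%N /\ ~ exists P, primitive_divisor f g gam alpha n P.

End Dyn.

(* Main.v *)
(* If [n] lies in the Zsigmondy set, every good prime dividing [A_n] divides [A_(n-k)],
   where [k] is the period of [gam]. Hence [phi^(n-k)(alpha)] is incongruent to [b] modulo
   every good prime, for any [b <> gam] with [phi^k(b) = gam]; such a [b] exists precisely
   because [phi] is not of polynomial type at [gam]. Since [b] is not periodic, some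
   backward level [phi^(-j)(b)] contains three points [t1], [t2], [t3], and
   [phi^(n-k-j)(alpha)] is incongruent to each of them modulo every good prime. By
   Siegel's identity this gives a solution of the S-unit equation [u + v = 1] in a number
   field, and these solutions are distinct because [alpha] is wandering.
   The finiteness of the solutions of the S-unit equation is obtained, following Beukers
   and Schlickewei, from Pade approximants: two solutions whose logarithmic vectors point in
   nearly the same direction cannot have heights of very different size, and directions
   form a compact set.
   Over a Galois number field [L] the product formula does not require the splitting of
   primes: with one fixed extension to [L] of the absolute value [|.|_p], the product of
   [|g t|_p] over the Galois group is [|N t|_p]. *)
Require Import Defs.
From HB Require Import structures.
From mathcomp Require Import all_boot all_order all_algebra all_field ring lra zify.
From mathcomp Require Import fingroup Rstruct complex boolp classical_sets reals sequences exp.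
Set Implicit Arguments. Unset Strict Implicit. Unset Printing Implicit Defensive.
Import Order.TTheory GRing.Theory Num.Theory.
Local Open Scope ring_scope.

(** * Pade approximants *)

(** Primes enter only through valuation rings that omit some [q^-1]. Zorn's lemma provides them, and
    they pull back along field embeddings and Galois automorphisms. Points of the projective line
    are coordinate pairs, so that congruence means that a determinant lies in the maximal ideal and
    infinity is no exception; with the trivial valuation ring the same lemmas describe equality of
    points over a field. In the Pade part the obstacle is nonvanishing: the S-integer to which the
    product formula is applied may be zero for one approximant. Two neighbouring approximants with
    the same exponent [2N] are therefore used; their minor is a nonzero constant times a power of
    [x], so they cannot both fail. Their coefficients grow at most exponentially in [N], which is
    negligible against solutions of large height. *)

Lemma coefM_top (R : nzRingType) (p q : {poly R}) a b :
  (size p <= a.+1)%N -> (size q <= b.+1)%N ->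
  (size (p * q)%R <= (a + b).+1)%N /\ (p * q)`_(a + b) = p`_a * q`_b.
Proof.
move=> sp sq; split.
  apply: leq_trans (size_polyMleq _ _) _.
  by rewrite -subn1 leq_subLR; apply: leq_trans (leq_add sp sq) _; lia.
rewrite coefM (bigD1 (inord a)) //= inordK ?ltnS ?leq_addr // addKn.
rewrite big1 ?addr0 // => i /eqP ni.
have {}ni : i != a :> nat by apply: contra_notN ni => /eqP h; apply/val_inj; rewrite /= inordK // ltnS leq_addr.
case: (ltngtP i a) ni => // ia _; last by rewrite nth_default ?mul0r // (leq_trans sp).
rewrite [q`_ _]nth_default ?mulr0 // (leq_trans sq) //; lia.
Qed.

(* Up to a constant, [padeE a c] at [x] is the integral of [t^a (1-t)^a (x-t)^c] over
   [0 <= t <= x]; its [c+1]-st derivative is symmetric under [x -> 1 - x], which makes the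
   degree of [padeC a c] at most [c]. *)
Definition padeA (a c : nat) : {poly int} :=
  \poly_(j < a.+1) ((-1) ^+ j * ('C(a + j, j) * 'C((a + a + c).+1, a - j))%:R).
Definition padeB (a c : nat) : {poly int} := (-1) ^+ c *: (padeA a c \Po (1 - 'X)).
Definition padeE (a c : nat) : {poly int} := 'X^((a + c).+1) * padeA a c.
Definition padeC (a c : nat) : {poly int} :=
  padeE a c + (-1) ^+ c *: (padeE a c \Po (1 - 'X)).

Lemma padeCE a c :
  padeC a c = 'X^((a + c).+1) * padeA a c + (1 - 'X) ^+ (a + c).+1 * padeB a c.
Proof.
rewrite /padeC /padeB /padeE; congr (_ + _).
by rewrite comp_polyM rmorphXn /= comp_polyX scalerAr.
Qed.

Lemma derivn_comp_1subX (p : {poly int}) n :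
  (p \Po (1 - 'X))^`(n) = (-1) ^+ n *: (p^`(n) \Po (1 - 'X)).
Proof.
elim: n => [|n IH]; first by rewrite !derivn0 scale1r.
rewrite !derivnS IH derivZ deriv_comp derivB derivX -polyC1 derivC sub0r.
by rewrite mulrN1 exprSr -scalerA scaleN1r.
Qed.

Lemma padeE_coef a c i : (padeE a c)`_((a + c).+1 + i) = (padeA a c)`_i.
Proof. by rewrite /padeE coefXnM ltnNge leq_addr /= addKn. Qed.

(** The constant by which the [c+1]-st derivative of [padeE a c] differs from [X^a (1-X)^a]. The
    division is exact. *)
Definition padeK (a c : nat) : nat := ((a + a + c).+1)`! %/ (a`! * a`!).

Lemma padeKE a c : (padeK a c * (a`! * a`!) = ((a + a + c).+1)`!)%N.
Proof.
rewrite /padeK divnK //.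
have -> : (a + a + c).+1 = (a + (a + c.+1))%N by lia.
rewrite -(bin_fact (leq_addr (a + c.+1) a)) addKn.
rewrite -(bin_fact (leq_addr c.+1 a)) addKn.
set u := 'C(_, _); set v := 'C(_, _).
have -> : (u * (a`! * (v * (a`! * (c.+1)`!))) = (u * v * (c.+1)`!) * (a`! * a`!))%N by ring.
exact: dvdn_mull.
Qed.

Lemma pade_fact a c j : (j <= a)%N ->
  ('C(a + j, j) * 'C((a + a + c).+1, a - j) * (((a + c).+1 + j) ^_ c.+1)
   = padeK a c * 'C(a, j))%N.
Proof.
move=> ja.
(* These factorials turn both sides into [(a+j)! * (2a+c+1)! * a!]. *)
have P : (0 < j`! * a`! * (a - j)`! * (a+j)`! * a`!)%N by rewrite !muln_gt0 !fact_gt0.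
apply/eqP; rewrite -(eqn_pmul2r P); apply/eqP.
have e1 := bin_fact (leq_addl a j); rewrite addnK in e1.
have l2 : (a - j <= (a + a + c).+1)%N.
  by lia.
have e2 := bin_fact l2.
have s2 : ((a + a + c).+1 - (a - j) = (a + c).+1 + j)%N.
  lia.
rewrite s2 in e2.
have e3 : (((a + c).+1 + j) ^_ c.+1 * (a + j)`! = ((a + c).+1 + j)`!)%N.
  have l3 : (c.+1 <= (a + c).+1 + j)%N by lia.
  rewrite -(ffact_fact l3); congr (_ * (_)`!)%N.
  lia.
have e4 := bin_fact ja; have e5 := padeKE a c.
transitivity ((('C(a + j, j) * (j`! * a`!)) * ('C((a + a + c).+1, a - j) * ((a - j)`! *
  (((a + c).+1 + j) ^_ c.+1 * (a + j)`!))) * a`!))%N.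
  by ring.
rewrite e1 e3 e2.
transitivity ((padeK a c * (a`! * ('C(a, j) * (j`! * (a - j)`!)))) * (a + j)`! * a`!)%N; last by ring.
rewrite e4 e5; ring.
Qed.

Lemma exprBn_poly a :
  (1 - 'X) ^+ a = \poly_(j < a.+1) ((-1) ^+ j * ('C(a, j))%:R) :> {poly int}.
Proof.
rewrite exprBn poly_def; apply: eq_bigr => i _.
by rewrite expr1n mulr1 -mul_polyC rmorphM rmorphXn rmorphN1 rmorph_nat /= mulrAC mulr_natr.
Qed.

Lemma derivn_padeE a c :
  (padeE a c)^`(c.+1) = (padeK a c)%:R *: ('X^a * (1 - 'X) ^+ a).
Proof.
apply/polyP=> i; rewrite coef_derivn coefZ [in RHS]coefXnM.
case: ltnP => ia.
  rewrite ?mulr0 /padeE coefXnM ifT ?mul0rn ?mulr0 //; lia.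
have -> : (c.+1 + i = (a + c).+1 + (i - a))%N by lia.
set j := (i - a)%N.
rewrite padeE_coef coef_poly ltnS.
rewrite exprBn_poly coef_poly ltnS.
case: leqP => ja; last by rewrite mul0rn !mulr0.
rewrite -mulrnAr -[_ *+ _]mulr_natr -natrM pade_fact // natrM mulrCA //.
Qed.

Lemma padeA_coef a c j : (padeA a c)`_j =
  if (j < a.+1)%N then (-1) ^+ j * ('C(a + j, j) * 'C((a + a + c).+1, a - j))%:R else 0.
Proof. by rewrite coef_poly. Qed.

Lemma padeA_lead a c : (padeA a c)`_a != 0.
Proof.
rewrite padeA_coef ltnSn subnn bin0 muln1 mulf_neq0 ?signr_eq0 //.
by rewrite pnatr_eq0 -lt0n bin_gt0 leq_addl.
Qed.

Lemma size_padeA a c : size (padeA a c) = a.+1.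
Proof.
apply/eqP; rewrite eqn_leq size_poly ltnNge.
by apply/negP => /leq_sizeP /(_ a (leqnn a)) /eqP; apply/negP/padeA_lead.
Qed.

Lemma size_1subX : size (1 - 'X : {poly int}) = 2%N.
Proof. by rewrite -opprB size_polyN size_XsubC. Qed.

Lemma size_padeB a c : size (padeB a c) = a.+1.
Proof.
rewrite /padeB size_scale ?signr_eq0 //.
by rewrite size_comp_poly2 ?size_1subX ?size_padeA.
Qed.

Lemma derivn_padeC a c :
  (padeC a c)^`(c) = (padeE a c)^`(c) + ((padeE a c)^`(c) \Po (1 - 'X)).
Proof.
by rewrite /padeC derivnD derivnZ derivn_comp_1subX scalerA -exprD addnn -signr_odd odd_double scale1r.
Qed.

Lemma size_padeC a c : (size (padeC a c) <= c.+1)%N.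
Proof.
suff P : (padeC a c)^`(c.+1) = 0.
  apply/leq_sizeP => i ci; have := congr1 (fun p : {poly int} => p`_(i - c.+1)) P.
  rewrite coef_derivn coef0 subnKC // => /eqP; rewrite mulrn_eq0 => /orP[|/eqP //].
  by rewrite eqn0Ngt ffact_gt0 ci.
rewrite derivnS derivn_padeC derivD deriv_comp -derivnS derivn_padeE.
rewrite derivB derivX -polyC1 derivC sub0r mulrN1 comp_polyZ comp_polyM.
rewrite !rmorphXn /= !comp_polyX polyC1 rmorphB /= comp_polyX comp_polyC.
have -> : 1%:P - (1 - 'X) = 'X :> {poly int} by rewrite polyC1; ring.
by rewrite mulrC subrr.
Qed.

(** If this coefficient vanished, so would the [c]-th derivative of [padeC], making that of [padeE]
    antisymmetric under [X -> 1 - X]. Being divisible by [X^(a+1)], it would be divisible by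
    [(1-X)^(a+1)] too, but its cofactor [F1] is nonzero of degree at most [a]. *)
Lemma padeC_lead a c : (padeC a c)`_c != 0.
Proof.
apply/negP => /eqP C0.
have sC : (size (padeC a c) <= c)%N.
  apply/leq_sizeP => j; rewrite leq_eqVlt => /orP[/eqP <- //|cj].
  by move/leq_sizeP: (size_padeC a c); apply.
have : (padeC a c)^`(c) = 0.
  by apply/polyP=> i; rewrite coef_derivn coef0 nth_default ?mul0rn // (leq_trans sC) ?leq_addr.
rewrite derivn_padeC.
pose F1 : {poly int} := \poly_(j < a.+1) ((padeA a c)`_j *+ ((a + c).+1 + j) ^_ c).
have -> : (padeE a c)^`(c) = 'X^(a.+1) * F1.
  apply/polyP=> i; rewrite coef_derivn coefXnM coef_poly.
  case: ltnP => ia.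
    by rewrite /padeE coefXnM ifT ?mul0rn //; lia.
  have -> : (c + i = (a + c).+1 + (i - a.+1))%N by lia.
  rewrite padeE_coef; case: ifP => // /negbT h.
  by rewrite nth_default ?mul0rn // size_padeA leqNgt.
rewrite comp_polyM rmorphXn /= comp_polyX => /eqP; rewrite addr_eq0 => /eqP e.
have cop : coprimep ((1 - 'X) ^+ a.+1) ('X^(a.+1) : {poly int}).
  rewrite coprimep_expl // coprimep_expr //; apply/Bezout_coprimepP.
  by exists (1, 1); rewrite /= !mul1r subrK eqpxx.
have : (1 - 'X) ^+ a.+1 %| 'X^(a.+1) * F1.
  by rewrite e dvdpNr dvdp_mulr.
rewrite Gauss_dvdpr // => /dvdp_leq.
have F0 : F1 != 0.
  apply/eqP => /(congr1 (fun p : {poly int} => p`_a)); rewrite coef_poly ltnSn coef0 => /eqP.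
  rewrite mulrn_eq0 (negPf (padeA_lead _ _)) orbF eqn0Ngt ffact_gt0; lia.
have sF : (size F1 <= a.+1)%N := size_poly _ _.
move=> /(_ F0); have := size_exp (1 - 'X : {poly int}) a.+1; rewrite size_1subX mul1n.
move=> e1 /leq_trans /(_ sF) e2; move: e1 e2; case: (size _) => //= k ->; by rewrite ltnn.
Qed.

(* The minor is divisible by [X^M] and its degree is at most [M = 2n+2]. *)
Lemma pade_minor n :
  exists2 mu : int, mu != 0 &
    padeB n.+1 n * padeC n n.+1 - padeB n n.+1 * padeC n.+1 n = mu *: 'X^((n.+1 + n).+1).
Proof.
set M := (n.+1 + n).+1; set D := _ - _.
have c1 := padeCE n.+1 n; have c2 := padeCE n n.+1.
rewrite -/M in c1; rewrite -addSnnS -/M in c2.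
have key : (1 - 'X) ^+ M * D = 'X^M * (padeA n n.+1 * padeC n.+1 n - padeA n.+1 n * padeC n n.+1).
  rewrite /D c1 c2; ring.
have cop : coprimep ('X^M : {poly int}) ((1 - 'X) ^+ M).
  rewrite coprimep_expl // coprimep_expr //; apply/Bezout_coprimepP.
  by exists (1, 1); rewrite /= !mul1r addrC subrK eqpxx.
have : 'X^M %| D by rewrite -(Gauss_dvdpr _ cop) key dvdp_mulr.
have sD : (size D <= M.+1)%N.
  have s1 := size_padeB n.+1 n; have s2 := size_padeB n n.+1.
  have s3 := size_padeC n.+1 n; have s4 := size_padeC n n.+1.
  rewrite /D; apply: leq_trans (size_polyD _ _) _; rewrite size_polyN geq_max.
  apply/andP; split.
    by apply: leq_trans (coefM_top (a := n.+1) (b := n.+1) _ _).1 _; rewrite ?s1 // /M; lia.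
  by apply: leq_trans (coefM_top (a := n) (b := n) _ _).1 _; rewrite ?s2 // /M; lia.
(* Over the integers, divisibility only gives [w *: D = r * 'X^M] for some nonzero scalar [w], which
   is enough to kill the coefficients below [M]. *)
case/Pdiv.Idomain.dvdpP => -[w r] /= w0 e.
have DE : D = D`_M *: 'X^M.
  apply/polyP=> i; rewrite coefZ coefXn; case: ltngtP => [iM|iM|->]; rewrite ?mulr1 // mulr0.
    have := congr1 (fun p : {poly int} => p`_i) e; rewrite coefZ coefMXn iM => /eqP.
    by rewrite mulf_eq0 (negPf w0) => /eqP.
  by move/leq_sizeP: sD; apply.
exists D`_M => //.
(* Only the first product reaches degree [M]; the second has degree at most [2n]. *)
have s1 := size_padeB n.+1 n; have s2 := size_padeB n n.+1.
have s3 := size_padeC n.+1 n; have s4 := size_padeC n n.+1.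
rewrite /D coefB.
have -> : (padeB n n.+1 * padeC n.+1 n)`_M = 0.
  apply: nth_default; apply: leq_trans (coefM_top (a := n) (b := n) _ _).1 _; rewrite ?s2 // /M; lia.
rewrite subr0 (_ : M = n.+1 + n.+1)%N; last by rewrite addnS.
rewrite (coefM_top _ s4).2 ?s1 // mulf_neq0 ?padeC_lead //.
have := lead_coef_eq0 (padeB n.+1 n); rewrite lead_coefE s1 /= => ->.
by rewrite -size_poly_eq0 s1.
Qed.

(** * Sizes of the coefficients of the approximants *)

Definition absp (p : {poly int}) : {poly int} := \poly_(i < size p) `|p`_i|.
(** Sum of the absolute values of the coefficients, written as a value at [1] so that
    submultiplicativity becomes a coefficientwise comparison of [absp (p * q)] with
    [absp p * absp q]. *)
Definition l1 (p : {poly int}) : int := (absp p).[1].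

Lemma absp_coef p i : (absp p)`_i = `|p`_i|.
Proof. by rewrite coef_poly; case: ltnP => // h; rewrite nth_default // normr0. Qed.

Lemma horner1_sum (p : {poly int}) n : (size p <= n)%N -> p.[1] = \sum_(i < n) p`_i.
Proof.
move=> h; rewrite (horner_coef_wide _ h); apply: eq_bigr => i _.
by rewrite expr1n mulr1.
Qed.

Lemma size_absp (p : {poly int}) : (size (absp p) <= size p)%N.
Proof. exact: size_poly. Qed.

Lemma l1E (p : {poly int}) n : (size p <= n)%N -> l1 p = \sum_(i < n) `|p`_i|.
Proof.
move=> h; rewrite /l1 (@horner1_sum _ n) ?(leq_trans (size_absp p)) //.
by apply: eq_bigr => i _; rewrite absp_coef.
Qed.

Lemma l1_ge0 p : 0 <= l1 p.
Proof. by rewrite (l1E (leqnn _)); apply: sumr_ge0 => i _; apply: normr_ge0. Qed.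

Lemma l1D p q : l1 (p + q) <= l1 p + l1 q.
Proof.
set n := maxn (size p) (size q).
rewrite (@l1E _ n) ?size_polyD // (@l1E p n) ?leq_maxl // (@l1E q n) ?leq_maxr //.
by rewrite -big_split /=; apply: ler_sum => i _; rewrite coefD ler_normD.
Qed.

Lemma l1M p q : l1 (p * q) <= l1 p * l1 q.
Proof.
rewrite /l1 -hornerM.
set n := maxn (size (p * q)) (size (absp p * absp q)).
rewrite (@horner1_sum _ n) ?(leq_trans (size_absp _)) ?leq_maxl //.
rewrite (@horner1_sum _ n) ?leq_maxr //; apply: ler_sum => i _.
rewrite absp_coef !coefM; apply: le_trans (ler_norm_sum _ _ _) _.
by apply: ler_sum => j _; rewrite normrM !absp_coef.
Qed.

Lemma l1Z c p : l1 (c *: p) <= `|c| * l1 p.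
Proof.
rewrite (@l1E _ (size p)) ?size_scale_leq // (@l1E p (size p)) //.
by rewrite mulr_sumr; apply: ler_sum => i _; rewrite coefZ normrM.
Qed.

Lemma l1_sum (J : Type) (r : seq J) (F : J -> {poly int}) :
  l1 (\sum_(j <- r) F j) <= \sum_(j <- r) l1 (F j).
Proof.
elim/big_ind2: _ => // [|p m q k hp hq]; first by rewrite /l1 /absp size_poly0 poly_def big_ord0 horner0.
exact: le_trans (l1D _ _) (lerD hp hq).
Qed.

Lemma l1_Xn n : l1 'X^n = 1.
Proof.
rewrite (@l1E _ n.+1) ?size_polyXn // (bigD1 ord_max) //= coefXn eqxx big1 ?addr0 // => i ni.
by rewrite coefXn; move: ni; rewrite -val_eqE /= => /negPf ->.
Qed.

Lemma l1_1 : l1 1 = 1.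
Proof. by rewrite -(expr0 'X) l1_Xn. Qed.

Lemma l1_exp p n : l1 (p ^+ n) <= l1 p ^+ n.
Proof.
elim: n => [|n IH]; first by rewrite !expr0 l1_1.
by rewrite !exprS; apply: le_trans (l1M _ _) _; rewrite ler_wpM2l ?l1_ge0.
Qed.

Lemma l1_1subX : l1 (1 - 'X) = 2.
Proof.
by rewrite (@l1E _ 2) ?size_1subX // !big_ord_recl big_ord0 /= !coefB !coef1 !coefX.
Qed.

Lemma l1_comp_1subX (p : {poly int}) a : (size p <= a.+1)%N -> l1 (p \Po (1 - 'X)) <= 2 ^+ a * l1 p.
Proof.
move=> sp; rewrite comp_polyE; apply: le_trans (l1_sum _ _) _.
rewrite (l1E (leqnn (size p))) mulr_sumr; apply: ler_sum => i _.
apply: le_trans (l1Z _ _) _; rewrite mulrC ler_wpM2r //.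
apply: le_trans (l1_exp _ _) _; rewrite l1_1subX ler_weXn2l //.
by rewrite -ltnS (leq_trans _ sp).
Qed.

Lemma leq_bin_exp n m : ('C(n, m) <= 2 ^ n)%N.
Proof.
elim: n m => [|n IH] [|m] //; first by rewrite bin0 expn_gt0.
by rewrite binS expnS mul2n -addnn leq_add.
Qed.

(** This bound and the next two are crude: what matters is an exponent linear in [N]. *)
Lemma l1_padeA a c N : (a <= N)%N -> (c <= N)%N -> (0 < N)%N -> l1 (padeA a c) <= 2 ^+ (7 * N).
Proof.
move=> aN cN N0; rewrite (@l1E _ a.+1) ?size_padeA //.
apply: (@le_trans _ _ (\sum_(i < a.+1) 2 ^+ (4 * a + c).+1)).
  apply: ler_sum => i _; rewrite padeA_coef ltn_ord normrM -signr_odd normr_sign mul1r.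
  rewrite ger0_norm // -natrX ler_nat.
  apply: leq_trans (leq_mul (leq_bin_exp _ _) (leq_bin_exp _ _)) _.
  rewrite -expnD leq_exp2l //; have := ltn_ord i; lia.
rewrite sumr_const card_ord -[_ *+ a.+1]mulr_natr -!natrX -natrM ler_nat.
apply: (@leq_trans (2 ^ (4 * a + c).+1 * 2 ^ a)); first by rewrite leq_mul2l orbC ltn_expl.
by rewrite -expnD leq_exp2l //; lia.
Qed.

Lemma l1_padeB a c N : (a <= N)%N -> (c <= N)%N -> (0 < N)%N -> l1 (padeB a c) <= 2 ^+ (8 * N).
Proof.
move=> aN cN N0; apply: le_trans (l1Z _ _) _; rewrite -signr_odd normr_sign mul1r.
apply: le_trans (l1_comp_1subX (a := a) _) _; first by rewrite size_padeA.
have /(ler_wpM2l (exprn_ge0 a (ler0n int 2))) := l1_padeA aN cN N0.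
move=> /le_trans; apply; rewrite -exprD ler_weXn2l //; lia.
Qed.

Lemma l1_padeC a c N : (a <= N)%N -> (c <= N)%N -> (a + c < 2 * N)%N -> l1 (padeC a c) <= 2 ^+ (11 * N).
Proof.
move=> aN cN acN; have N0 : (0 < N)%N by lia.
rewrite padeCE; apply: le_trans (l1D _ _) _.
have e1 : l1 ('X^((a + c).+1) * padeA a c) <= 2 ^+ (10 * N).
  apply: le_trans (l1M _ _) _; rewrite l1_Xn mul1r (le_trans (l1_padeA aN cN N0)) //.
  rewrite ler_weXn2l //; lia.
have e2 : l1 ((1 - 'X) ^+ (a + c).+1 * padeB a c) <= 2 ^+ (10 * N).
  apply: le_trans (l1M _ _) _.
  apply: (@le_trans _ _ (2 ^+ (a + c).+1 * 2 ^+ (8 * N))).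
    rewrite ler_pM ?l1_ge0 ?l1_padeB //.
    by apply: le_trans (l1_exp _ _) _; rewrite l1_1subX.
  rewrite -exprD ler_weXn2l //; lia.
apply: le_trans (lerD e1 e2) _; rewrite (_ : _ + _ = 2 ^+ (10 * N).+1) ?ler_weXn2l //; last by rewrite exprS; ring.
lia.
Qed.

Definition pev (L : fieldType) (p : {poly int}) (x : L) : L := (map_poly intr p).[x].

(** Rounding to a grid of mesh [e] leaves finitely many codes. It serves twice: for the directions
    of logarithmic vectors, and for the archimedean coordinates of bounded S-integers. *)
Lemma pigeonhole_close (R : realType) (J : finType) (v : nat -> J -> R) (B e : R) : 0 < e ->
  (forall n j, `|v n j| <= B) ->
  exists a b : nat, (a < b)%N /\ forall j, `|v a j - v b j| <= e.
Proof.
move=> e0 hv; pose T := Num.truncn ((B + B) / e).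
pose code n : {ffun J -> 'I_T.+1} := [ffun j => inord (Num.truncn ((v n j + B) / e))].
have pos n j : 0 <= (v n j + B) / e.
  by rewrite divr_ge0 ?(ltW e0) //; have := hv n j; rewrite ler_norml => /andP[]; lra.
have cod n j : code n j = Num.truncn ((v n j + B) / e) :> nat.
  rewrite ffunE inordK // ltnS; apply: le_truncn.
  rewrite ler_pM2r ?invr_gt0 // lerD2r.
  by have := hv n j; rewrite ler_norml => /andP[].
pose m := #|{ffun J -> 'I_T.+1}|.
have : ~~ injectiveb (fun i : 'I_m.+1 => code i).
  apply/negP => /injectiveP /leq_card; rewrite card_ord -/m ltnn //.
case/injectivePn => a [b ab eab].
have close j : `|v a j - v b j| <= e.
  have := congr1 (fun f : {ffun J -> 'I_T.+1} => f j : nat) eab; rewrite !cod => et.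
  have /andP[a1 a2] := truncn_itv (pos a j); have /andP[b1 b2] := truncn_itv (pos b j).
  rewrite et in a1 a2; set t : nat := Num.truncn _ in a1 a2 b1 b2.
  rewrite ler_pdivlMr // in a1; rewrite ler_pdivlMr // in b1.
  rewrite ltr_pdivrMr // -natr1 mulrDl mul1r in a2; rewrite ltr_pdivrMr // -natr1 mulrDl mul1r in b2.
  rewrite ler_norml; lra.
case: (ltngtP a b) => h; [by exists a, b| |by rewrite -val_eqE /= h eqxx in ab].
by exists b, a; split=> // j; rewrite distrC.
Qed.

(** * The S-unit equation *)

Section SUnit.
Variables (R : realType) (L : fieldType) (I : finType) (nm : I -> L -> R).
Variable O : L -> Prop.
Hypothesis nm_ge0 : forall i x, 0 <= nm i x.
Hypothesis nm0 : forall i, nm i 0 = 0.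
Hypothesis nm1 : forall i, nm i 1 = 1.
Hypothesis nm_eq0 : forall i x, nm i x = 0 -> x = 0.
Hypothesis nmM : forall i x y, nm i (x * y) = nm i x * nm i y.
Hypothesis nmD : forall i x y, nm i (x + y) <= nm i x + nm i y.
Hypothesis intL_inj : forall z : int, z%:~R = 0 :> L -> z = 0.
Hypothesis O1 : O 1.
Hypothesis OB : forall x y, O x -> O y -> O (x - y).
Hypothesis OM : forall x y, O x -> O y -> O (x * y).
(** The product formula as an inequality, since the places left out have absolute value at most [1]
    on S-integers. The hypothesis after it is a Northcott property. *)
Hypothesis prod_nm_ge1 : forall t, O t -> t != 0 -> 1 <= \prod_i nm i t.
Hypothesis bounded_not_inj : forall (B : R) (t : nat -> L),
  (forall n, O (t n)) -> (forall n i, nm i (t n) <= B) -> ~ injective t.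

Let nm_gt0 i x : x != 0 -> 0 < nm i x.
Proof.
move=> x0; rewrite lt_neqAle nm_ge0 andbT eq_sym.
by apply/negP => /eqP /nm_eq0 /eqP; apply/negP.
Qed.

Let nmN i x : nm i (- x) = nm i x.
Proof.
suff e : nm i (-1) = 1 by rewrite -mulN1r nmM e mul1r.
have := nmM i (-1) (-1); rewrite mulrNN mulr1 nm1 => /esym/eqP.
rewrite -expr2 sqrf_eq1 => /orP[/eqP //|/eqP h].
by have := nm_ge0 i (-1); rewrite h oppr_ge0 ler10.
Qed.

Let nmX i x n : nm i (x ^+ n) = nm i x ^+ n.
Proof. by elim: n => [|n IH]; rewrite ?expr0 ?nm1 // !exprS nmM IH. Qed.

Let nm_sum i (J : Type) (r : seq J) (F : J -> L) :
  nm i (\sum_(j <- r) F j) <= \sum_(j <- r) nm i (F j).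
Proof.
elim/big_ind2: _ => [|p m q k hp hq|//]; first by rewrite nm0.
exact: le_trans (nmD _ _ _) (lerD hp hq).
Qed.

Let nm_int i (z : int) : nm i z%:~R <= `|z|%:~R.
Proof.
have nat_le n : nm i n%:R <= n%:R.
  elim: n => [|n IH]; first by rewrite nm0.
  by rewrite -!natr1; apply: le_trans (nmD _ _ _) _; rewrite nm1 lerD2r.
by case: z => n; rewrite ?NegzE ?mulrNz ?nmN ?normrN ?normr_nat; apply: nat_le.
Qed.

Let O0 : O 0. Proof. by rewrite -(subrr 1); apply: OB. Qed.
Let OD x y : O x -> O y -> O (x + y).
Proof. by move=> hx hy; rewrite -[y]opprK -[- y]sub0r; apply: OB => //; apply: OB. Qed.
Let OX x n : O x -> O (x ^+ n).
Proof. by move=> hx; elim: n => [|n IH]; rewrite ?expr0 // exprS; apply: OM. Qed.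
Let Oint (z : int) : O z%:~R.
Proof.
have Onat n : O n%:R by elim: n => [|n IH]; rewrite // -natr1; apply: OD.
case: z => n; first exact: Onat.
by rewrite NegzE mulrNz -sub0r; apply: OB => //; exact: Onat.
Qed.

Let pevE (p : {poly int}) (x : L) d : (size p <= d)%N ->
  pev p x = \sum_(j < d) (p`_j)%:~R * x ^+ j.
Proof.
move=> sp; rewrite /pev (@horner_coef_wide _ d) ?(leq_trans (size_poly _ _)) //.
by apply: eq_bigr => j _; rewrite coef_map.
Qed.

Let O_pev (p : {poly int}) x : O x -> O (pev p x).
Proof.
move=> hx; rewrite (pevE x (leqnn _)); elim/big_ind: _ => // j _.
by apply: OM; [apply: Oint | apply: OX].
Qed.

Let nm_pev i (p : {poly int}) x d H : (size p <= d.+1)%N -> 1 <= H -> nm i x <= H ->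
  nm i (pev p x) <= (l1 p)%:~R * H ^+ d.
Proof.
move=> sp H1 xH; rewrite (pevE x sp) (l1E sp); apply: le_trans (nm_sum _ _ _) _.
rewrite rmorph_sum /= mulr_suml; apply: ler_sum => j _.
rewrite nmM ler_pM ?nm_int // nmX.
apply: le_trans (_ : H ^+ j <= _); first by rewrite lerXn2r ?nnegrE ?(le_trans ler01 H1).
by rewrite ler_weXn2l // -ltnS ltn_ord.
Qed.

(** Local factor of the height of the projective point [(1 : x : y)]. *)
Let ht i x y : R := Num.max 1 (Num.max (nm i x) (nm i y)).

Let ht_ge1 i x y : 1 <= ht i x y. Proof. by rewrite /ht le_max lexx. Qed.
Let ht_gel i x y : nm i x <= ht i x y. Proof. by rewrite /ht !le_max lexx orbT. Qed.
Let ht_ger i x y : nm i y <= ht i x y. Proof. by rewrite /ht !le_max lexx !orbT. Qed.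

Let kap (N : nat) : R := 2 ^+ (11 * N).

Let nm_pev_kap i (p : {poly int}) N x y : (size p <= N.+1)%N -> l1 p <= 2 ^+ (11 * N) ->
  nm i (pev p x) <= kap N * ht i x y ^+ N.
Proof.
move=> sp lp; apply: le_trans (nm_pev sp (ht_ge1 i x y) (ht_gel i x y)) _.
rewrite ler_wpM2r ?exprn_ge0 ?(le_trans ler01) //.
by rewrite /kap -[2](rmorph_nat (intmul 1 : int -> R)) -rmorphXn ler_int.
Qed.

(* With [a = (A(x), B(x), -C(x))] and [b = (xi, eta, -1)] both orthogonal to
   [(x^M, y^M, 1)], this vector times the third coordinate [t] of [a x b] is [a x b]. *)
Let pade_place_bound (n a c : nat) x y xi eta i : let N := n.+1 in
  (a <= N)%N -> (c <= N)%N -> (a + c).+1 = (2 * N)%N ->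
  x + y = 1 -> xi * x ^+ (2 * N) + eta * y ^+ (2 * N) = 1 ->
  nm i (pev (padeA a c) x * eta - pev (padeB a c) x * xi) * ht i x y ^+ (2 * N) <=
  2 * kap N * ht i x y ^+ N * ht i xi eta.
Proof.
move=> N aN cN acN xy1 e1; set t := _ - _.
have hy : y = 1 - x by rewrite -xy1 addrC addKr.
have eC : pev (padeC a c) x = x ^+ (2 * N) * pev (padeA a c) x + y ^+ (2 * N) * pev (padeB a c) x.
  by rewrite /pev padeCE acN rmorphD !rmorphM !rmorphXn /= rmorphB /= rmorph1 map_polyX !hornerE hy.
set A := pev _ _ in t eC *; set B := pev _ _ in t eC *; set C := pev _ _ in eC.
have tx : t * x ^+ (2 * N) = C * eta - B.
  rewrite eC /t; transitivity (A * x ^+ (2 * N) * eta - B * (xi * x ^+ (2 * N))); first ring.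
  have -> : xi * x ^+ (2 * N) = 1 - eta * y ^+ (2 * N) by rewrite -e1 addrK.
  ring.
have ty : t * y ^+ (2 * N) = A - C * xi.
  rewrite eC /t; transitivity (A * (eta * y ^+ (2 * N)) - B * xi * y ^+ (2 * N)); first ring.
  have -> : eta * y ^+ (2 * N) = 1 - xi * x ^+ (2 * N) by rewrite -e1 addrC addKr.
  ring.
set H := ht i x y; set H' := ht i xi eta.
have N0 : (0 < N)%N by [].
have bA : nm i A <= kap N * H ^+ N.
  apply: nm_pev_kap; first by rewrite size_padeA.
  apply: le_trans (l1_padeA aN cN N0) _; rewrite ler_weXn2l //; lia.
have bB : nm i B <= kap N * H ^+ N.
  apply: nm_pev_kap; first by rewrite size_padeB.
  apply: le_trans (l1_padeB aN cN N0) _; rewrite ler_weXn2l //; lia.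
have bC : nm i C <= kap N * H ^+ N.
  apply: nm_pev_kap; first by rewrite (leq_trans (size_padeC _ _)).
  by apply: l1_padeC => //; rewrite -acN ltnSn.
have K0 : 0 <= kap N * H ^+ N by apply: le_trans bA.
have gen u v z w : nm i u <= kap N * H ^+ N -> nm i v <= kap N * H ^+ N ->
    nm i z <= H' -> nm i w <= H' -> nm i (u * z - v * w) <= 2 * kap N * H ^+ N * H'.
  move=> hu hv hz hw; apply: le_trans (nmD _ _ _) _; rewrite nmN !nmM.
  have -> : 2 * kap N * H ^+ N * H' = kap N * H ^+ N * H' + kap N * H ^+ N * H' by ring.
  by apply: lerD; apply: ler_pM.
have b1 : nm i t <= 2 * kap N * H ^+ N * H' by apply: gen; rewrite // ?ht_ger ?ht_gel.
have b2 : nm i t * nm i x ^+ (2 * N) <= 2 * kap N * H ^+ N * H'.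
  by rewrite -nmX -nmM tx -[B]mulr1; apply: gen; rewrite // ?ht_ger // nm1 ht_ge1.
have b3 : nm i t * nm i y ^+ (2 * N) <= 2 * kap N * H ^+ N * H'.
  by rewrite -nmX -nmM ty -[A]mulr1; apply: gen; rewrite // ?ht_gel // nm1 ht_ge1.
(* The maximum [H] is [1], [nm i x] or [nm i y], and [b1], [b2], [b3] treat these cases. *)
rewrite {1}/H /ht /Num.max; case: (nm i x < nm i y); by case: (_ < _); rewrite ?expr1n ?mulr1.
Qed.

(** For a nonzero [t a c], the product of its absolute values is at least [1]; multiplying the
    bounds of [pade_place_bound] over all places and cancelling [H^N] leaves the claim. *)
Let pade_height (n : nat) x y xi eta : let N := n.+1 in
  O x -> O xi -> O eta -> x != 0 ->
  x + y = 1 -> xi * x ^+ (2 * N) + eta * y ^+ (2 * N) = 1 ->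
  \prod_i ht i x y ^+ N <= \prod_i (2 * kap N * ht i xi eta).
Proof.
move=> N Ox Oxi Oeta x0 xy1 e1.
pose t a c := pev (padeA a c) x * eta - pev (padeB a c) x * xi.
suff [a [c [aN cN acN t0]]] : exists a c, [/\ (a <= N)%N, (c <= N)%N, (a + c).+1 = (2 * N)%N & t a c != 0].
  have Ot : O (t a c) by apply: OB; apply: OM => //; apply: O_pev.
  have H0 : 0 < \prod_i ht i x y ^+ N.
    by apply: prodr_gt0 => i _; rewrite exprn_gt0 // (lt_le_trans ltr01).
  rewrite -(ler_pM2r H0) -!big_split /=.
  apply: (@le_trans _ _ (\prod_i (nm i (t a c) * ht i x y ^+ (2 * N)))).
    rewrite [X in _ <= X]big_split /= -[X in X <= _]mul1r.
    have -> : \prod_i (ht i x y ^+ N * ht i x y ^+ N) = \prod_i ht i x y ^+ (2 * N).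
      by apply: eq_bigr => i _; rewrite -exprD addnn mul2n.
    rewrite ler_wpM2r ?prod_nm_ge1 // prodr_ge0 // => i _.
    by rewrite exprn_ge0 // (le_trans ler01).
  apply: ler_prod => i _; rewrite mulr_ge0 ?nm_ge0 ?exprn_ge0 ?(le_trans ler01) //=.
  apply: le_trans (pade_place_bound i aN cN acN xy1 e1) _.
  by rewrite mulrAC.
(* If both candidates vanish, [eC] gives [C * eta = B] for both approximants, so their minor
   vanishes at [x]. By [pade_minor] it equals [mu * x^(2N)], which is not zero. *)
have [t1|t1] := eqVneq (t n.+1 n) 0; last first.
  by exists n.+1, n; split => //; rewrite /N; lia.
have [t2|t2] := eqVneq (t n n.+1) 0; last first.
  by exists n, n.+1; split => //; rewrite /N; lia.
have hy : y = 1 - x by rewrite -xy1 addrC addKr.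
have eC a c : (a + c).+1 = (2 * N)%N -> t a c = 0 ->
    pev (padeC a c) x * eta = pev (padeB a c) x.
  move=> acN ta.
  have -> : pev (padeC a c) x = x ^+ (2 * N) * pev (padeA a c) x + y ^+ (2 * N) * pev (padeB a c) x.
    by rewrite /pev padeCE acN rmorphD !rmorphM !rmorphXn /= rmorphB /= rmorph1 map_polyX !hornerE hy.
  transitivity (x ^+ (2 * N) * (t a c) + pev (padeB a c) x * (xi * x ^+ (2 * N) + eta * y ^+ (2 * N))).
    rewrite /t; ring.
  by rewrite ta e1 mulr0 add0r mulr1.
have [mu mu0 D] := pade_minor n.
have E1 := eC n.+1 n _ t1; have E2 := eC n n.+1 _ t2.
have hD : pev (padeB n.+1 n) x * pev (padeC n n.+1) x -
    pev (padeB n n.+1) x * pev (padeC n.+1 n) x = mu%:~R * x ^+ ((n.+1 + n).+1).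
  by rewrite /pev -!hornerM -!rmorphM -hornerN -hornerD -rmorphB D /= map_polyZ map_polyXn hornerZ hornerXn.
have a1 : (n.+1 + n).+1 = (2 * N)%N by rewrite /N; lia.
have a2 : (n + n.+1).+1 = (2 * N)%N by rewrite /N; lia.
move: hD; rewrite -(E1 a1) -(E2 a2).
rewrite mulrAC [X in _ - X]mulrAC [X in _ - X * _]mulrC subrr => /esym/eqP.
rewrite mulf_eq0 expf_eq0 (negPf x0) andbF orbF => /eqP /intL_inj h.
by rewrite h eqxx in mu0.
Qed.

Let ln_prod (F : I -> R) : (forall i, 0 < F i) -> ln (\prod_i F i) = \sum_i ln (F i).
Proof.
move=> F0; elim: (index_enum I) => [|i r IH]; first by rewrite !big_nil ln1.
by rewrite !big_cons lnM ?posrE ?prodr_gt0 // IH.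
Qed.

Let pade_height_ln (n : nat) x y xi eta : let N := n.+1 in
  O x -> O xi -> O eta -> x != 0 ->
  x + y = 1 -> xi * x ^+ (2 * N) + eta * y ^+ (2 * N) = 1 ->
  N%:R * \sum_i ln (ht i x y) <= \sum_i (12 * N%:R * ln 2 + ln (ht i xi eta)).
Proof.
move=> N Ox Oxi Oeta x0 xy1 e1; have := pade_height Ox Oxi Oeta x0 xy1 e1; rewrite -/N.
have hp i u v : 0 < ht i u v by rewrite (lt_le_trans ltr01).
have kp : 0 < kap N by rewrite exprn_gt0.
have p1 : 0 < \prod_i ht i x y ^+ N by apply: prodr_gt0 => i _; rewrite exprn_gt0.
have p2 : 0 < \prod_i (2 * kap N * ht i xi eta) by apply: prodr_gt0 => i _; rewrite !mulr_gt0.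
rewrite -ler_ln ?posrE // !ln_prod; try by move=> i; rewrite ?exprn_gt0 // !mulr_gt0.
rewrite mulr_sumr => h; apply: le_trans (le_trans _ h) _.
  by apply: ler_sum => i _; rewrite lnXn // mulr_natl.
apply: ler_sum => i _; rewrite !lnM ?posrE ?mulr_gt0 // lerD2r /kap lnXn //.
rewrite -[ln 2 *+ _]mulr_natr natrM.
have l2 : 0 <= ln 2 :> R by rewrite ln_ge0 // ler1n.
have N1 : 1 <= N%:R :> R by rewrite ler1n.
nra.
Qed.

(** * The gap argument for solutions of the unit equation *)

Section Solutions.
Variable u : nat -> L.
Hypothesis u0 : forall n, u n != 0.
Hypothesis u1 : forall n, 1 - u n != 0.
Hypothesis Ou : forall n, O (u n).
Hypothesis OVu : forall n, O (u n)^-1.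
Hypothesis Ou1 : forall n, O (1 - u n).
Hypothesis OVu1 : forall n, O (1 - u n)^-1.
Hypothesis u_inj : injective u.

Let h n : R := \sum_i ln (ht i (u n) (1 - u n)).

Let ln_ht_ge0 i x y : 0 <= ln (ht i x y). Proof. exact: ln_ge0. Qed.

Let ln_le_ht i x y z : z != 0 -> nm i z <= ht i x y -> ln (nm i z) <= ln (ht i x y).
Proof. by move=> z0 hz; rewrite ler_ln ?posrE ?nm_gt0 // (lt_le_trans ltr01). Qed.

Let h_ge0 n : 0 <= h n. Proof. by apply: sumr_ge0 => i _; apply: ln_ht_ge0. Qed.

Let ln_ht_le_h i n : ln (ht i (u n) (1 - u n)) <= h n.
Proof. by rewrite /h (bigD1 i) //= lerDl sumr_ge0. Qed.

(** The lower bound comes from the product formula: the logarithms have nonnegative sum, so a very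
    negative one must be compensated at the other places, where the height bounds them. *)
Let unit_ln_bound i z n : O z -> z != 0 ->
  (forall j, nm j z <= ht j (u n) (1 - u n)) -> `|ln (nm i z)| <= h n.
Proof.
move=> Oz z0 hz; rewrite ler_norml (le_trans (ln_le_ht z0 (hz i)) (ln_ht_le_h i n)) andbT.
have := ln_ge0 (prod_nm_ge1 Oz z0); rewrite ln_prod; last by move=> j; apply: nm_gt0.
rewrite (bigD1 i) //= -lerBlDr sub0r; apply: le_trans; rewrite lerN2.
rewrite /h [X in _ <= X](bigD1 i) //= -[X in X <= _]add0r lerD //.
by apply: ler_sum => j _; apply: ln_le_ht.
Qed.

Let lnx_bound i n : `|ln (nm i (u n))| <= h n.
Proof. by apply: unit_ln_bound => // j; rewrite ht_gel. Qed.

Let lny_bound i n : `|ln (nm i (1 - u n))| <= h n.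
Proof. by apply: unit_ln_bound => // j; rewrite ht_ger. Qed.

Let h_unbounded B : exists n, B < h n.
Proof.
apply: contrapT => hB; apply: (bounded_not_inj (B := expR B) Ou) u_inj => n i.
rewrite -[nm i _]lnK ?posrE ?nm_gt0 // ler_expR.
apply: le_trans (ler_norm _) _; apply: le_trans (lnx_bound i n) _.
by rewrite leNgt; apply/negP => ?; apply: hB; exists n.
Qed.

Let nm_div i z w M : z != 0 -> w != 0 -> ln (nm i (z / w ^+ M)) = ln (nm i z) - M%:R * ln (nm i w).
Proof.
move=> z0 w0; have e : z = z / w ^+ M * w ^+ M by rewrite divfK // expf_neq0.
have := congr1 (fun t => ln (nm i t)) e; rewrite nmM nmX lnM.
- by rewrite lnXn ?nm_gt0 // -[ln (nm i w) *+ M]mulr_natl => ->; rewrite addrK.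
- by rewrite posrE nm_gt0 // mulf_neq0 ?invr_neq0 ?expf_neq0.
- by rewrite posrE exprn_gt0 ?nm_gt0.
Qed.

Lemma no_injective_unit_solutions : False.
Proof.
set s : R := #|I|%:R; have s0 : 0 <= s by rewrite ler0n.
have l2 : 0 < ln 2 :> R by rewrite ln_gt0 // ltr1n.
(* With [p < q] the two heights, the final inequality is [N p <= s (12 N ln 2 + 2 p + e q)], where
   [q < (2N+2) p]. To refute it, [c] makes the first term at most [N p / 8], [e] ensures
   [s e <= 1/8], and [Rt] forces [N > 4 s + 1]. *)
pose c := 96 * s * ln 2 + 1; pose Rt : R := 8 * s + 4; pose e := (8 * (s + 1))^-1.
have c0 : 0 < c by rewrite /c; have := mulr_ge0 s0 (ltW l2); lra.
have e0 : 0 < e by rewrite invr_gt0; lra.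
have /choice [nxt hnxt] : forall B, exists n, B < h n by exact: h_unbounded.
(* A subsequence whose heights exceed [c] and grow at each step by a factor above [Rt], so that any
   pair selected by the pigeonhole principle has well separated heights. *)
pose sq := fix sq k := if k is k'.+1 then nxt (Rt * h (sq k')) else nxt c.
have Rt1 : 1 <= Rt by rewrite /Rt; lra.
have step k : Rt * h (sq k) < h (sq k.+1) by exact: hnxt.
have mono k l : (k <= l)%N -> h (sq k) <= h (sq l).
  move=> /subnK <-; elim: (l - k)%N => // d IH; apply: le_trans IH _; rewrite addSn.
  by apply: le_trans (ltW (step _)); rewrite ler_peMl ?h_ge0.
have hc k : c < h (sq k) by apply: lt_le_trans (mono 0%N k (leq0n k)); exact: hnxt.
pose v k (j : I + I) := match j with
  | inl i => ln (nm i (u (sq k))) / h (sq k)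
  | inr i => ln (nm i (1 - u (sq k))) / h (sq k) end.
have hpos k : 0 < h (sq k) by apply: lt_trans (hc k).
have vb k j : `|v k j| <= 1.
  by case: j => i /=; rewrite normrM normfV (gtr0_norm (hpos k)) ler_pdivrMr // mul1r.
have [a [b [ab close]]] := pigeonhole_close e0 vb.
set p := h (sq a) in close *; set q := h (sq b) in close *.
have p0 : 0 < p := hpos a. have q0 : 0 < q := hpos b.
have pq : Rt * p < q by apply: lt_le_trans (step a) (mono _ _ ab).
have cp : c < p := hc a.
(* The power [x^(2N)] then has about the height of [x'], so that [xi = x' / x^(2N)] and [eta] are
   small when the directions nearly agree. *)
pose N := Num.truncn (q / p / 2).
have /truncn_itv /andP[N1 N2] : 0 <= q / p / 2 by rewrite !divr_ge0 // ltW.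
rewrite -/N in N1 N2.
have N1' : 2 * N%:R * p <= q by move: N1; rewrite ler_pdivlMr // ler_pdivlMr // [2 * _]mulrC.
have N2' : q < (2 * N%:R + 2) * p.
  by move: N2; rewrite ltr_pdivrMr // ltr_pdivrMr // -natr1; lra.
have Nbig : 4 * s + 1 < N%:R :> R.
  rewrite -(ltr_pM2r p0); move: pq N2'; rewrite /Rt; nra.
have N0 : (0 < N)%N by rewrite -(ltr_nat R); lra.
have [n Nn] : exists n, N = n.+1 by exists N.-1; rewrite prednK.
set x := u (sq a); set x' := u (sq b); set y := 1 - x; set y' := 1 - x'.
have hx0 : x != 0 := u0 _. have hy0 : y != 0 := u1 _.
have hx'0 : x' != 0 := u0 _. have hy'0 : y' != 0 := u1 _.
have Odiv z w M : O z -> O w^-1 -> O (z / w ^+ M).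
  by move=> Oz Ow; rewrite -exprVn; apply: OM => //; apply: OX.
have e1 : x' / x ^+ (2 * N) * x ^+ (2 * N) + y' / y ^+ (2 * N) * y ^+ (2 * N) = 1.
  by rewrite !divfK ?expf_neq0 // /y' addrC subrK.
set xi := x' / x ^+ (2 * N); set eta := y' / y ^+ (2 * N).
(* Two errors add up: [e q] from the difference of directions and [2 p] from the rounding of [q / p]
   to an even integer. *)
have dev (w : nat -> R) : `|w (sq a)| <= p ->
    `|w (sq a) / p - w (sq b) / q| <= e -> `|w (sq b) - (2 * N)%:R * w (sq a)| <= 2 * p + e * q.
  move=> wp wd.
  have -> : w (sq b) - (2 * N)%:R * w (sq a) =
      - q * (w (sq a) / p - w (sq b) / q) + (q / p - (2 * N)%:R) * w (sq a).
    by field; rewrite !gt_eqF.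
  have D1 : `|- q * (w (sq a) / p - w (sq b) / q)| <= e * q.
    by rewrite normrM normrN (gtr0_norm q0) mulrC ler_wpM2r // ltW.
  have D2 : `|(q / p - (2 * N)%:R) * w (sq a)| <= 2 * p.
    rewrite normrM; apply: ler_pM => //; rewrite ger0_norm natrM; last first.
      by rewrite subr_ge0 ler_pdivlMr.
    by rewrite lerBlDr ler_pdivrMr // addrC ltW.
  by apply: le_trans (ler_normD _ _) _; rewrite [2 * p + _]addrC lerD.
have hb i : ln (ht i xi eta) <= 2 * p + e * q.
  have b0 : 0 <= 2 * p + e * q by rewrite addr_ge0 // mulr_ge0 // ltW.
  have bx : ln (nm i xi) <= 2 * p + e * q.
    rewrite nm_div //; apply: le_trans (ler_norm _) _.
    apply: (dev (fun k => ln (nm i (u k)))); first exact: lnx_bound.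
    exact: (close (inl i)).
  have bY : ln (nm i eta) <= 2 * p + e * q.
    rewrite nm_div //; apply: le_trans (ler_norm _) _.
    apply: (dev (fun k => ln (nm i (1 - u k)))); first exact: lny_bound.
    exact: (close (inr i)).
  by rewrite /ht /Num.max; case: (nm i xi < nm i eta); case: (1 < _); rewrite ?ln1.
have xy1 : x + y = 1 by rewrite /y addrC subrK.
have := pade_height_ln (n := n) (Ou (sq a)) (Odiv x' x (2 * N)%N (Ou _) (OVu _))
  (Odiv y' y (2 * N)%N (Ou1 _) (OVu1 _)) hx0 xy1.
rewrite -Nn -/xi -/eta => /(_ e1); rewrite -[X in N%:R * X]/p.
have sumb : \sum_i (12 * N%:R * ln 2 + ln (ht i xi eta)) <= s * (12 * N%:R * ln 2 + 2 * p + e * q).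
  rewrite /s -sum1_card natr_sum mulr_suml; apply: ler_sum => i _.
  by rewrite mul1r -addrA lerD2l.
move=> /le_trans /(_ sumb).
have se : s * e <= 8^-1.
  by rewrite /e invfM mulrCA ler_piMr ?invr_ge0 // ler_pdivrMr ?mul1r; lra.
have t1 : s * (12 * N%:R * ln 2) <= N%:R * p / 8.
  have : 96 * s * ln 2 * N%:R <= p * N%:R by rewrite ler_wpM2r //; rewrite /c in cp; lra.
  lra.
have t2 : s * (e * q) <= 8^-1 * ((2 * N%:R + 2) * p).
  by rewrite mulrA; apply: ler_pM => //; [rewrite mulr_ge0 // ltW | exact: ltW | exact: ltW].
rewrite leNgt => /negP; apply.
have Np : (4 * s + 1) * p < N%:R * p by rewrite ltr_pM2r.
have sp : 0 <= s * p by rewrite mulr_ge0 // ltW.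
rewrite !mulrDr; lra.
Qed.
End Solutions.

Theorem finitely_many_unit_solutions (u : nat -> L) :
  (forall n, [/\ O (u n), O (u n)^-1, O (1 - u n) & O (1 - u n)^-1]) ->
  (forall n, u n != 0 /\ 1 - u n != 0) -> ~ injective u.
Proof.
move=> h1 h2 ui.
by apply: (no_injective_unit_solutions (u := u)) => // n; case: (h1 n) => //; case: (h2 n).
Qed.
End SUnit.

(** * Valuation rings *)

Section Valring.
Variable F : fieldType.
Implicit Types (V : F -> Prop) (x y z : F).

(* [valring V] allows [V] to be the whole field. *)
Record valring V : Prop := Valring {
  vr1 : V 1;
  vrB : forall x y, V x -> V y -> V (x - y);
  vrM : forall x y, V x -> V y -> V (x * y);
  vr_total : forall x, V x \/ V x^-1 }.

(* The maximal ideal; the disjunct [x = 0] is needed because [0^-1 = 0]. *)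
Definition vmax V x := x = 0 \/ ~ V x^-1.
Definition vunit V x := [/\ x != 0, V x & V x^-1].

Variable V : F -> Prop.
Hypothesis hV : valring V.

Lemma vr0 : V 0. Proof. by rewrite -(subrr 1); apply: (vrB hV); apply: (vr1 hV). Qed.
Lemma vrN x : V x -> V (- x).
Proof. by move=> hx; rewrite -sub0r; apply: (vrB hV) => //; apply: vr0. Qed.
Lemma vrD x y : V x -> V y -> V (x + y).
Proof. by move=> hx hy; rewrite -[y]opprK; apply: (vrB hV) => //; apply: vrN. Qed.
Lemma vrX x n : V x -> V (x ^+ n).
Proof. by move=> hx; elim: n => [|n IH]; [apply: (vr1 hV) | rewrite exprS; apply: (vrM hV)]. Qed.
Lemma vr_sum (I : Type) (r : seq I) (P : pred I) (f : I -> F) :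
  (forall i, P i -> V (f i)) -> V (\sum_(i <- r | P i) f i).
Proof. by move=> h; elim/big_ind: _; [apply: vr0 | apply: vrD | ]. Qed.
Lemma vr_nat n : V n%:R.
Proof. by elim: n => [|n IH]; [apply: vr0 | rewrite -natr1; apply: vrD => //; apply: (vr1 hV)]. Qed.
Lemma vr_int (z : int) : V z%:~R.
Proof. by case: z => n; [apply: vr_nat | rewrite NegzE mulrNz; apply/vrN/vr_nat]. Qed.
Lemma vr_horner (p : {poly F}) x : (forall i, V p`_i) -> V x -> V p.[x].
Proof.
move=> hp hx; rewrite horner_coef; apply: vr_sum => i _.
by apply: (vrM hV) => //; apply: vrX.
Qed.

Lemma vmax_V x : vmax V x -> V x.
Proof. by case=> [->|h]; [apply: vr0 | case: (vr_total hV x)]. Qed.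
Lemma vmax0 : vmax V 0. Proof. by left. Qed.
Lemma vmaxMl a x : V a -> vmax V x -> vmax V (a * x).
Proof.
move=> ha [->|h]; first by left; rewrite mulr0.
have [->|a0] := eqVneq a 0; first by left; rewrite mul0r.
right => h2; apply: h; have := vrM hV ha h2.
by rewrite invfM mulrA divff // mul1r.
Qed.
Lemma vmaxMr a x : V a -> vmax V x -> vmax V (x * a).
Proof. by rewrite mulrC; apply: vmaxMl. Qed.
Lemma vmaxD x y : vmax V x -> vmax V y -> vmax V (x + y).
Proof.
move=> hx hy; have [->|x0] := eqVneq x 0; first by rewrite add0r.
have [->|y0] := eqVneq y 0; first by rewrite addr0.
have V1 := vr1 hV; case: (vr_total hV (x / y)) => h.
  have -> : x + y = (x / y + 1) * y by rewrite mulrDl divfK // mul1r.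
  by apply: vmaxMl => //; apply: vrD.
rewrite invf_div in h.
have -> : x + y = (1 + y / x) * x by rewrite mulrDl divfK // mul1r.
by apply: vmaxMl => //; apply: vrD.
Qed.
Lemma vmaxN x : vmax V x -> vmax V (- x).
Proof. by move=> h; rewrite -mulN1r; apply: vmaxMl => //; apply/vrN/(vr1 hV). Qed.
Lemma vmaxB x y : vmax V x -> vmax V y -> vmax V (x - y).
Proof. by move=> hx hy; apply: vmaxD => //; apply: vmaxN. Qed.
Lemma vmax_sum (I : Type) (r : seq I) (P : pred I) (f : I -> F) :
  (forall i, P i -> vmax V (f i)) -> vmax V (\sum_(i <- r | P i) f i).
Proof. by move=> h; elim/big_ind: _; [apply: vmax0 | apply: vmaxD | ]. Qed.
Lemma vmax_unit x : vunit V x -> ~ vmax V x.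
Proof. by case=> x0 _ hx [xe|]; [rewrite xe eqxx in x0 | ]. Qed.
Lemma vunit1 : vunit V 1.
Proof. by split; rewrite ?invr1 ?oner_neq0 //; apply: (vr1 hV). Qed.
Lemma vmax1 : ~ vmax V 1. Proof. exact/vmax_unit/vunit1. Qed.
Lemma vmax_or_unit x : V x -> vmax V x \/ vunit V x.
Proof.
move=> hx; have [->|x0] := eqVneq x 0; first by left; left.
by case: (pselect (V x^-1)) => h; [right | left; right].
Qed.
Lemma nvmax_unit x : V x -> ~ vmax V x -> vunit V x.
Proof. by move=> /vmax_or_unit []. Qed.
Lemma vunitM x y : vunit V x -> vunit V y -> vunit V (x * y).
Proof.
case=> x0 hx hx' [y0 hy hy']; split; first by rewrite mulf_neq0.
  exact: (vrM hV). by rewrite invfM; apply: (vrM hV).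
Qed.
Lemma vunitV x : vunit V x -> vunit V x^-1.
Proof. by case=> x0 hx hx'; split; rewrite ?invr_eq0 ?invrK. Qed.
Lemma vunitX x n : vunit V x -> vunit V (x ^+ n).
Proof. by move=> hx; elim: n => [|n IH]; [apply: vunit1 | rewrite exprS; apply: vunitM]. Qed.
Lemma vmax_prime x y : V x -> V y -> vmax V (x * y) -> vmax V x \/ vmax V y.
Proof.
move=> /vmax_or_unit [h|hx]; first by left.
move=> /vmax_or_unit [h|hy]; first by right.
by move/vmax_unit: (vunitM hx hy).
Qed.
(** Otherwise [x^-1] lies in the maximal ideal, and dividing the equation by the top power of [x]
    puts [1] there. *)
Lemma vr_integral (p : {poly F}) x : p \is monic -> (forall i, V p`_i) -> root p x -> V x.
Proof.
move=> pm hp /rootP px; apply: contrapT => hx.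
have mx : vmax V x^-1 by right; rewrite invrK.
have x0 : x != 0 by apply: contra_notN hx => /eqP ->; apply: vr0.
have p0 : size p != 0%N by rewrite size_poly_eq0 monic_neq0.
have sp : size p = (size p).-1.+1 by rewrite prednK // lt0n.
move: px; rewrite horner_coef sp big_ord_recr /=.
rewrite -lead_coefE (monicP pm) mul1r => /eqP; rewrite addrC addr_eq0 => /eqP e.
apply: vmax1; have <- : x ^+ (size p).-1 * x^-1 ^+ (size p).-1 = 1.
  by rewrite -exprMn divff // expr1n.
rewrite e mulNr mulr_suml; apply/vmaxN/vmax_sum => i _.
rewrite -mulrA; apply: vmaxMl => //.
rewrite -[X in x^-1 ^+ X](subnKC (ltnW (ltn_ord i))) exprD mulrA -exprMn divff // expr1n mul1r.
have : (0 < (size p).-1 - i)%N by rewrite subn_gt0.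
case: (_ - _)%N => // k _; rewrite exprS; apply: vmaxMr => //.
by apply/vrX/vmax_V.
Qed.

End Valring.

Lemma valring_comp (F E : fieldType) (f : {rmorphism F -> E}) (V : E -> Prop) :
  valring V -> valring (fun x => V (f x)).
Proof.
move=> hV; split; first by rewrite rmorph1; apply: (vr1 hV).
- by move=> x y hx hy; rewrite rmorphB; apply: (vrB hV).
- by move=> x y hx hy; rewrite rmorphM; apply: (vrM hV).
by move=> x; rewrite fmorphV; apply: (vr_total hV).
Qed.

(* A subring maximal among those not containing [q^-1] is a valuation ring. *)
Section Existence.
Variables (F : fieldType) (l : nat).
Let q : F := l%:R.
Hypothesis q0 : q != 0.
Hypothesis q_nonunit : forall z : int, q^-1 != z%:~R.
Local Open Scope classical_set_scope.

(** The clause on [1] is conditional because the empty chain has empty union, which must be [good]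
    for Zorn's lemma. A maximal [A] does contain [1]: if not it would be empty, hence smaller than
    the image of the integers. *)
Let good (A : set F) : Prop := [/\ forall x, A x -> A 1,
  forall x y, A x -> A y -> A (x - y), forall x y, A x -> A y -> A (x * y) & ~ A q^-1].

Lemma exists_maximal : exists A, good A /\ forall B, A `<` B -> ~ good B.
Proof.
apply: Zorn_bigcup => C CP tot; split.
- by move=> x [X CX Xx]; exists X => //; case: (CP _ CX) => /(_ x Xx).
- move=> x y [X CX Xx] [Y CY Yy]; case: (tot _ _ CX CY) => s.
    by exists Y => //; case: (CP _ CY) => _ h _ _; apply: h => //; apply: s.
  by exists X => //; case: (CP _ CX) => _ h _ _; apply: h => //; apply: s.
- move=> x y [X CX Xx] [Y CY Yy]; case: (tot _ _ CX CY) => s.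
    by exists Y => //; case: (CP _ CY) => _ _ h _; apply: h => //; apply: s.
  by exists X => //; case: (CP _ CX) => _ _ h _; apply: h => //; apply: s.
- by move=> [X CX Xx]; case: (CP _ CX).
Qed.

Section Maximal.
Variable A : set F.
Hypothesis gA : good A.
Hypothesis maxA : forall B, A `<` B -> ~ good B.

Let A1 : A 1.
Proof.
case: gA => h1 hB hM hq; apply: contrapT => n1.
pose Z := [set x : F | exists z : int, x = z%:~R].
apply: (maxA (B := Z)).
  rewrite properEneq; split; last by move=> x /h1.
  by apply/eqP => e; apply: n1; rewrite e; exists 1.
split; first by exists 1.
- by move=> _ _ [z ->] [w ->]; exists (z - w); rewrite rmorphB.
- by move=> _ _ [z ->] [w ->]; exists (z * w); rewrite rmorphM.
by move=> [z e]; have := q_nonunit z; rewrite e eqxx.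
Qed.
Let AB x y : A x -> A y -> A (x - y). Proof. by case: gA => _ h _ _; apply: h. Qed.
Let AM x y : A x -> A y -> A (x * y). Proof. by case: gA => _ _ h _; apply: h. Qed.
Let Aq : ~ A q^-1. Proof. by case: gA. Qed.
Let A0 : A 0. Proof. by rewrite -(subrr 1); apply: AB. Qed.
Let AN x : A x -> A (- x). Proof. by move=> h; rewrite -sub0r; apply: AB. Qed.
Let AD x y : A x -> A y -> A (x + y).
Proof. by move=> hx hy; rewrite -[y]opprK; apply: AB => //; apply: AN. Qed.
Let AX x n : A x -> A (x ^+ n).
Proof. by move=> hx; elim: n => [|n IH]; rewrite ?expr0 // exprS; apply: AM. Qed.
Let A_sum (I : Type) (r : seq I) (P : pred I) (f : I -> F) :
  (forall i, P i -> A (f i)) -> A (\sum_(i <- r | P i) f i).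
Proof. by move=> h; elim/big_ind: _. Qed.

Let polyA (p : {poly F}) := forall i, A p`_i.

Let adjoin x : ~ A x -> exists2 p, polyA p & p.[x] = q^-1.
Proof.
move=> nx; apply: contrapT => H.
pose B := [set y : F | exists2 p, polyA p & p.[x] = y].
apply: (maxA (B := B)).
  rewrite properEneq; split; last first.
    move=> y Ay; exists y%:P; last by rewrite hornerC.
    by move=> i; rewrite coefC; case: ifP.
  apply/eqP => e; apply: nx; rewrite e; exists 'X; last by rewrite hornerX.
  by move=> i; rewrite coefX; case: (_ == _).
split.
- move=> _ _; exists 1%:P; last by rewrite hornerC.
  by move=> i; rewrite coefC; case: (_ == _).
- move=> _ _ [p hp <-] [r hr <-]; exists (p - r); last by rewrite !hornerE.
  by move=> i; rewrite coefB; apply: AB.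
- move=> _ _ [p hp <-] [r hr <-]; exists (p * r); last by rewrite hornerM.
  by move=> i; rewrite coefM; apply: A_sum => j _; apply: AM.
- exact: H.
Qed.

Let Aq1 : A q. Proof. by rewrite /q; elim: (l) => [|n IH] //; rewrite -natr1; apply: AD. Qed.

(** With [s = 1 + q y], if [s^-1] were missing from [A] then [q^-1] would be a polynomial in [s^-1]
    over [A]. Multiplication by a power [s^n = 1 + q r] clears the denominators and puts [q^-1 + r]
    in [A]. *)
Let unit_1q y : A y -> A (1 + q * y)^-1.
Proof.
move=> Ay; apply: contrapT => nA; have [p hp e] := adjoin nA.
set s := 1 + q * y in nA e.
have s0 : s != 0 by apply: contra_notN nA => /eqP ->; rewrite invr0.
have As : A s by apply: AD => //; apply: AM.
have [r Ar er] : exists2 r, A r & s ^+ size p = 1 + q * r.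
  elim: (size p) => [|k [r Ar er]]; first by exists 0; rewrite // mulr0 addr0.
  exists (r + y + q * y * r); last by rewrite exprS er /s; ring.
  by apply: AD; [apply: AD | apply: AM => //; apply: AM].
have As2 : A (s ^+ size p * p.[s^-1]).
  rewrite horner_coef mulr_sumr; apply: A_sum => i _; rewrite mulrCA; apply: AM => //.
  rewrite -[X in s ^+ X](subnK (ltnW (ltn_ord i))) exprD -mulrA -exprMn divff // expr1n mulr1.
  exact: AX.
apply: Aq; have -> : q^-1 = s ^+ size p * p.[s^-1] - r.
  by rewrite e er mulrDl mul1r mulrAC divff // mul1r addrK.
exact: AB.
Qed.

(** Multiplying [r(x^-1) = q^-1] by [q x^(n+1)] gives [(1 - q r_0) x^(n+1)] as [q] times lower
    powers of [x]. The factor [1 - q r_0] is a unit by [unit_1q], so the top term of [p] can be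
    replaced. *)
Let reduce n m x (p r : {poly F}) : x != 0 -> (m <= n)%N ->
  polyA p -> (size p <= n.+2)%N -> p.[x] = q^-1 ->
  polyA r -> (size r <= m.+2)%N -> r.[x^-1] = q^-1 ->
  exists2 s, polyA s & (size s <= n.+1)%N /\ s.[x] = q^-1.
Proof.
move=> x0 mn hp sp ep hr sr er.
set u := 1 - q * r`_0.
have Au : A u^-1 by rewrite /u -mulrN; apply: unit_1q; apply: AN.
have u0 : u != 0.
  apply: contra_notN Aq; rewrite subr_eq0 => /eqP e.
  by rewrite -[q^-1]mulr1 e mulKf.
pose s := \poly_(i < n.+1) (u^-1 * r`_(n.+1 - i)).
have hs : polyA s by move=> i; rewrite coef_poly; case: ifP => // _; apply: AM.
have es : x ^+ n.+1 = q * s.[x].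
  have e1 : x ^+ n.+1 * r.[x^-1] = r`_0 * x ^+ n.+1 + \sum_(i < n.+1) r`_(n.+1 - i) * x ^+ i.
    rewrite (@horner_coef_wide _ n.+2); last by rewrite (leq_trans sr).
    rewrite mulr_sumr (reindex_inj rev_ord_inj) big_ord_recr /= subnn addrC; congr (_ + _).
      by rewrite expr0 mulr1 mulrC.
    apply: eq_bigr => i _; rewrite subSS mulrCA; congr (_ * _).
    have hi : (i <= n.+1)%N by rewrite ltnW // ltn_ord.
    by rewrite -{1}(subnK hi) addnC exprD -mulrA -exprMn divff // expr1n mulr1.
  have e2 : s.[x] = u^-1 * \sum_(i < n.+1) r`_(n.+1 - i) * x ^+ i.
    rewrite horner_poly mulr_sumr; apply: eq_bigr => i _; by rewrite mulrA.
  rewrite e2; apply: (mulfI u0); rewrite mulrCA mulVKf //.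
  move/(congr1 (fun t => q * t)): e1; rewrite er mulrCA divff // mulr1 mulrDr => e1.
  by rewrite /u mulrBl mul1r {1}e1 mulrA addrC addKr.
exists (\poly_(i < n.+1) p`_i + (q * p`_n.+1) *: s).
  by move=> i; rewrite coefD coefZ coef_poly; apply: AD; [case: ifP | apply: AM => //; apply: AM].
split.
  apply: leq_trans (size_polyD _ _) _; rewrite geq_max size_poly.
  by apply: leq_trans (size_scale_leq _ _) _; rewrite size_poly.
rewrite hornerD hornerZ -ep (horner_coef_wide _ sp) big_ord_recr /= es horner_poly.
by rewrite mulrCA mulrA.
Qed.

Lemma maximal_valring : valring A.
Proof.
split=> // x; apply: contrapT => /not_orP [nx nVx].
have x0 : x != 0 by apply: contra_notN nx => /eqP ->.
(* Descent on the sum of the two degrees: the longer of the expressions of [q^-1] in [y] and in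
   [y^-1] is shortened by [reduce], until one is constant and [q^-1] falls into [A]. *)
have H : forall N n m y (p r : {poly F}), (n + m <= N)%N -> y != 0 -> ~ A y -> ~ A y^-1 ->
    polyA p -> (size p <= n.+1)%N -> p.[y] = q^-1 ->
    polyA r -> (size r <= m.+1)%N -> r.[y^-1] = q^-1 -> False.
  elim=> [|N IH] n m y p r nmN y0 ny nVy hp sp ep hr sr er.
    move: nmN; rewrite leqn0 addn_eq0 => /andP[/eqP n0 _]; rewrite n0 in sp.
    by apply: Aq; rewrite -ep (size1_polyC sp) hornerC.
  case: n => [|n] in sp nmN; first by apply: Aq; rewrite -ep (size1_polyC sp) hornerC.
  case: m => [|m] in sr nmN; first by apply: Aq; rewrite -er (size1_polyC sr) hornerC.
  case: (leqP m n) => mn.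
    have [s hs [ss es]] := reduce y0 mn hp sp ep hr sr er.
    by apply: (IH n m.+1 y s r) => //; lia.
  have yV0 : y^-1 != 0 by rewrite invr_eq0.
  have ep' : p.[y^-1^-1] = q^-1 by rewrite invrK.
  have [s hs [ss es]] := reduce yV0 (ltnW mn) hr sr er hp sp ep'.
  by apply: (IH n.+1 m y p s) => //; lia.
have [p hp ep] := adjoin nx; have [r hr er] := adjoin nVx.
exact: (H _ _ _ _ _ _ (leqnn _) x0 nx nVx hp (leqnSn _) ep hr (leqnSn _) er).
Qed.
End Maximal.

Lemma exists_valring : exists V : F -> Prop, valring V /\ ~ V q^-1.
Proof.
by have [A [gA mA]] := exists_maximal; exists A; split; [apply: (maximal_valring gA) | case: gA].
Qed.
End Existence.

(** * Algebraic numbers in valuation rings *)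

Section Algebraic.
Variable K : fieldExtType rat.
Implicit Types (x : K) (P : {poly int}).

Lemma intK_eq0 (z : int) : (z%:~R == 0 :> K) = (z == 0).
Proof.
by rewrite -(rmorph_int (in_alg K)) fmorph_eq0 intr_eq0.
Qed.

Lemma alg_int_poly x : exists2 P : {poly int}, P != 0 & root (map_poly intr P) x.
Proof.
have [p pm px] := alg_integral x; have [q [a a0 pe]] := rat_poly_scale p.
exists q; first by apply: contraTneq pm => q0; rewrite pe q0 rmorph0 scaler0 monicE lead_coef0 eq_sym oner_eq0.
move: px; rewrite pe map_polyZ /= rootZ; last by rewrite scaler_eq0 oner_eq0 orbF invr_eq0 intr_eq0.
rewrite -map_poly_comp /=; congr (root _ x).
by apply: eq_map_poly => z /=; rewrite -[RHS](rmorph_int (in_alg K)).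
Qed.

Lemma alg_int_poly0 x : x != 0 ->
  exists2 P : {poly int}, P`_0 != 0 & root (map_poly intr P) x.
Proof.
move=> x0; have [P P0 rP] := alg_int_poly x.
elim/poly_ind: P P0 rP => [|P c IH]; first by rewrite eqxx.
have [->|c0 _ r] := eqVneq c 0; last by exists (P * 'X + c%:P); rewrite // coefD coefMX coefC /= add0r.
rewrite addr0 mulf_eq0 polyX_eq0 orbF rmorphM /= map_polyX rootM rootX (negPf x0) orbF.
exact: IH.
Qed.

(** Take for [m] the product, up to sign, of the leading and constant coefficients of an integer
    polynomial killing [x]. When both are invertible in [V], [x] is integral over [V], and solving
    the equation for [x^-1] puts the inverse in [V] as well. *)
Lemma unit_multiplier x : x != 0 -> exists2 m : nat, (0 < m)%N &
  forall V, valring V -> V (m%:R)^-1 -> vunit V x.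
Proof.
move=> x0; have [P P0 rP] := alg_int_poly0 x0.
pose Q : {poly K} := map_poly intr P.
have Pn0 : P != 0 by apply: contraNneq P0 => ->; rewrite coef0.
have sQ : size Q = size P by rewrite size_map_poly_id0 // intK_eq0 lead_coef_eq0.
have QE i : Q`_i = (P`_i)%:~R by rewrite coef_map.
exists `|(lead_coef P * P`_0)%R|%N.
  by rewrite absz_gt0 mulf_neq0 // lead_coef_eq0.
move=> V hV hm.
have l0 : lead_coef P != 0 by rewrite lead_coef_eq0.
have hz (z w : int) : z != 0 -> w != 0 -> `|(lead_coef P * P`_0)%R|%N = `|(z * w)%R|%N -> V (z%:~R)^-1.
  move=> z0 w0 e; have : V ((z * w)%:~R^-1).
    move: hm; rewrite e; case: (z * w) => n //=.
    by rewrite NegzE mulrNz invrN => h; apply: vrN.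
  have := vr_int hV w => /(vrM hV) h /h.
  by rewrite intrM invfM mulrCA divff ?mulr1 // intK_eq0.
have Vl : V ((lead_coef P)%:~R)^-1 by apply: hz (P`_0) _ _ _.
have V0 : V ((P`_0)%:~R)^-1 by apply: hz (lead_coef P) _ _ _; rewrite // mulrC.
have lQ : lead_coef Q = (lead_coef P)%:~R by rewrite !lead_coefE sQ QE.
have Vx : V x.
  apply: (vr_integral hV (p := (lead_coef Q)^-1 *: Q)).
  - by rewrite monicE lead_coefZ mulVf // lQ intK_eq0.
  - by move=> i; rewrite coefZ QE lQ; apply: (vrM hV) => //; apply: vr_int.
  - by rewrite rootZ // invr_eq0 lQ intK_eq0.
split=> //; have := rP; rewrite -/Q /root horner_coef.
have -> : size Q = (size Q).-1.+1 by rewrite prednK // lt0n size_poly_eq0 -size_poly_eq0 sQ size_poly_eq0.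
rewrite big_ord_recl /= expr0 mulr1 addrC addr_eq0 => /eqP e.
have Q0 : Q`_0 != 0 by rewrite QE intK_eq0.
have -> : x^-1 = - (Q`_0)^-1 * \sum_(i < (size Q).-1) Q`_i.+1 * x ^+ i.
  apply: (mulIf x0); rewrite mulVf // -mulrA mulr_suml.
  rewrite (eq_bigr (fun i : 'I_(size Q).-1 => Q`_(bump 0 i) * x ^+ bump 0 i)).
    by rewrite e mulrNN mulVf.
  by move=> i _; rewrite -mulrA -exprSr.
apply: (vrM hV); first by apply: vrN => //; rewrite QE.
by apply: vr_sum => // i _; apply: (vrM hV); [rewrite QE; apply: vr_int | apply: vrX].
Qed.

Lemma integralP x : integral x <-> integralOver (intr : int -> K) x.
Proof. by split=> [[p [pm px]]|[p pm px]]; exists p. Qed.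

Lemma vr_integral_mem V x : valring V -> integral x -> V x.
Proof.
move=> hV [p [pm px]]; apply: (vr_integral hV _ _ px); first exact: monic_map.
by move=> i; rewrite coef_map; apply: vr_int.
Qed.

(* Multiplying the equation by [c ^+ n] makes it monic in [c * x]. *)
Lemma integral_lead (n : nat) (c x : K) (a : nat -> int) :
  integral c -> c * x ^+ n.+1 + \sum_(i < n.+1) (a i)%:~R * x ^+ i = 0 -> integral (c * x).
Proof.
move=> /integralP ic e; apply/integralP.
pose p : {poly K} := 'X^(n.+1) + \poly_(i < n.+1) ((a i)%:~R * c ^+ (n - i)).
have ci k : integralOver (intr : int -> K) (c ^+ k).
  elim: k => [|k IH]; first by rewrite expr0; apply: integral1.
  by rewrite exprS; apply: integral_mul.
have pm : p \is monic.
  by rewrite monicE lead_coefDl ?lead_coefXn // size_polyXn ltnS size_poly.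
have pr : root p (c * x).
  apply/rootP; rewrite hornerD hornerXn horner_poly.
  transitivity (c ^+ n * (c * x ^+ n.+1 + \sum_(i < n.+1) (a i)%:~R * x ^+ i)); last by rewrite e mulr0.
  rewrite mulrDr mulrA -exprSr exprMn; congr (_ + _).
  rewrite mulr_sumr; apply: eq_bigr => i _.
  have hi : (i <= n)%N by rewrite -ltnS ltn_ord.
  have -> : c ^+ n = c ^+ (n - i) * c ^+ i by rewrite -exprD subnK.
  by rewrite exprMn; ring.
apply: (integral_root_monic pm pr); apply/integral_poly => i.
rewrite coefD coefXn coef_poly; apply: integral_add; first exact: integral_nat.
case: ifP => _; last exact: integral0.
by apply: integral_mul => //; apply: integral_id.
Qed.

Lemma intr_nonunit (z : int) l : prime l -> (l%:R : K)^-1 != z%:~R.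
Proof.
move=> pl; apply/negP => /eqP e.
have l0 : (l%:R : K) != 0 by rewrite (intK_eq0 l) -lt0n prime_gt0.
have : (z * l)%:~R = 1%:~R :> K by rewrite intrM -e mulVf.
move/eqP; rewrite -subr_eq0 -rmorphB intK_eq0 subr_eq0 => /eqP h.
have : (`|z| * l)%N = 1%N by have := congr1 absz h; rewrite abszM absz_nat.
by move/eqP; rewrite muln_eq1 => /andP[_ /eqP l1]; rewrite l1 in pl.
Qed.

Section Residue.
Variables (V : K -> Prop) (l : nat).
Hypothesis hV : valring V.
Hypothesis pl : prime l.
Hypothesis nVl : ~ V (l%:R)^-1.

Let l0 : (l%:R : K) != 0.
Proof. by rewrite (intK_eq0 l) -lt0n prime_gt0. Qed.

Lemma vmax_prime_nat : vmax V l%:R. Proof. by right. Qed.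

Lemma vunit_coprime n : coprime l n -> vunit V n%:R.
Proof.
move=> co; apply: nvmax_unit (vr_nat hV n) _ => // mn.
have n0 : (0 < l)%N by rewrite prime_gt0.
case: (egcdnP n n0) => u v e _.
apply: (vmax1 hV); have -> : 1 = u%:R * l%:R - v%:R * n%:R :> K.
  by rewrite -!natrM e (eqP co) natrD addrC addKr.
by apply: vmaxB => //; apply: vmaxMl => //; [apply: vr_nat | apply: vmax_prime_nat | apply: vr_nat].
Qed.

Lemma vmax_int_dvd (z : int) : vmax V z%:~R -> (l %| z)%Z.
Proof.
move=> h; apply: contrapT => /negP nd.
have co : coprime l `|z| by rewrite prime_coprime.
apply: (vmax_unit (vunit_coprime co)).
by case: z h nd co => n //= h _ _; move: h; rewrite NegzE mulrNz => /(vmaxN hV); rewrite opprK.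
Qed.

(* The denominators are the Horner partial sums of a primitive integer polynomial vanishing
   at [x]; they cannot all be nonunits, since its coefficients would be. *)
Lemma vr_fraction x : V x -> exists b c, [/\ integral b, integral c, vunit V c & b = x * c].
Proof.
move=> Vx; have [P0 nz0 rP0] := alg_int_poly x.
pose P := zprimitive P0.
have nzP : P != 0 by rewrite zprimitive_eq0.
have rP : root (map_poly intr P) x.
  move: rP0; rewrite [in X in X -> _](zpolyEprim P0) map_polyZ rootZ // intK_eq0 zcontents_eq0 //.
pose n := size P.
pose c s := \sum_(i < n - s) (P`_(s + i))%:~R * x ^+ i : K.
have cS s : (s < n)%N -> c s = (P`_s)%:~R + x * c s.+1.
  move=> sn; rewrite /c -(subnSK sn) big_ord_recl /= addn0 expr0 mulr1; congr (_ + _).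
  rewrite mulr_sumr; apply: eq_bigr => i _.
  by rewrite /bump /= add1n addnS exprS mulrCA.
have c0 : c 0%N = 0.
  move/rootP: rP; rewrite (@horner_coef_wide _ n) ?size_poly // => <-.
  by rewrite /c subn0; apply: eq_bigr => i _; rewrite coef_map add0n.
have eq s : (s <= n)%N -> c s * x ^+ s + \sum_(i < s) (P`_i)%:~R * x ^+ i = 0.
  elim: s => [_|s IH sn]; first by rewrite big_ord0 addr0 mulr1 c0.
  apply: etrans (IH (ltnW sn)); rewrite big_ord_recr /= [in RHS]cS // exprS; ring.
(* Downward induction on [s]: [eq] is an equation for [x] with leading coefficient [c s], so
   integrality of [c s] gives that of [c s * x], which [cS] needs at the next lower index. *)
have int_c : forall k s, (s + k)%N = n -> integral (c s) /\ integral (c s * x).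
  elim=> [|k IH] s e.
    have -> : c s = 0 by rewrite /c -e addn0 subnn big_ord0.
    by rewrite mul0r; split; apply/integralP/integral0.
  have sn : (s < n)%N by rewrite -e -addSnnS leq_addr.
  have [|i1 i2] := IH s.+1; first by rewrite addSnnS.
  have ics : integral (c s).
    rewrite cS //; apply/integralP/integral_add; first exact: integral_id.
    by rewrite mulrC; apply/integralP.
  split=> //; case: s {e i1 i2} sn ics => [|s] sn ics; first by rewrite c0 mul0r; apply/integralP/integral0.
  exact: integral_lead ics (eq _ (ltnW sn)).
have [[s [sn us]]|H] := pselect (exists s, (s < n)%N /\ ~ vmax V (c s)).
  have [|i1 i2] := int_c (n - s)%N s; first by rewrite subnKC // ltnW.
  exists (c s * x), (c s); split=> //; last by rewrite mulrC.
  by apply: nvmax_unit => //; apply: vr_integral_mem.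
have mc s : vmax V (c s).
  case: (ltnP s n) => sn; first by apply: contrapT => ?; apply: H; exists s.
  by left; rewrite /c (eqP (_ : n - s == 0)%N) ?big_ord0 // subn_eq0.
have : (l%:Z %| zcontents P)%Z.
  rewrite dvdz_contents; apply/polyOverP => i; apply: vmax_int_dvd.
  case: (ltnP i n) => hi; last by rewrite nth_default //; left.
  have -> : (P`_i)%:~R = c i - x * c i.+1 by rewrite cS // addrK.
  by apply: vmaxB => //; apply: vmaxMl.
rewrite zcontents_primitive nz0 dvdz1 absz_nat => /eqP e; by move: pl; rewrite e.
Qed.

End Residue.
End Algebraic.

(* A relation [sum_i a_i x^i = 0] over the integers has two terms of equal valuation, so a
   power of [x] is a power of [l] times a unit: this defines the absolute value. *)
Lemma vr_dominant (F : fieldType) (V : F -> Prop) (I : finType) (f : I -> F) :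
  valring V -> (exists i, f i != 0) ->
  exists2 i, f i != 0 & forall j, V (f j / f i).
Proof.
move=> hV [i0 fi0].
suff: forall s : seq I, i0 \in s -> exists2 i, f i != 0 & forall j, j \in s -> V (f j / f i).
  move=> /(_ (index_enum I) (mem_index_enum _)) [i fi h]; exists i => // j.
  by apply: h; apply: mem_index_enum.
suff H : forall s : seq I, exists2 i, f i != 0 & forall j, j \in s -> V (f j / f i).
  by move=> s _; apply: H.
elim=> [|j s [i fi h]]; first by exists i0.
case: (vr_total hV (f j / f i)) => hji.
  by exists i => // k; rewrite inE => /orP[/eqP -> //|]; apply: h.
rewrite invf_div in hji.
have [fj|fj] := eqVneq (f j) 0.
  exists i => // k; rewrite inE => /orP[/eqP ->|]; last exact: h.
  by rewrite fj mul0r; apply: vr0.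
exists j => // k; rewrite inE => /orP[/eqP ->|ks]; first by rewrite divff //; apply: (vr1 hV).
have -> : f k / f j = (f k / f i) * (f i / f j) by rewrite mulrA divfK.
by apply: (vrM hV) => //; apply: h.
Qed.

(** Divide by a dominant term [f i]: if all other quotients were nonunits, [1] would be in the
    maximal ideal. *)
Lemma vr_zero_sum (F : fieldType) (V : F -> Prop) (I : finType) (f : I -> F) :
  valring V -> (exists i, f i != 0) -> \sum_i f i = 0 ->
  exists i j, [/\ i != j, f i != 0, f j != 0 & vunit V (f i / f j)].
Proof.
move=> hV ex s0; have [i fi h] := vr_dominant hV ex.
apply: contrapT => H; apply: (vmax1 hV).
have -> : 1 = - \sum_(j | j != i) f j / f i.
  apply: (mulIf fi); rewrite mul1r mulNr -mulr_suml divfK //.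
  by apply/eqP; rewrite -addr_eq0 -(bigD1 (P := xpredT) i) //= s0.
apply/(vmaxN hV)/(vmax_sum hV) => j ji.
case: (vmax_or_unit (h j)) => // u; case: H; exists j, i; split=> //.
by case: u => h0 _ _; apply: contraNneq h0 => ->; rewrite mul0r.
Qed.

(** * The absolute value attached to a valuation ring *)

Section PadicAbs.
Variables (R : realType) (K : fieldExtType rat) (V : K -> Prop) (l : nat).
Hypothesis hV : valring V.
Hypothesis pl : prime l.
Hypothesis nVl : ~ V (l%:R)^-1.

Let L : K := l%:R.
Let L0 : L != 0.
Proof. by rewrite /L (intK_eq0 K l) -lt0n prime_gt0. Qed.
Let mL : vmax V L. Proof. by right. Qed.

Let unit_Lz (k : int) : vunit V (L ^ k) -> k = 0.
Proof.
have pos n : vunit V (L ^+ n.+1) -> False.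
  by move=> /(vmax_unit)[]; rewrite exprS; apply: vmaxMr => //; apply/(vrX hV)/(vmax_V hV).
case: k => [[|n]|n] //; first by move/pos.
by rewrite NegzE -exprnN => /vunitV; rewrite invrK => /pos.
Qed.

Let int_decomp (z : int) : z != 0 -> exists a : nat, exists2 b, vunit V b & z%:~R = L ^+ a * b.
Proof.
move=> z0; have z1 : (0 < `|z|)%N by rewrite absz_gt0.
have [m co e] := pfactor_coprime pl z1; exists (logn l `|z|).
have um : vunit V (m%:R : K) by apply: vunit_coprime co.
have e' : (`|z|%N)%:R = L ^+ logn l `|z| * m%:R :> K by rewrite {1}e natrM natrX mulrC.
have [->|->] : z%:~R = (`|z|%N)%:R :> K \/ z%:~R = - (`|z|%N)%:R :> K.
  by case: (z) => n; [left | right; rewrite NegzE mulrNz].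
  by exists m%:R.
exists (- m%:R); last by rewrite mulrN e'.
by case: um => u0 u1 u2; split; rewrite ?oppr_eq0 ?invrN //; apply: vrN.
Qed.

Let exists_val x : x != 0 -> exists (e : nat) (k : int), (0 < e)%N /\ vunit V (x ^+ e * L ^ k).
Proof.
move=> x0; have [P P0 /rootP rP] := alg_int_poly x.
pose f (i : 'I_(size P)) : K := (P`_i)%:~R * x ^+ i.
have fE i : (f i == 0) = (P`_i == 0) by rewrite mulf_eq0 intK_eq0 expf_eq0 (negPf x0) andbF orbF.
have s0 : \sum_i f i = 0.
  apply: etrans rP; rewrite (@horner_coef_wide _ (size P)) ?size_poly //.
  by apply: eq_bigr => i _; rewrite coef_map.
have sP : (0 < size P)%N by rewrite lt0n size_poly_eq0.
have ex : exists i, f i != 0.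
  have h : ((size P).-1 < size P)%N by rewrite prednK.
  by exists (Ordinal h); rewrite fE -lead_coefE lead_coef_eq0.
have [i [j [ij fi fj u]]] := vr_zero_sum hV ex s0.
wlog lij : i j ij fi fj u / (j < i)%N.
  move=> W; case: (ltngtP i j) => h.
  - by apply: (W j i); rewrite // 1?eq_sym // -[f j / f i]invf_div; apply: vunitV.
  - exact: (W i j).
  - by move: ij; rewrite -val_eqE /= h eqxx.
have hi : P`_i != 0 by rewrite -fE.
have hj : P`_j != 0 by rewrite -fE.
have [a [b ub eb]] := int_decomp hi.
have [c [d ud ed]] := int_decomp hj.
exists (i - j)%N, (a%:Z - c%:Z); split; first by rewrite subn_gt0.
have -> : x ^+ (i - j) * L ^ (a%:Z - c%:Z) = f i / f j * d / b.
  have b0 : b != 0 by case: ub. have d0 : d != 0 by case: ud.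
  rewrite /f eb ed expfzDr // -exprnN -exprnP expfB //.
  by field; rewrite ?expf_neq0 ?b0 ?d0 ?x0 ?L0.
by apply: vunitM => //; [apply: vunitM | apply: vunitV].
Qed.

(** Eliminating [x] between the two relations leaves a power of [l] that is a unit, so its exponent
    is zero. Hence [k / e] depends on [x] alone. *)
Let val_unique x e k e' k' : x != 0 -> vunit V (x ^+ e * L ^ k) -> vunit V (x ^+ e' * L ^ k') ->
  k * e'%:Z = k' * e%:Z.
Proof.
move=> x0 /(vunitX hV e') u /(vunitX hV e)/(vunitV) u'.
have := vunitM hV u u'; rewrite !exprMn -!exprM [(e' * e)%N]mulnC.
have -> : x ^+ (e * e') * (L ^ k) ^+ e' / (x ^+ (e * e') * (L ^ k') ^+ e) = L ^ (k * e'%:Z - k' * e%:Z).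
  rewrite expfzDr // -invr_expz -!exprz_exp -!exprnP; field.
  by rewrite ?expf_neq0 // ?expfz_neq0.
by move/unit_Lz/eqP; rewrite subr_eq0 => /eqP.
Qed.
Lemma exists_padic_abs : exists nm : K -> R,
  [/\ forall x, 0 <= nm x, nm 0 = 0, forall x, nm x = 0 -> x = 0,
      forall x y, nm (x * y) = nm x * nm y & forall x y, nm (x + y) <= Num.max (nm x) (nm y)] /\
  nm l%:R = l%:R^-1 /\ forall x, V x -> nm x <= 1.
Proof.
have /choice [v hv] : forall x : K, exists r : R, x != 0 ->
    exists (e : nat) (k : int), [/\ (0 < e)%N, vunit V (x ^+ e * L ^ k) & r = k%:~R / e%:R].
  move=> x; have [->|x0] := eqVneq x 0; first by exists 0.
  by have [e [k [e0 u]]] := exists_val x0; exists (k%:~R / e%:R) => _; exists e, k.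
have vE x e k : x != 0 -> (0 < e)%N -> vunit V (x ^+ e * L ^ k) -> v x = k%:~R / e%:R.
  move=> x0 e0 u; have [e' [k' [e'0 u' ->]]] := hv _ x0.
  have := congr1 (fun z : int => z%:~R : R) (val_unique x0 u u'); rewrite !intrM -!pmulrn => E.
  apply/eqP; rewrite eqr_div ?pnatr_eq0 -?lt0n //; exact/eqP.
have vM x y : x != 0 -> y != 0 -> v (x * y) = v x + v y.
  move=> x0 y0; have [e [k [e0 u ->]]] := hv _ x0; have [f [h [f0 w ->]]] := hv _ y0.
  rewrite (@vE _ (e * f)%N (k * f%:Z + h * e%:Z)) ?mulf_neq0 ?muln_gt0 ?e0 //.
    by rewrite intrD !intrM natrM -!pmulrn; field; rewrite !pnatr_eq0 -!lt0n e0 f0.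
  have -> : (x * y) ^+ (e * f) * L ^ (k * f%:Z + h * e%:Z) =
      (x ^+ e * L ^ k) ^+ f * (y ^+ f * L ^ h) ^+ e.
    by rewrite expfzDr // -!exprz_exp -!exprnP !exprMn -!exprM [(f * e)%N]mulnC; ring.
  by apply: vunitM => //; apply: vunitX.
have ln_l : 0 < ln (l%:R : R) by rewrite ln_gt0 // ltr1n prime_gt1.
have vV x : x != 0 -> V x -> v x <= 0.
  move=> x0 Vx; have [e [k [e0 u ->]]] := hv _ x0.
  rewrite pmulr_lle0 ?invr_gt0 ?ltr0n // lerz0 leNgt; apply/negP => k0.
  apply: (vmax_unit u); apply: vmaxMl => //; first exact: vrX.
  by case: k k0 {u} => [[|n]|n] // _; rewrite -exprnP exprS; apply: vmaxMr => //; apply/(vrX hV)/(vmax_V hV).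
(* Since [x^e * l^k] is a unit, [x] has valuation [-k/e], and its absolute value is [l^(k/e)] with a
   positive exponent sign. *)
pose nm x := if x == 0 then 0 else expR (v x * ln l%:R).
have nm_pos x : x != 0 -> 0 < nm x by move=> x0; rewrite /nm (negPf x0) expR_gt0.
have nm_ge0 x : 0 <= nm x by rewrite /nm; case: eqP => // _; rewrite expR_ge0.
have nm0 : nm 0 = 0 by rewrite /nm eqxx.
have nmM x y : nm (x * y) = nm x * nm y.
  have [->|x0] := eqVneq x 0; first by rewrite mul0r nm0 mul0r.
  have [->|y0] := eqVneq y 0; first by rewrite mulr0 nm0 mulr0.
  by rewrite /nm mulf_eq0 (negPf x0) (negPf y0) /= vM // mulrDl expRD.
have nmV x : V x -> nm x <= 1.
  move=> Vx; rewrite /nm; case: eqVneq => [_|x0]; first exact: ler01.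
  by rewrite -[leRHS]expR0 ler_expR pmulr_lle0 //; apply: vV.
have ultra x y : y != 0 -> V (x / y) -> nm (x + y) <= nm y.
  move=> y0 h; have -> : x + y = (x / y + 1) * y by rewrite mulrDl divfK // mul1r.
  by rewrite nmM ler_piMl // nmV //; apply: vrD => //; apply: vr1.
exists nm; split; [split=> // | split=> //].
- by move=> x e; apply/eqP; apply: contraT => /nm_pos; rewrite e ltxx.
- move=> x y; rewrite le_max; have [->|x0] := eqVneq x 0; first by rewrite add0r lexx orbT.
  have [->|y0] := eqVneq y 0; first by rewrite addr0 lexx.
  case: (vr_total hV (x / y)) => h; first by rewrite ultra ?orbT.
  by rewrite addrC ultra // -invf_div.
- rewrite /nm (negPf L0) (@vE _ 1%N (-1)) //; last by rewrite expr1 exprN1 divff //; apply: vunit1.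
  by rewrite mulrN1z divr1 mulN1r expRN lnK // posrE ltr0n prime_gt0.
Qed.
End PadicAbs.

(** * Reduction of homogeneous maps *)

Section Homogeneous.
Variable F : fieldType.
Implicit Types (p f g : {poly F}) (P Q : F * F) (d : nat).

(** Homogenisation of [p] in formal degree [d], which may exceed its true degree; this is what makes
    the map defined at infinity [(1, 0)]. *)
Definition hev d p (x y : F) : F := \sum_(i < d.+1) p`_i * x ^+ i * y ^+ (d - i).
Definition hstep d f g P : F * F := (hev d f P.1 P.2, hev d g P.1 P.2).
Definition hiter d f g n P := iter n (hstep d f g) P.
Definition pdet P Q : F := P.1 * Q.2 - P.2 * Q.1.

Lemma hevE d p x y : (size p <= d.+1)%N -> y != 0 -> hev d p x y = y ^+ d * p.[x / y].
Proof.
move=> sp y0; rewrite (horner_coef_wide _ sp) mulr_sumr; apply: eq_bigr => i _.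
have hi : (i <= d)%N by rewrite -ltnS.
have -> : y ^+ d = y ^+ (d - i) * y ^+ i by rewrite -exprD subnK.
by rewrite exprMn exprVn; field; rewrite expf_neq0.
Qed.

Lemma hev0 d p x : hev d p x 0 = p`_d * x ^+ d.
Proof.
rewrite /hev big_ord_recr /= subnn expr0 mulr1 big1 ?add0r // => i _.
by rewrite expr0n subn_eq0 leqNgt ltn_ord mulr0.
Qed.

Section Reduction.
Variables (V : F -> Prop) (d : nat) (f g u v : {poly F}).
Hypothesis hV : valring V.
Hypothesis sf : (size f <= d.+1)%N.
Hypothesis sg : (size g <= d.+1)%N.
Hypothesis Vf : forall i, V f`_i.
Hypothesis Vg : forall i, V g`_i.
Hypothesis Vu : forall i, V u`_i.
Hypothesis Vv : forall i, V v`_i.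
(** Together with [top], this is good reduction: [bezout] excludes a common zero of the reduced
    forms at finite points, [top] at infinity. *)
Hypothesis bezout : u * f + v * g = 1.
Hypothesis top : vunit V f`_d \/ vunit V g`_d.

Definition vprim P := [/\ V P.1, V P.2 & ~ (vmax V P.1 /\ vmax V P.2)].
Definition vcong P Q := vmax V (pdet P Q).

Lemma V_hev p x y : (forall i, V p`_i) -> V x -> V y -> V (hev d p x y).
Proof.
move=> hp hx hy; apply: vr_sum => // i _.
by apply: (vrM hV); [apply: (vrM hV) => //|]; apply: vrX.
Qed.

Lemma vmax_hev p x y : (forall i, V p`_i) -> V x -> vmax V y ->
  vmax V (hev d p x y - p`_d * x ^+ d).
Proof.
move=> hp hx hy; rewrite /hev big_ord_recr /= subnn expr0 mulr1 addrK.
apply: vmax_sum => // i _; apply: vmaxMl => //; first by apply: (vrM hV) => //; apply: vrX.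
have : (0 < d - i)%N by rewrite subn_gt0.
case: (d - i)%N => // k _; rewrite exprS; apply: vmaxMr => //.
by apply/(vrX hV)/(vmax_V hV).
Qed.

Lemma vmax_unitM x y : vunit V x -> vmax V (x * y) -> vmax V y.
Proof.
move=> [x0 Vx VVx] h; have -> : y = x^-1 * (x * y) by rewrite mulKf.
exact: vmaxMl.
Qed.

Lemma vprim_step P : vprim P -> vprim (hstep d f g P).
Proof.
case: P => x y [/= Vx Vy nm]; split=> /=; [exact: V_hev| exact: V_hev|].
case: (vmax_or_unit Vy) => [my|uy].
  have ux : vunit V x by apply: nvmax_unit => // mx; apply: nm.
  have gen p : (forall i, V p`_i) -> vmax V (hev d p x y) -> vunit V p`_d -> False.
    move=> hp h up; have h2 := vmax_hev hp Vx my.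
    apply: (vmax_unit (vunitM hV up (vunitX hV d ux))).
    by rewrite -[X in vmax V X](subKr (hev d p x y)); apply: vmaxB.
  by case=> h1 h2; case: top; [apply: gen h1 | apply: gen h2].
have [y0 _ Vy'] := uy.
have Vz : V (x / y) by apply: (vrM hV).
rewrite !hevE // => -[/(vmax_unitM (vunitX hV d uy)) h1 /(vmax_unitM (vunitX hV d uy)) h2].
apply: (vmax1 hV); have := congr1 (horner^~ (x / y)) bezout.
rewrite hornerD !hornerM hornerC => <-.
by apply: vmaxD => //; apply: vmaxMl => //; apply: vr_horner.
Qed.

Lemma vprim_iter n P : vprim P -> vprim (hiter d f g n P).
Proof. by move=> h; elim: n => //= n IH; apply: vprim_step. Qed.

Lemma vmax_horner_sub p x y : (forall i, V p`_i) -> V x -> V y -> vmax V (x - y) ->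
  vmax V (p.[x] - p.[y]).
Proof.
move=> hp hx hy h; rewrite !horner_coef -sumrB; apply: vmax_sum => // i _.
rewrite -mulrBr; apply: vmaxMl => //; rewrite subrXX; apply: vmaxMr => //.
by apply: vr_sum => // j _; apply: (vrM hV); apply: vrX.
Qed.

(** If one point reduces to infinity so does the other, and modulo the maximal ideal only the top
    terms remain, which cancel in the determinant. Otherwise the determinant is a unit times
    [f(z) g(z') - f(z') g(z)] with [z] congruent to [z']. *)
Lemma vcong_step P Q : vprim P -> vprim Q -> vcong P Q -> vcong (hstep d f g P) (hstep d f g Q).
Proof.
case: P => x y; case: Q => x' y' [/= Vx Vy nm] [/= Vx' Vy' nm']; rewrite /vcong /pdet /= => h.
case: (vmax_or_unit Vy) => [my|uy].
  have ux : vunit V x by apply: nvmax_unit => // mx; apply: nm.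
  have my' : vmax V y'.
    apply: (vmax_unitM ux); rewrite -[x * y'](subrK (y * x')).
    by apply: vmaxD => //; apply: vmaxMr.
  have hp p : (forall i, V p`_i) -> exists2 e, vmax V e & hev d p x y = p`_d * x ^+ d + e.
    by move=> Vp; exists (hev d p x y - p`_d * x ^+ d); [apply: vmax_hev | rewrite addrC subrK].
  have hp' p : (forall i, V p`_i) -> exists2 e, vmax V e & hev d p x' y' = p`_d * x' ^+ d + e.
    by move=> Vp; exists (hev d p x' y' - p`_d * x' ^+ d); [apply: vmax_hev | rewrite addrC subrK].
  have [a ma ->] := hp f Vf; have [b mb ->] := hp g Vg.
  have [a' ma' ->] := hp' f Vf; have [b' mb' ->] := hp' g Vg.
  rewrite (_ : _ - _ = (f`_d * x ^+ d) * b' + a * (g`_d * x' ^+ d + b') -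
    ((g`_d * x ^+ d) * a' + b * (f`_d * x' ^+ d + a'))); last by ring.
  have VX n z : V z -> V (z ^+ n) by apply: vrX.
  have Vm := vmax_V hV.
  have VM := vrM hV; have VD := vrD hV.
  apply: vmaxB => //; apply: vmaxD => //.
  - by apply: vmaxMl => //; apply: VM => //; apply: VX.
  - by apply: vmaxMr => //; apply: VD; [apply: VM => //; apply: VX | apply: Vm].
  - by apply: vmaxMl => //; apply: VM => //; apply: VX.
  - by apply: vmaxMr => //; apply: VD; [apply: VM => //; apply: VX | apply: Vm].
case: (vmax_or_unit Vy') => [my'|uy'].
  have mx' : vmax V x'.
    apply: (vmax_unitM uy); rewrite -[y * x'](subKr (x * y')).
    by apply: vmaxB => //; apply: vmaxMl.
  by case: nm'.
have [y0 _ iy] := uy; have [y'0 _ iy'] := uy'.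
rewrite !hevE //; set z := x / y; set z' := x' / y'.
have Vz : V z by apply: (vrM hV). have Vz' : V z' by apply: (vrM hV).
have mz : vmax V (z - z').
  have -> : z - z' = (y^-1 * y'^-1) * (x * y' - y * x').
    by rewrite /z /z'; field; rewrite y0 y'0.
  by apply: vmaxMl => //; apply: (vrM hV).
rewrite (_ : _ - _ = y ^+ d * y' ^+ d * ((f.[z] - f.[z']) * g.[z'] - f.[z'] * (g.[z] - g.[z']))); last by ring.
apply: vmaxMl => //; first by apply: (vrM hV); apply: vrX.
by apply: vmaxB => //; [apply: vmaxMr | apply: vmaxMl] => //; first [apply: vmax_horner_sub | apply: vr_horner].
Qed.

Lemma vcong_iter n P Q : vprim P -> vprim Q -> vcong P Q -> vcong (hiter d f g n P) (hiter d f g n Q).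
Proof.
by move=> hP hQ h; elim: n => //= n IH; apply: vcong_step => //; apply: vprim_iter.
Qed.

Lemma vcong_refl P : vcong P P.
Proof. by rewrite /vcong /pdet mulrC subrr; left. Qed.

Lemma vcong_sym P Q : vcong P Q -> vcong Q P.
Proof.
rewrite /vcong => h; rewrite (_ : pdet Q P = - pdet P Q); first exact: vmaxN.
rewrite /pdet; ring.
Qed.

(** Some coordinate of [Q] is a unit, and that coordinate times [pdet P S] is a combination of
    [pdet P Q] and [pdet Q S]. *)
Lemma vcong_trans Q P S : vprim P -> vprim Q -> vprim S -> vcong P Q -> vcong Q S -> vcong P S.
Proof.
case: P => p1 p2; case: Q => q1 q2; case: S => s1 s2 [/= Vp1 Vp2 _] [/= Vq1 Vq2 nq] [/= Vs1 Vs2 _].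
rewrite /vcong /pdet /= => h1 h2.
case: (vmax_or_unit Vq1) => [mq1|uq1]; last first.
  apply: (vmax_unitM uq1).
  rewrite (_ : q1 * _ = (p1 * q2 - p2 * q1) * s1 + (q1 * s2 - q2 * s1) * p1); last by ring.
  by apply: vmaxD => //; apply: vmaxMr.
case: (vmax_or_unit Vq2) => [mq2|uq2]; first by case: nq.
apply: (vmax_unitM uq2).
rewrite (_ : q2 * _ = (p1 * q2 - p2 * q1) * s2 + (q1 * s2 - q2 * s1) * p2); last by ring.
by apply: vmaxD => //; apply: vmaxMr.
Qed.

Lemma hiterD a b P : hiter d f g (a + b) P = hiter d f g a (hiter d f g b P).
Proof. exact: iterD. Qed.

Lemma vcong_period Q k a t : vprim Q -> vcong (hiter d f g k Q) Q ->
  vcong (hiter d f g (a + t * k) Q) (hiter d f g a Q).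
Proof.
move=> pQ hk; elim: t => [|t IH]; first by rewrite mul0n addn0; apply: vcong_refl.
apply: vcong_trans IH; try exact: vprim_iter.
rewrite (_ : a + t.+1 * k = (a + t * k) + k)%N; last by rewrite mulSn addnCA addnC.
by rewrite hiterD; apply: vcong_iter => //; apply: vprim_iter.
Qed.

(* If [P_n] is congruent to the periodic point [c] only when some earlier [P_i] is,
   then [P_(n-k)] is congruent to [c] whenever [P_n] is, so [P_(n-k-j)] avoids every
   [b] with [phi^(j+k)(b) = c] but [phi^j(b)] incongruent to [c]. *)
Lemma avoid_preimage (P b c : F * F) (k j q : nat) :
  vprim P -> vprim b -> vprim c -> (0 < k)%N ->
  vcong (hiter d f g k c) c ->
  (forall r, (0 < r < k)%N -> ~ vcong (hiter d f g r c) c) ->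
  vcong (hiter d f g (j + k) b) c -> ~ vcong (hiter d f g j b) c ->
  (vcong (hiter d f g (q + (j + k)) P) c ->
    exists2 i, (1 <= i < q + (j + k))%N & vcong (hiter d f g i P) c) ->
  ~ vcong (hiter d f g q P) b.
Proof.
move=> pP pb pc k0 hk hr hjk hj H cqb.
have pr n Q : vprim Q -> vprim (hiter d f g n Q) by apply: vprim_iter.
have cn : vcong (hiter d f g (q + (j + k)) P) c.
  rewrite (addnC q) hiterD; apply: vcong_trans hjk => //; try by repeat apply pr.
  by apply: vcong_iter => //; apply pr.
have [i /andP[i1 iltn] ci] := H cn.
set n := (q + (j + k))%N in cn iltn.
have c1 : vcong (hiter d f g (n - i) c) c.
  apply: vcong_trans cn; try by repeat apply pr.
  rewrite -(subnK (ltnW iltn)) hiterD; apply: vcong_sym.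
  by rewrite subnK ?(ltnW iltn) //; apply: vcong_iter => //; apply pr.
(* The reduction of [c] still has exact period [k], so a return after [n - i] steps forces [k] to
   divide [n - i]. *)
have kd : ((n - i) %% k = 0)%N.
  apply: contrapT => nz; apply: (hr ((n - i) %% k)%N); first by rewrite ltn_pmod // lt0n andbT; apply/eqP.
  apply: vcong_trans c1; try by repeat apply pr.
  apply: vcong_sym; rewrite [in X in vcong X _](divn_eq (n - i) k) addnC.
  exact: vcong_period.
have ik : (i <= q + j)%N.
  have : (k <= n - i)%N by rewrite dvdn_leq ?subn_gt0 // /dvdn kd.
  rewrite /n; lia.
have c2 : vcong (hiter d f g (q + j) P) c.
  rewrite -(subnK ik) hiterD; apply: (vcong_trans (Q := hiter d f g (q + j - i) c)); try by repeat apply pr.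
    by apply: vcong_iter => //; apply pr.
  have -> : (q + j - i = 0 + (q + j - i) %/ k * k)%N.
    rewrite add0n divnK // /dvdn.
    have e : (n - i = (q + j - i) + k)%N by rewrite /n; lia.
    by move: kd; rewrite e modnDr => ->.
  exact: (vcong_period 0 _ pc hk).
apply: hj; apply: vcong_trans c2; try by repeat apply pr.
by apply: vcong_sym; rewrite (addnC q) hiterD; apply: vcong_iter => //; apply pr.
Qed.
End Reduction.
End Homogeneous.

(* The trivial valuation ring: [vprim] means nonzero and [vcong] means projectively equal. *)
Definition allV (F : fieldType) (x : F) : Prop := True.

Section Trivial.
Variable F : fieldType.
Lemma valring_all : valring (@allV F). Proof. by split=> //; left. Qed.
Lemma vmax_all (x : F) : vmax (@allV F) x <-> x = 0.
Proof. by split=> [[//|h]|->]; [case: h | left]. Qed.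
Lemma vunit_all (x : F) : vunit (@allV F) x <-> x != 0.
Proof. by split=> [[]|]. Qed.
Lemma vprim_all (P : F * F) : vprim (@allV F) P <-> P != 0.
Proof.
case: P => x y; split=> [[_ _ h]|h].
  by apply/eqP => -[x0 y0]; apply: h; rewrite /= x0 y0; split; left.
by split=> // -[/vmax_all /= x0 /vmax_all /= y0]; rewrite x0 y0 eqxx in h.
Qed.
Lemma vcong_all (P Q : F * F) : vcong (@allV F) P Q <-> pdet P Q = 0.
Proof. exact: vmax_all. Qed.
End Trivial.

(** * Preimages of the periodic point *)

Section Preimages.
Variables (C : numClosedFieldType) (d : nat) (f g : {poly C}).
Hypothesis cop : coprimep f g.
Hypothesis sf : (size f <= d.+1)%N.
Hypothesis sg : (size g <= d.+1)%N.
Hypothesis top : f`_d != 0 \/ g`_d != 0.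
Hypothesis d2 : (1 < d)%N.
Let phi := hstep d f g.
Let it n P := hiter d f g n P.
Let V := @allV C.
Let hV : valring V := valring_all C.

Let bez : exists uv : {poly C} * {poly C}, uv.1 * f + uv.2 * g = 1.
Proof. exact/Bezout_eq1_coprimepP. Qed.

Let top' : vunit V f`_d \/ vunit V g`_d.
Proof. by case: top => h; [left|right]; apply/vunit_all. Qed.

Let prim_it n P : vprim V P -> vprim V (it n P).
Proof. by have [[u v] e] := bez; apply: (vprim_iter hV sf sg) e _ _ _. Qed.

Let cong_it n P Q : vprim V P -> vprim V Q -> vcong V P Q -> vcong V (it n P) (it n Q).
Proof. by have [[u v] e] := bez; apply: (vcong_iter hV sf sg) e _ _ _ _. Qed.

Let trans Q P S : vprim V P -> vprim V Q -> vprim V S ->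
  vcong V P Q -> vcong V Q S -> vcong V P S := @vcong_trans _ V hV Q P S.

Let period Q k t : vprim V Q -> vcong V (it k Q) Q -> vcong V (it (t * k) Q) Q.
Proof. by have [[u v] e] := bez => h1 h2; apply: (vcong_period hV sf sg _ _ _ _ e top' 0 t h1 h2). Qed.

Variables (b c : C * C) (k : nat).
Hypothesis k0 : (0 < k)%N.
Hypothesis pb : vprim V b.
Hypothesis pc : vprim V c.
Hypothesis cc : vcong V (it k c) c.
Hypothesis bc : vcong V (it k b) c.
Hypothesis nbc : ~ vcong V b c.

Let level j w := vcong V (it j w) b.

Let itD i j P : it (i + j) P = it i (it j P). Proof. exact: iterD. Qed.

(** A point on two levels would make [b] periodic, so some iterate by a multiple of [k] would fix
    [b]. But all positive multiples of [k] send [b] to [c]. *)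
Let level_disjoint i j w : vprim V w -> (i < j)%N -> level i w -> level j w -> False.
Proof.
move=> pw ij li lj.
have e : vcong V (it (j - i) b) b.
  apply: trans lj; rewrite ?prim_it //; try exact: prim_it.
  rewrite -(subnK (ltnW ij)) itD subnK ?(ltnW ij) //.
  by apply: cong_it; rewrite //; [apply: prim_it | apply: vcong_sym].
have [r er] : exists r, (j - i)%N = r.+1 by exists (j - i).-1; rewrite prednK // subn_gt0.
rewrite er in e.
have e1 : vcong V (it (k * r.+1) b) b := period k pb e.
have e2 : vcong V (it (r * k + k) b) c.
  rewrite itD; apply: (trans (Q := it (r * k) c)); try (by repeat apply: prim_it).
    by apply: cong_it => //; apply: prim_it.
  exact: period.
apply: nbc; apply: trans e2; try (by repeat apply: prim_it).
by apply: vcong_sym => //; rewrite (_ : r * k + k = k * r.+1)%N // mulnS mulnC addnC.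
Qed.

Let surj Q : vprim V Q -> exists P, vprim V P /\ vcong V (phi P) Q.
Proof.
case: Q => q1 q2 hQ; pose h := q2 *: f - q1 *: g.
(* A constant [h] has no coefficient in degree [d], which says that infinity is mapped to [Q]. *)
have [sh|sh] := leqP (size h) 1.
  exists (1, 0); split; first by apply/vprim_all; apply/eqP => -[/eqP]; rewrite oner_eq0.
  apply/vcong_all; rewrite /pdet /phi /hstep /= !hev0 expr1n !mulr1.
  have : h`_d = 0 by rewrite nth_default // (leq_trans sh) // ltnW.
  by rewrite coefB !coefZ => /eqP; rewrite subr_eq0 => /eqP; rewrite mulrC => ->; rewrite mulrC subrr.
have [z] : exists z, root h z by apply/closed_rootP; rewrite neq_ltn sh orbT.
move=> /rootP; rewrite hornerD hornerN !hornerZ => e.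
exists (z, 1); split; first by apply/vprim_all; apply/eqP => -[_ /eqP]; rewrite oner_eq0.
apply/vcong_all; rewrite /pdet /phi /hstep /= !hevE ?oner_eq0 // expr1n !mul1r divr1.
by rewrite mulrC [g.[z] * _]mulrC.
Qed.

Let W := f^`() * g - f * g^`().

(** If it vanished, coprimality would make [f] divide its own derivative and likewise [g]. In
    characteristic zero both would be constant, against [top] and [d > 1]. *)
Let W0 : W != 0.
Proof.
apply/eqP => /eqP; rewrite subr_eq0 => /eqP e.
have small (p q : {poly C}) : coprimep p q -> q^`() * p = q * p^`() -> (size p <= 1)%N.
  move=> co e'; have dv : p %| p^`() by rewrite -(Gauss_dvdpr _ co) -e' dvdp_mulIr.
  have : p^`() = 0.
    apply/eqP/negPn/negP => h; have := dvdp_leq h dv; rewrite leqNgt lt_size_deriv //.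
    by apply: contraNneq h => ->; rewrite deriv0.
  move=> dp; apply/leq_sizeP => i i1; have := congr1 (fun t : {poly C} => t`_i.-1) dp.
  rewrite coef_deriv coef0 prednK // => /eqP.
  by rewrite -mulr_natr mulf_eq0 pnatr_eq0 => /orP[/eqP //|]; rewrite eqn0Ngt i1.
have h1 : (size f <= 1)%N.
  by apply: (@small f g cop); rewrite mulrC -e mulrC.
have h2 : (size g <= 1)%N.
  by apply: (@small g f); rewrite 1?coprimep_sym.
case: top => /eqP; apply; apply: nth_default; [apply: leq_trans h1 _ | apply: leq_trans h2 _]; exact: ltnW.
Qed.

Let avoid_point p : vprim V p -> exists N, forall j, (N <= j)%N -> ~ level j p.
Proof.
move=> pp; have [[j0 l0]|h] := pselect (exists j0, level j0 p); last first.
  by exists 0%N => j _ l; apply: h; exists j.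
by exists j0.+1 => j hj l; apply: (level_disjoint pp hj l0 l).
Qed.

Let fin_pt (z : C) : vprim V (z, 1).
Proof. by apply/vprim_all; apply/eqP => -[_ /eqP]; rewrite oner_eq0. Qed.

Let inf_pt : vprim V (1, 0).
Proof. by apply/vprim_all; apply/eqP => -[/eqP]; rewrite oner_eq0. Qed.

(* The levels of the backward orbit of [b] are disjoint, so all but finitely many of them
   avoid infinity and the roots of the Wronskian. *)
Let avoid_all : exists J, forall j, (J <= j)%N ->
  ~ level j (1, 0) /\ forall z, root W z -> ~ level j (z, 1).
Proof.
have [rs hrs] := closed_field_poly_normal W.
have [N0 hN0] := avoid_point inf_pt.
have [N1 hN1] : exists N, forall z, z \in rs -> forall j, (N <= j)%N -> ~ level j (z, 1).
  elim: rs {hrs} => [|z rs [N hN]]; first by exists 0%N.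
  have [M hM] := avoid_point (fin_pt z); exists (maxn M N) => y.
  by rewrite inE => /orP[/eqP ->|hy] j; rewrite geq_max => /andP[h1 h2]; [apply: hM | apply: hN].
exists (maxn N0 N1) => j; rewrite geq_max => /andP[h0 h1]; split; first exact: hN0.
move=> z; rewrite hrs rootZ ?lead_coef_eq0 ?W0 // root_prod_XsubC => hz; exact: hN1.
Qed.

(* A double root of [f - t g] is a root of the Wronskian [W]. *)
Let two_preimages J j t : (forall j, (J <= j)%N ->
    ~ level j (1, 0) /\ forall z, root W z -> ~ level j (z, 1)) ->
  (J <= j)%N -> level j (t, 1) ->
  exists z1 z2, [/\ z1 != z2, f.[z1] = t * g.[z1], f.[z2] = t * g.[z2],
    level j.+1 (z1, 1) & level j.+1 (z2, 1)].
Proof.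
move=> hJ Jj lt; pose h := f - t *: g.
have lift w : vprim V w -> vcong V (phi w) (t, 1) -> level j.+1 w.
  move=> pw e; have pw1 : vprim V (phi w) := prim_it 1 pw.
  rewrite /level /it /hiter iterSr; apply: (trans (Q := it j (t, 1))) lt => //; try exact: prim_it.
  exact: cong_it.
have [ninf nW] := hJ j.+1 (leqW Jj).
have hd0 : h`_d != 0.
  apply/eqP => e; apply: ninf; apply: lift => //; apply/vcong_all.
  rewrite /pdet /phi /hstep /= !hev0 expr1n !mulr1; move: e; rewrite coefB coefZ => /eqP.
  by rewrite subr_eq0 => /eqP ->; rewrite mulrC subrr.
have sh : (d < size h)%N by rewrite ltnNge; apply: contraNN hd0 => s; rewrite nth_default.
have root_lift z : root h z -> f.[z] = t * g.[z] /\ level j.+1 (z, 1).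
  move=> /rootP; rewrite hornerD hornerN hornerZ => /eqP; rewrite subr_eq0 => /eqP e; split=> //.
  apply: lift => //; apply/vcong_all.
  rewrite /pdet /phi /hstep /= !hevE ?oner_eq0 // expr1n !mul1r divr1.
  by rewrite e mulr1 mulrC subrr.
have [z1 r1] : exists z, root h z.
  by apply/closed_rootP; rewrite neq_ltn (leq_trans _ sh) ?orbT // ltnS ltnW.
have [q hq] := factor_theorem _ _ r1.
have q0 : q != 0 by apply: contraNneq hd0 => q0; rewrite hq q0 mul0r coef0.
have sq : (1 < size q)%N.
  move: sh; rewrite hq size_Mmonic ?monicXsubC // size_XsubC addn2 /= ltnS; exact: leq_trans d2.
have [z2 r2] : exists z, root q z by apply/closed_rootP; rewrite neq_ltn sq orbT.
have [e1 l1] := root_lift _ r1.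
have [e2 l2] : f.[z2] = t * g.[z2] /\ level j.+1 (z2, 1).
  by apply: root_lift; rewrite hq rootM r2.
exists z1, z2; split=> //; apply: contraT => /negPn/eqP z12.
exfalso; apply: (nW z1) => //; rewrite /root /W hornerD hornerN !hornerM.
have : h^`().[z1] = 0.
  rewrite hq derivM hornerD !hornerM derivXsubC hornerC hornerXsubC subrr mulr0 add0r mulr1.
  by rewrite z12; apply/rootP.
rewrite derivB derivZ hornerD hornerN hornerZ => /eqP; rewrite subr_eq0 => /eqP ->.
by rewrite e1 mulrAC subrr.
Qed.

(** Two preimages [r1], [r2] of one point on a late level are taken, then two preimages of [r1] and
    one of [r2]; the last differs from the others because its image does. *)
Lemma three_preimages : exists j s1 s2 s3,
  [/\ s1 != s2, s1 != s3, s2 != s3 & forall s, s \in [:: s1; s2; s3] ->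
    vcong V (it (j + k) (s, 1)) c /\ ~ vcong V (it j (s, 1)) c].
Proof.
have [J hJ] := avoid_all.
have lev n : exists w, vprim V w /\ level n w.
  elim: n => [|n [w [pw lw]]]; first by exists b; split=> //; apply: vcong_refl.
  have [w' [pw' lw']] := surj pw; exists w'; split=> //.
  have pw1 : vprim V (phi w') := prim_it 1 pw'.
  rewrite /level /it /hiter iterSr; apply: (trans (Q := it n w)) lw => //; try exact: prim_it.
  exact: cong_it.
have [[x y] [pw lw]] := lev J.
have [ninf _] := hJ J (leqnn J).
have scale w w' : vprim V w -> vprim V w' -> vcong V w w' -> level J w' -> level J w.
  by move=> p p' e; apply: trans; try exact: prim_it; [|apply: cong_it].
have y0 : y != 0.
  apply/eqP => y0; apply: ninf; apply: (scale _ (x, y)) lw => //.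
  by apply/vcong_all; rewrite /pdet /= y0 mulr0 mul0r subrr.
have lt : level J (x / y, 1).
  by apply: (scale _ (x, y)) lw => //; apply/vcong_all; rewrite /pdet /= divfK // mul1r subrr.
have [r1 [r2 [r12 e1 e2 l1 l2]]] := two_preimages hJ (leqnn J) lt.
have [s1 [s2 [s12 a1 a2 m1 m2]]] := two_preimages hJ (leqnSn J) l1.
have [s3 [_ [_ a3 _ m3 _]]] := two_preimages hJ (leqnSn J) l2.
have ne s : f.[s] = r1 * g.[s] -> s != s3.
  move=> a; apply/eqP => es; rewrite es in a.
  have gs : g.[s3] = 0.
    apply/eqP; apply: contraNT r12 => gs; apply/eqP; apply: (mulIf gs); by rewrite -a.
  have := coprimep_root cop (x := s3); rewrite /root a gs mulr0 eqxx => /(_ isT).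
  by [].
exists J.+2, s1, s2, s3; split=> //; try exact: ne.
have fin s : level J.+2 (s, 1) -> vcong V (it (J.+2 + k) (s, 1)) c /\ ~ vcong V (it J.+2 (s, 1)) c.
  move=> l; split.
    rewrite addnC itD; apply: trans bc; try (by repeat apply: prim_it).
    by apply: cong_it => //; apply: prim_it.
  move=> h; apply: nbc; apply: trans h; rewrite //; first exact: prim_it.
  exact: vcong_sym.
by move=> s; rewrite !inE => /or3P[] /eqP ->; apply: fin.
Qed.
End Preimages.

(** * Iterates as pairs of polynomials and as maps of coordinate pairs *)

Lemma coefX_top (R : nzRingType) (p : {poly R}) a n : (size p <= a.+1)%N ->
  (size (p ^+ n)%R <= (a * n).+1)%N /\ (p ^+ n)`_(a * n) = p`_a ^+ n.
Proof.
move=> sp; elim: n => [|n [s1 s2]]; first by rewrite muln0 !expr0 size_poly1 coef1.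
have [h1 h2] := coefM_top sp s1.
by rewrite !exprS mulnS h2 s2.
Qed.

Section IterPair.
Variables (K : fieldExtType rat) (f g : {poly K}).
Let d := ratdeg f g.

Lemma ratdeg_size : (size f <= d.+1)%N /\ (size g <= d.+1)%N.
Proof. by rewrite /d /ratdeg; split; apply: leq_trans (leqSpred _); rewrite (leq_maxl, leq_maxr). Qed.

Lemma ratdeg_top : (0 < d)%N -> f`_d != 0 \/ g`_d != 0.
Proof.
rewrite /d /ratdeg => d0; have [h|h] := leqP (size f) (size g).
  right; move: d0; rewrite (maxn_idPr h) -lead_coefE lead_coef_eq0 -size_poly_eq0; by case: (size g).
left; move: d0; rewrite (maxn_idPl (ltnW h)) -lead_coefE lead_coef_eq0 -size_poly_eq0; by case: (size f).
Qed.

Lemma homog_top (p F G : {poly K}) a : (size F <= a.+1)%N -> (size G <= a.+1)%N ->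
  (size (homog d p F G) <= (a * d).+1)%N /\ (homog d p F G)`_(a * d) = hev d p F`_a G`_a.
Proof.
move=> sF sG.
have key (i : 'I_d.+1) : (size ((p`_i)%:P * F ^+ i * G ^+ (d - i))%R <= (a * d).+1)%N /\
    ((p`_i)%:P * F ^+ i * G ^+ (d - i))`_(a * d) = p`_i * F`_a ^+ i * G`_a ^+ (d - i).
  have hi : (i <= d)%N by rewrite -ltnS.
  have [h1 h2] := coefX_top i sF; have [h3 h4] := coefX_top (d - i) sG.
  have [h5 h6] := coefM_top (size_polyC_leq1 (p`_i) : (_ <= 0.+1)%N) h1.
  have [h7 h8] := coefM_top h5 h3.
  have e : (0 + a * i + a * (d - i) = a * d)%N by rewrite add0n -mulnDr subnKC.
  by rewrite e in h7 h8; rewrite h7 h8 h6 h2 h4 coefC.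
split.
  apply: leq_trans (size_sum _ _ _) _; apply/bigmax_leqP => i _; by case: (key i).
by rewrite coef_sum; apply: eq_bigr => i _; case: (key i).
Qed.

(** The coefficients in formal degree [d^n] are coordinates of the image of infinity, so a drop in
    degree of [F_k - gam G_k] means that infinity is sent to [gam]. *)
Lemma iter_pair_top n : let FG := iter_pair f g n in
  [/\ (size FG.1 <= (d ^ n).+1)%N, (size FG.2 <= (d ^ n).+1)%N &
    (FG.1`_(d ^ n), FG.2`_(d ^ n)) = hiter d f g n (1, 0)].
Proof.
elim: n => [|n [s1 s2 e]] /=.
  by rewrite size_polyX size_poly1 coefX coef1 expn0.
have [h1 h2] := homog_top f s1 s2; have [h3 h4] := homog_top g s1 s2.
rewrite expnSr; split => //.
by rewrite h2 h4; rewrite /hiter in e *; rewrite -e.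
Qed.

Variables (E : fieldType) (tau : {rmorphism K -> E}).
Local Notation "p ^t" := (map_poly tau p) (at level 2, format "p ^t").

Lemma map_hev (p : {poly K}) x y : tau (hev d p x y) = hev d p^t (tau x) (tau y).
Proof.
rewrite rmorph_sum; apply: eq_bigr => i _.
by rewrite !rmorphM !rmorphXn coef_map.
Qed.

Lemma map_hiter n P : (tau (hiter d f g n P).1, tau (hiter d f g n P).2) =
  hiter d f^t g^t n (tau P.1, tau P.2).
Proof.
elim: n => // n IH; rewrite /hiter !iterS -!/(hiter d _ _ n _) -IH.
by rewrite /hstep /= !map_hev.
Qed.

Lemma horner_homog (p F G : {poly K}) z : (homog d p F G)^t.[z] = hev d p^t F^t.[z] G^t.[z].
Proof.
rewrite /homog rmorph_sum horner_sum; apply: eq_bigr => i _.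
by rewrite !rmorphM !hornerM !rmorphXn /= !horner_exp map_polyC hornerC coef_map.
Qed.

Lemma horner_iter_pair n z :
  ((iter_pair f g n).1^t.[z], (iter_pair f g n).2^t.[z]) = hiter d f^t g^t n (z, 1).
Proof.
elim: n => [|n IH]; first by rewrite /= map_polyX hornerX rmorph1 hornerC.
rewrite /hiter iterS -/(hiter d f^t g^t n (z, 1)) -IH /iter_pair iterS -/(iter_pair f g n).
by rewrite /hstep /= !horner_homog.
Qed.
End IterPair.

Definition ptopt (K : fieldType) (P : K * K) : option K :=
  if P.2 == 0 then None else Some (P.1 / P.2).

Section Orbit.
Variables (K : fieldExtType rat) (f g : {poly K}).
Hypothesis cop : coprimep f g.
Let d := ratdeg f g.
Hypothesis d0 : (0 < d)%N.

Lemma rat_eval_ptopt P : vprim (@allV K) P -> rat_eval f g (ptopt P) = ptopt (hstep d f g P).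
Proof.
have [sf sg] := ratdeg_size f g; rewrite -/d in sf sg.
case: P => x y /vprim_all P0; rewrite /ptopt /=; case: eqVneq => [y0|y0] /=.
  rewrite y0 !hev0 in P0 *; have x0 : x != 0 by apply: contraNneq P0 => ->.
  have xd : x ^+ d != 0 by rewrite expf_neq0.
  rewrite mulf_eq0 (negPf xd) orbF.
  have dE : d = (maxn (size f) (size g)).-1 by [].
  case: (ltngtP (size g) (size f)) => h /=.
  - by rewrite dE (maxn_idPl (ltnW h)) [g`_ _]nth_default ?eqxx // -ltnS prednK // (leq_ltn_trans _ h).
  - have gd : g`_d = lead_coef g by rewrite lead_coefE dE (maxn_idPr (ltnW h)).
    have fd : f`_d = 0.
      by rewrite dE (maxn_idPr (ltnW h)) nth_default // -ltnS prednK // (leq_ltn_trans _ h).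
    by rewrite gd lead_coef_eq0 -size_poly_eq0 gtn_eqF ?(leq_ltn_trans _ h) // fd !mul0r.
  - have gd : g`_d = lead_coef g by rewrite lead_coefE dE h maxnn.
    have fd : f`_d = lead_coef f by rewrite lead_coefE dE -h maxnn.
    rewrite gd fd lead_coef_eq0 -size_poly_eq0.
    case: eqP => s0; first by move: d0; rewrite dE -h s0.
    by congr Some; rewrite -mulf_div divff // mulr1.
rewrite !hevE // mulf_eq0 expf_eq0 (negPf y0) andbF /=.
by case: eqP => // _; congr Some; rewrite -mulf_div divff ?mul1r // expf_neq0.
Qed.

Lemma vprim_hiter n P : vprim (@allV K) P -> vprim (@allV K) (hiter d f g n P).
Proof.
have [sf sg] := ratdeg_size f g; have /Bezout_eq1_coprimepP [[u v] e] := cop.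
apply: (vprim_iter (valring_all K) sf sg) e _ _ _ => //.
by case: (ratdeg_top d0) => h; [left|right]; apply/vunit_all.
Qed.

Lemma rat_iter_ptopt n z : rat_iter f g n (Some z) = ptopt (hiter d f g n (z, 1)).
Proof.
elim: n => [|n IH]; first by rewrite /ptopt /= oner_eq0 divr1.
rewrite /rat_iter iterS -/(rat_iter f g n _) IH rat_eval_ptopt //.
apply: vprim_hiter; apply/vprim_all; apply/eqP => -[_ /eqP]; by rewrite oner_eq0.
Qed.
End Orbit.

(* Otherwise [F_k - gam G_k] would vanish only at [gam] and have full degree [d^k]. *)
Lemma exists_other_preimage (K : fieldExtType rat) (C : numClosedFieldType)
  (tau : {rmorphism K -> C}) (f g : {poly K}) (gam : K) (k : nat) :
  let d := ratdeg f g in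
  coprimep f g -> (0 < d)%N -> is_period f g gam k -> ~ polynomial_type f g gam ->
  exists b : C * C, [/\ vprim (@allV C) b, ~ vcong (@allV C) b (tau gam, 1) &
    vcong (@allV C) (hiter d (map_poly tau f) (map_poly tau g) k b) (tau gam, 1)].
Proof.
move=> d cop d0 per npt; apply: contrapT => H; apply: npt.
exists k; split=> //.
have [s1 s2 etop] := iter_pair_top f g k; rewrite -/d in s1 s2 etop.
have ev z := horner_iter_pair f g tau k z.
set Fk := (iter_pair f g k).1 in s1 etop ev *; set Gk := (iter_pair f g k).2 in s2 etop ev *.
pose h := Fk - gam%:P * Gk.
have [k0 [hk _]] := per.
have uniq b : vprim (@allV C) b ->
    vcong (@allV C) (hiter d (map_poly tau f) (map_poly tau g) k b) (tau gam, 1) -> pdet b (tau gam, 1) = 0.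
  by move=> pb cb; apply/vcong_all; apply: contrapT => n; apply: H; exists b.
have hD : h`_(d ^ k) != 0.
  apply/eqP => e; suff /eqP : pdet (1 : C, 0 : C) (tau gam, 1) = 0.
    by rewrite /pdet /= mulr1 mul0r subr0 oner_eq0.
  apply: uniq.
    by apply/vprim_all; apply/eqP => -[/eqP]; rewrite oner_eq0.
  have := map_hiter f g tau k (1, 0); rewrite -etop /= rmorph1 rmorph0 => <-.
  apply/vcong_all; rewrite /pdet /= mulr1 mulrC -rmorphM -rmorphB; move: e.
  by rewrite /h coefB coefCM => ->; rewrite rmorph0.
have sh : size h = (d ^ k).+1.
  apply/eqP; rewrite eqn_leq ltnNge; apply/andP; split; last first.
    by apply: contraNN hD => s; rewrite nth_default.
  apply: leq_trans (size_polyD _ _) _; rewrite size_polyN geq_max s1 /=.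
  by rewrite mul_polyC (leq_trans (size_scale_leq _ _)).
have roots z : root (map_poly tau h) z -> z = tau gam.
  rewrite /root /h rmorphB rmorphM /= map_polyC hornerD hornerN hornerM hornerC => /eqP e.
  suff : pdet (z, 1) (tau gam, 1) = 0.
    by rewrite /pdet /= mulr1 mul1r => /eqP; rewrite subr_eq0 => /eqP.
  apply: uniq; first by apply/vprim_all; apply/eqP => -[_ /eqP]; rewrite oner_eq0.
  by rewrite -ev; apply/vcong_all; rewrite /pdet /= mulr1 [X in _ - X]mulrC.
(* All roots over [C] equal [tau gam], so the factorisation holds there; injectivity of
   [map_poly tau] brings it down to [K]. *)
have hE : h = lead_coef h *: ('X - gam%:P) ^+ (d ^ k).
  apply: (map_poly_inj tau); rewrite map_polyZ rmorphXn /= map_polyXsubC.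
  have [rs ers] := closed_field_poly_normal (map_poly tau h).
  have h0 : map_poly tau h != 0 by rewrite map_poly_eq0 -size_poly_eq0 sh.
  have l0 : lead_coef (map_poly tau h) != 0 by rewrite lead_coef_eq0.
  have rsE : rs = nseq (d ^ k) (tau gam).
    have srs : size rs = (d ^ k)%N.
      have := congr1 (fun p : {poly C} => size p) ers.
      by rewrite size_scale // size_prod_XsubC size_map_poly sh => -[].
    rewrite -srs; apply/all_pred1P/allP => z zrs; apply/eqP/roots.
    by rewrite ers rootZ // root_prod_XsubC.
  by rewrite [LHS]ers lead_coef_map rsE big_nseq iter_mulr_1.
have l0 : lead_coef h != 0 by rewrite lead_coef_eq0 -size_poly_eq0 sh.
(* The normalised denominator of [phi^k]; it is nonzero at [gam] because [phi^k] fixes this finite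
   point. *)
exists ((lead_coef h)^-1 *: Gk); split.
  rewrite hornerZ mulf_neq0 ?invr_eq0 //.
  have := rat_iter_ptopt cop d0 k gam; rewrite hk /ptopt.
  have e2 : tau (hiter d f g k (gam, 1)).2 = tau Gk.[gam].
    have := map_hiter f g tau k (gam, 1); rewrite /= rmorph1 -ev => -[_ ->].
    by rewrite horner_map.
  by rewrite (fmorph_inj tau e2); case: eqP.
have e1 : ('X - gam%:P) ^+ (d ^ k) = (lead_coef h)^-1 *: h.
  by rewrite {2}hE scalerA mulVf // scale1r.
rewrite -/Fk -/Gk e1; have -> : Fk = h + gam%:P * Gk by rewrite subrK.
rewrite -!mul_polyC; ring.
Qed.

(** [L] is generated by all roots of the rational minimal polynomials of the given numbers and of
    the images of a basis of [K], hence is a splitting field. The embedding [iota] is [tau] followed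
    by the inverse of [j] on its image. *)
Lemma galois_number_field (K : fieldExtType rat) (tau : {rmorphism K -> algC}) (s : seq algC) :
  exists (L : splittingFieldType rat) (j : {rmorphism L -> algC}) (iota : {rmorphism K -> L}),
    (forall x, j (iota x) = tau x) /\ forall z, z \in s -> exists t, j t = z.
Proof.
pose s' := s ++ map tau (vbasis {:K}).
have rat_min (z : algC) : exists r : {poly rat}, minCpoly z = map_poly ratr r.
  by have [r [e _] _] := minCpolyP z; exists r.
have /choice [r hr] := rat_min.
pose P : {poly rat} := \prod_(z <- s') r z.
have PE : map_poly (ratr : rat -> algC) P = \prod_(z <- s') minCpoly z.
  by rewrite rmorph_prod; apply: eq_bigr => z _; rewrite /= hr.
have Pm : map_poly (ratr : rat -> algC) P \is monic.
  by rewrite PE monic_prod // => z _; apply: minCpoly_monic.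
have [rs ers] := closed_field_poly_normal (map_poly (ratr : rat -> algC) P).
rewrite (monicP Pm) scale1r in ers.
have [Qs [QsC [s1 es1 gen]]] := num_field_exists rs.
have mapE (p : {poly rat}) : map_poly QsC (map_poly (in_alg Qs) p) = map_poly ratr p.
  rewrite -map_poly_comp; apply: eq_map_poly => x /=.
  by rewrite alg_num_field fmorph_rat.
have ax : splitting_field_axiom Qs.
  exists (map_poly (in_alg Qs) P); first by apply/polyOver1P; exists P.
  exists s1; last by [].
  have -> : map_poly (in_alg Qs) P = \prod_(z <- s1) ('X - z%:P); last exact: eqpxx.
  apply: (map_poly_inj QsC); rewrite mapE ers -es1 big_map rmorph_prod /=.
  by apply: eq_bigr => z _; rewrite map_polyXsubC.
pose L : splittingFieldType rat := HB.pack Qs (FieldExt_isSplittingField.Build rat Qs ax).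
have img z : z \in s' -> exists t, QsC t = z.
  move=> zs; have : z \in rs.
    rewrite -(root_prod_XsubC rs) -ers PE (big_rem z) //= rootM root_minCpoly //.
  by rewrite -es1 => /mapP [t _ ->]; exists t.
have imgK (x : K) : exists t, QsC t = tau x.
  have /choice [t0 ht] : forall i : 'I_(\dim {:K}), exists t, QsC t = tau (vbasis {:K})`_i.
    move=> i; apply: img; rewrite mem_cat map_f ?orbT //; apply: mem_nth; by rewrite size_tuple.
  exists (\sum_i coord (vbasis {:K}) i x *: t0 i).
  rewrite [in RHS](coord_vbasis (memvf x)) !rmorph_sum; apply: eq_bigr => i _.
  by rewrite !rmorphZ_num ht.
have /choice [iota hi] := imgK.
have ia : zmod_morphism iota by move=> x y; apply: (fmorph_inj QsC); rewrite rmorphB !hi rmorphB.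
have im : monoid_morphism iota.
  by split=> [|x y]; apply: (fmorph_inj QsC); rewrite ?rmorphM !hi (rmorph1, rmorphM) // rmorph1.
pose iA := GRing.isZmodMorphism.Build K Qs iota ia.
pose iM := GRing.isMonoidMorphism.Build K Qs iota im.
pose iR : {rmorphism K -> Qs} := HB.pack iota iA iM.
exists L, QsC, iR; split=> // z zs; apply: img; by rewrite mem_cat zs.
Qed.

(** * Places of a Galois number field *)

Section Embedding.
Variables (K : fieldExtType rat) (C : numClosedFieldType).

Lemma number_field_primitive : exists th : K, forall x : K,
  exists q : {poly rat}, x = (map_poly (in_alg K) q).[th].
Proof.
exists (separable_generator 1 {:K}) => x.
have sep : separable 1 {:K}.
  by apply/separableP => y _; apply: pcharf0_separable => p; rewrite pchar_lalg pchar_num.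
have e := eq_adjoin_separable_generator sep (sub1v _).
have : x \in <<1; separable_generator 1 {:K}>>%VS by rewrite -e memvf.
move/Fadjoin_polyP => [p /polyOver1P[q ->] ->]; by exists q.
Qed.

Lemma number_field_embedding : inhabited {rmorphism K -> C}.
Proof.
have [th gen] := number_field_primitive.
have /polyOver1P[mu muE] := minPolyOver 1 th.
have smu : (1 < size mu)%N by rewrite -(size_map_poly (in_alg K)) -muE size_minPoly ltnS adjoin_degreeE dimv1 divn1 adim_gt0.
have [z rz] : exists z, root (map_poly (ratr : rat -> C) mu) z.
  by apply/closed_rootP; rewrite size_map_poly neq_ltn smu orbT.
have wd (p q : {poly rat}) : (map_poly (in_alg K) p).[th] = (map_poly (in_alg K) q).[th] ->
    (map_poly (ratr : rat -> C) p).[z] = (map_poly (ratr : rat -> C) q).[z].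
  move=> e; have : minPoly 1 th %| map_poly (in_alg K) (p - q).
    apply: minPoly_dvdp; first by apply/polyOver1P; exists (p - q).
    by rewrite /root rmorphB hornerD hornerN e subrr.
  rewrite muE dvdp_map => /dvdpP[r re].
  have : (map_poly (ratr : rat -> C) (p - q)).[z] = 0.
    by rewrite re rmorphM hornerM (rootP rz) mulr0.
  by rewrite rmorphB hornerD hornerN => /eqP; rewrite subr_eq0 => /eqP.
have /choice [Q hQ] := gen.
pose h x := (map_poly (ratr : rat -> C) (Q x)).[z].
suff [ha hm] : zmod_morphism h /\ monoid_morphism h.
  pose hA := GRing.isZmodMorphism.Build _ _ h ha.
  pose hM := GRing.isMonoidMorphism.Build _ _ h hm.
  by constructor; exact: (HB.pack h hA hM : {rmorphism K -> C}).
rewrite /h; split; last split.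
- move=> x y; rewrite -hornerN -hornerD -rmorphB; apply: wd.
  by rewrite -hQ rmorphB hornerD hornerN -!hQ.
- have -> : 1 = (map_poly (ratr : rat -> C) 1).[z] by rewrite rmorph1 hornerC.
  by apply: wd; rewrite -hQ rmorph1 hornerC.
- move=> x y; rewrite -hornerM -rmorphM; apply: wd.
  by rewrite -hQ rmorphM hornerM -!hQ.
Qed.
End Embedding.

Section Places.
Variables (R : realType) (L : splittingFieldType rat) (m : nat).
Hypothesis m0 : (0 < m)%N.

(** Stands for a prime not above any divisor of [m]. The clause with [q] excludes the whole
    field. *)
Definition good_valring (V : L -> Prop) :=
  [/\ valring V, exists2 q : nat, prime q & ~ V (q%:R)^-1 & V (m%:R)^-1].

Definition Sint (x : L) := forall V, good_valring V -> V x.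

Let G := gal_of {:L}.
(** A place is an automorphism with a place of the rationals, [None] being archimedean.
    Automorphisms that induce the same place repeat a factor, exactly so that the product over [G]
    is an absolute value of the norm. *)
Let I := (G * option (seq_sub (primes m)))%type.

Lemma good_valring_gal (g : G) V : good_valring V -> good_valring (fun x => V (g x)).
Proof.
case=> hV [q pq hq] hm; split; first exact: valring_comp.
  by exists q => //; rewrite fmorphV rmorph_nat.
by rewrite fmorphV rmorph_nat.
Qed.

Lemma Sint_gal (g : G) x : Sint x -> Sint (g x).
Proof. by move=> hx V gV; apply: (hx _ (good_valring_gal g gV)). Qed.

Lemma Sint1 : Sint 1. Proof. by move=> V [hV _ _]; apply: vr1. Qed.
Lemma SintB x y : Sint x -> Sint y -> Sint (x - y).
Proof. by move=> hx hy V gV; have [hV _ _] := gV; apply: vrB; [|apply: hx|apply: hy]. Qed.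
Lemma SintM x y : Sint x -> Sint y -> Sint (x * y).
Proof. by move=> hx hy V gV; have [hV _ _] := gV; apply: vrM; [|apply: hx|apply: hy]. Qed.
Lemma Sint_prod (J : Type) (r : seq J) (f : J -> L) :
  (forall j, Sint (f j)) -> Sint (\prod_(j <- r) f j).
Proof. by move=> h; elim/big_ind: _ => //; [apply: Sint1 | apply: SintM]. Qed.

Lemma prod_gal_rat x : exists r : rat, \prod_(g : G) g x = r%:A.
Proof.
have gal1 : galois 1 {:L}.
  apply/and3P; split; [exact: sub1v| |exact: normalFieldf].
  by apply/separableP => y _; apply: pcharf0_separable => p; rewrite pchar_lalg pchar_num.
have /vlineP [r e] := mem_galNorm gal1 (memvf x); exists r; rewrite -e /galNorm.
by apply: eq_bigl => g; rewrite gal_kHom ?sub1v // k1AHom.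
Qed.

Variable emb : {rmorphism L -> R[i]}.
Let arch (x : L) : R := ComplexField.Normc.normc (emb x).

Variable pad : nat -> L -> R.
Hypothesis padP : forall l, prime l ->
  [/\ forall x, 0 <= pad l x, pad l 0 = 0, forall x, pad l x = 0 -> x = 0,
      forall x y, pad l (x * y) = pad l x * pad l y &
      forall x y, pad l (x + y) <= Num.max (pad l x) (pad l y)] /\
  [/\ pad l l%:R = l%:R^-1, forall n, coprime l n -> pad l n%:R = 1 &
      forall z : int, pad l z%:~R <= 1].

Let nm (i : I) (x : L) : R :=
  if i.2 is Some p then pad (val p) (i.1 x) else arch (i.1 x).

Let prime_mem (p : seq_sub (primes m)) : prime (val p).
Proof. by case: p => p /=; rewrite mem_primes => /andP[]. Qed.

Let normc_ge0 (z : R[i]) : 0 <= ComplexField.Normc.normc z.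
Proof. by case: z => a b; rewrite sqrtr_ge0. Qed.

Let arch1 : arch 1 = 1.
Proof. by rewrite /arch rmorph1 ComplexField.Normc.normc1. Qed.
Let archM x y : arch (x * y) = arch x * arch y.
Proof. by rewrite /arch rmorphM ComplexField.Normc.normcM. Qed.
Let arch_nat n : arch n%:R = n%:R.
Proof. by rewrite /arch rmorph_nat ; apply: complexI; rewrite -[LHS]/(`|n%:R : R[i]|) normr_nat rmorph_nat. Qed.

Let nm_ge0 i x : 0 <= nm i x.
Proof.
case: i => g [p|] /=; last exact: normc_ge0.
by have [[h _ _ _ _] _] := padP (prime_mem p); apply: h.
Qed.

Let nm0 i : nm i 0 = 0.
Proof.
case: i => g [p|] /=; rewrite /nm /= rmorph0; last by rewrite /arch rmorph0 ComplexField.Normc.normc0.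
by have [[_ h _ _ _] _] := padP (prime_mem p).
Qed.

Let nmM i x y : nm i (x * y) = nm i x * nm i y.
Proof.
case: i => g [p|] /=; rewrite /nm /= rmorphM; last exact: archM.
by have [[_ _ _ h _] _] := padP (prime_mem p).
Qed.

Let nm_eq0 i x : nm i x = 0 -> x = 0.
Proof.
case: i => g [p|] /=; rewrite /nm /= => h.
  have [[_ _ h' _ _] _] := padP (prime_mem p).
  by apply: (fmorph_inj g); rewrite rmorph0; apply: h' h.
by apply: (fmorph_inj (emb \o g)); rewrite rmorph0; apply: ComplexField.Normc.eq0_normc h.
Qed.

Let nmD i x y : nm i (x + y) <= nm i x + nm i y.
Proof.
case: i => g [p|] /=; rewrite /nm /= rmorphD; last first.
  by rewrite /arch rmorphD le_normcD.
have [[h0 _ _ _ h] _] := padP (prime_mem p); apply: le_trans (h _ _) _.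
by rewrite ge_max lerDl lerDr !h0.
Qed.

Let nm1 i : nm i 1 = 1.
Proof.
case: i => g [p|] /=; rewrite /nm /= rmorph1; last exact: arch1.
by have [_ [_ h _]] := padP (prime_mem p); rewrite -[1]/(1%:R) h ?coprimen1.
Qed.

(* The product of the archimedean and the p-adic absolute values, [p | m]. *)
Let rho (x : L) : R := arch x * \prod_(p : seq_sub (primes m)) pad (val p) x.

Let rhoM x y : rho (x * y) = rho x * rho y.
Proof.
rewrite /rho archM mulrACA -big_split /=; congr (_ * _).
by apply: eq_bigr => p _; have [[_ _ _ h _] _] := padP (prime_mem p).
Qed.

(** For [q] dividing [m], the archimedean [q] cancels against [|q|_q = 1/q]; so [rho] of a positive
    integer is its part prime to [m]. *)
Let rho_prime q : prime q -> rho q%:R = if (q %| m)%N then 1 else q%:R.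
Proof.
move=> pq; rewrite /rho arch_nat; case: ifP => qm; last first.
  rewrite big1 ?mulr1 // => p _; have [_ [_ h _]] := padP (prime_mem p); apply: h.
  rewrite prime_coprime ?prime_mem // dvdn_prime2 ?prime_mem //; apply: contraFN qm => /eqP <-.
  by case: (p) => /= p'; rewrite mem_primes => /and3P[].
have qp : q \in primes m by rewrite mem_primes pq m0.
rewrite (bigD1 (SeqSub qp)) //= big1 ?mulr1; last first.
  move=> p np; have [_ [_ h _]] := padP (prime_mem p); apply: h.
  rewrite prime_coprime ?prime_mem // dvdn_prime2 ?prime_mem //.
have [_ [-> _ _]] := padP pq.
by rewrite divff // pnatr_eq0 -lt0n prime_gt0.
Qed.

Let rho1 : rho 1 = 1.
Proof.
rewrite /rho arch1 big1 ?mulr1 // => p _.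
by have [_ [_ h _]] := padP (prime_mem p); rewrite -[1]/(1%:R) h ?coprimen1.
Qed.

Let rho_ge1 n : (0 < n)%N -> 1 <= rho n%:R.
Proof.
elim/ltn_ind: n => n IH n0; case: (ltnP 1 n) => n1; last first.
  by have -> : n = 1%N by [lia]; rewrite rho1.
have pn := pdiv_prime n1; have hd := divnK (pdiv_dvd n).
set q := pdiv n in pn hd; set k := (n %/ q)%N in hd.
have -> : rho n%:R = rho k%:R * (if (q %| m)%N then 1 else q%:R) by rewrite -hd natrM rhoM (rho_prime pn).
have h : 1 <= rho k%:R.
  by apply: IH; rewrite ?ltn_Pdiv ?prime_gt1 // divn_gt0 ?prime_gt0 // dvdn_leq ?pdiv_dvd.
case: ifP => _; first by rewrite mulr1.
by apply: (le_trans h); rewrite ler_peMr ?(ler1n, prime_gt0 pn) //; apply: le_trans h; apply: ler01.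
Qed.

Let rho_eq1 n : (0 < n)%N -> (forall q, prime q -> (q %| n)%N -> (q %| m)%N) -> rho n%:R = 1.
Proof.
elim/ltn_ind: n => n IH n0 hq; case: (ltnP 1 n) => n1; last first.
  by have -> : n = 1%N by [lia]; rewrite rho1.
have pn := pdiv_prime n1; have hd := divnK (pdiv_dvd n).
have qm := hq _ pn (pdiv_dvd n).
set q := pdiv n in pn hd qm; set k := (n %/ q)%N in hd.
have -> : rho n%:R = rho k%:R by rewrite -hd natrM rhoM (rho_prime pn) qm mulr1.
apply: IH.
- by rewrite ltn_Pdiv ?prime_gt1.
- by rewrite divn_gt0 ?prime_gt0 // dvdn_leq ?pdiv_dvd.
- by move=> p pp pd; apply: hq => //; rewrite -hd dvdn_mulr.
Qed.

Let ratE (r : rat) : (r%:A : L) = (numq r)%:~R / (denq r)%:~R.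
Proof.
rewrite -[in LHS](divq_num_den r) -[_%:A]/(in_alg L _) fmorph_div.
by rewrite !(rmorph_int (in_alg L)).
Qed.

(** A prime [q] of the denominator not dividing [m] has a valuation ring omitting [q^-1], and it is
    good. There the numerator is a unit, so membership of [r] would invert [q]. *)
Let Sint_rat_den (r : rat) : Sint (r%:A) -> forall q, prime q -> (q %| `|denq r|)%N -> (q %| m)%N.
Proof.
move=> Sr q pq qd; apply: contraT => qm.
have q0 : (q%:R : L) != 0 by rewrite (intK_eq0 L q) -lt0n prime_gt0.
have [V [hV nV]] := exists_valring q0 (fun z => intr_nonunit L z pq).
have gV : good_valring V.
  split=> //; first by exists q.
  by have [] : vunit V (m%:R : L) by apply: (vunit_coprime hV pq nV); rewrite prime_coprime.
have Vr := Sr V gV; exfalso; apply nV.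
have rE := ratE r.
have un : vunit V ((numq r)%:~R : L).
  apply: nvmax_unit; first exact: vr_int.
  move=> /(vmax_int_dvd hV pq nV) h.
  have := coprime_num_den r; rewrite /coprime => /eqP co.
  have : (q %| 1)%N by rewrite -co dvdn_gcd qd andbT.
  by rewrite dvdn1 => /eqP q1; rewrite q1 in pq.
have d0 : ((denq r)%:~R : L) != 0 by rewrite intK_eq0 denq_neq0.
have Vd : V ((denq r)%:~R)^-1.
  have [n0 _ hn] := un; rewrite rE in Vr.
  by have := vrM hV Vr hn; rewrite mulrAC divff // mul1r.
have : denq r = ((`|denq r| %/ q)%N * q)%N :> int by rewrite divnK // gez0_abs // denq_ge0.
move=> e; rewrite e PoszM intrM in Vd.
have := vrM hV (vr_int hV (`|denq r| %/ q)%N) Vd; rewrite invfM mulrA divff ?mul1r //.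
by apply: contra_neq d0 => h; rewrite e PoszM intrM h mul0r.
Qed.

Let prod_nm t : \prod_(i : I) nm i t = rho (\prod_(g : G) g t).
Proof.
rewrite -(pair_bigA _ (fun g j => nm (g, j) t)) exchange_big /=.
have archprod : arch (\prod_(g : G) g t) = \prod_(g : G) arch (g t).
  exact: (big_morph arch archM arch1).
have padprod (p : seq_sub (primes m)) :
    pad (val p) (\prod_(g : G) g t) = \prod_(g : G) pad (val p) (g t).
  have [[_ _ _ hM _] [_ h1 _]] := padP (prime_mem p).
  by apply: (big_morph _ hM); rewrite -[1]/(1%:R) h1 ?coprimen1.
rewrite /rho archprod (eq_bigr _ (fun p _ => padprod p)).
rewrite (bigD1 None) //=; congr (_ * _).
rewrite (reindex_omap Some id) /=; last by case.
by apply: eq_bigl => p; rewrite eqxx.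
Qed.

(** The norm of [t] is a rational S-integer: [rho] of its denominator is [1], and [rho] of its
    nonzero numerator is at least [1]. *)
Let prod_nm_ge1 t : Sint t -> t != 0 -> 1 <= \prod_(i : I) nm i t.
Proof.
move=> St t0; rewrite prod_nm.
have SN : Sint (\prod_(g : G) g t) by apply: Sint_prod => g; apply: Sint_gal.
have N0 : \prod_(g : G) g t != 0 by apply/prodf_neq0 => g _; rewrite fmorph_eq0.
have [r e] := prod_gal_rat t; rewrite e in SN N0 *.
have rE : (r%:A : L) * (`|denq r|%N)%:R = (numq r)%:~R.
  have -> : (`|denq r|%N)%:R = (denq r)%:~R :> L by rewrite -[in RHS](gez0_abs (denq_ge0 r)).
  by rewrite ratE divfK // intK_eq0 denq_neq0.
have rd : rho (`|denq r|%N)%:R = 1.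
  by apply: rho_eq1; rewrite ?absz_gt0 ?denq_neq0 //; apply: Sint_rat_den.
have := congr1 rho rE; rewrite rhoM rd mulr1 => ->.
have n0 : numq r != 0.
  by rewrite numq_eq0; apply: contraNneq N0 => ->; rewrite scale0r.
have rhoN1 : rho (-1) = 1.
  have := rhoM (-1) (-1); rewrite mulrNN mulr1 rho1 => /esym/eqP; rewrite -expr2 sqrf_eq1.
  have h0 : 0 <= rho (-1).
    rewrite mulr_ge0 ?normc_ge0 // prodr_ge0 // => p _.
    by have [[h _ _ _ _] _] := padP (prime_mem p).
  by case/orP => /eqP // h; rewrite h oppr_ge0 ler10 in h0.
have : 1 <= rho (`|numq r|%N)%:R by apply: rho_ge1; rewrite absz_gt0.
case: (numq r) => n //; rewrite NegzE mulrNz -[- _ in X in _ -> X]mulN1r rhoM rhoN1 mul1r //.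
Qed.

(** Two terms that are close under every complex embedding differ by a nonzero S-integer whose
    product of absolute values is below [1]. *)
Let bounded_not_inj (B : R) (t : nat -> L) :
  (forall n, Sint (t n)) -> (forall n i, nm i (t n) <= B) -> ~ injective t.
Proof.
move=> St hB tinj.
pose s := #|{: seq_sub (primes m)}|; pose B' := Num.max B 1.
have B'1 : 1 <= B' by rewrite le_max lexx orbT.
have Bs : 0 < B' ^+ s by rewrite exprn_gt0 // (lt_le_trans ltr01).
(* For each automorphism the archimedean factor is at most [2 e] and the [s] others at most [B']
   each, so their product is at most [1/2]. *)
pose e := (4 * B' ^+ s)^-1.
have e0 : 0 < e by rewrite invr_gt0 mulr_gt0.
pose v n (j : G * bool) : R := if j.2 then complex.Re (emb (j.1 (t n))) else complex.Im (emb (j.1 (t n))).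
have normRe (z : R[i]) : `|complex.Re z| <= ComplexField.Normc.normc z.
  by case: z => a b /=; rewrite -sqrtr_sqr ler_wsqrtr // lerDl sqr_ge0.
have normIm (z : R[i]) : `|complex.Im z| <= ComplexField.Normc.normc z.
  by case: z => a b /=; rewrite -sqrtr_sqr ler_wsqrtr // lerDr sqr_ge0.
have norm_le (z : R[i]) : ComplexField.Normc.normc z <= `|complex.Re z| + `|complex.Im z|.
  case: z => a b /=; rewrite -[leRHS]ger0_norm ?addr_ge0 // -sqrtr_sqr ler_wsqrtr //.
  rewrite sqrrD !real_normK ?num_real // addrAC lerDl mulrn_wge0 // mulr_ge0 //.
have vb n j : `|v n j| <= B.
  case: j => g []; rewrite /v /=.
    by apply: le_trans (normRe _) (hB n (g, None)).
  by apply: le_trans (normIm _) (hB n (g, None)).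
have [a [b [ab close]]] := pigeonhole_close e0 vb.
pose d := t a - t b.
have d0 : d != 0 by rewrite subr_eq0; apply: contraTneq ab => /tinj ->; rewrite ltnn.
have Sd : Sint d by apply: SintB.
have := prod_nm_ge1 Sd d0; rewrite leNgt => /negP; apply.
rewrite -(pair_bigA _ (fun g j => nm (g, j) d)) /=.
have hg (g : G) : \prod_(j : option (seq_sub (primes m))) nm (g, j) d <= 2^-1.
  rewrite (bigD1 None) //=.
  have h1 : nm (g, None) d <= 2 * e.
    rewrite /nm /= /arch; apply: le_trans (norm_le _) _.
    have c1 := close (g, true); have c2 := close (g, false); rewrite /v /= in c1 c2.
    rewrite /d !rmorphB /=; set z := emb _ in c1 c2 *; set w := emb _ in c1 c2 *.
    have -> : complex.Re (z - w) = complex.Re z - complex.Re w by case: (z) (w) => ? ? [].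
    have -> : complex.Im (z - w) = complex.Im z - complex.Im w by case: (z) (w) => ? ? [].
    by rewrite mulr_natl mulr2n lerD.
  have h2 : \prod_(j | j != None) nm (g, j) d <= B' ^+ s.
    rewrite (reindex_omap Some id) /=; last by case.
    rewrite (eq_bigl xpredT); last by move=> p; rewrite eqxx.
    rewrite /s -prodr_const; apply: ler_prod => p _; rewrite nm_ge0 /=.
    have [[_ _ _ _ h] _] := padP (prime_mem p).
    have [[_ _ _ hM _] [_ h1' _]] := padP (prime_mem p).
    rewrite /nm /= /d rmorphB; apply: le_trans (h _ _) _; rewrite ge_max le_max.
    rewrite (hB a (g, Some p)) /=.
    have -> : pad (ssval p) (- g (t b)) = pad (ssval p) (g (t b)).
      have N1 : pad (ssval p) (-1) <= 1 by have [_ [_ _ hz]] := padP (prime_mem p); have := hz (-1); rewrite rmorphN1.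
      have sq : pad (ssval p) (-1) * pad (ssval p) (-1) = 1.
        by rewrite -hM mulrNN mulr1 -[1]/(1%:R) h1' ?coprimen1.
      have e1 : pad (ssval p) (-1) = 1.
        have [[h0 _ _ _ _] _] := padP (prime_mem p); have := h0 (-1).
        move: sq N1; rewrite /=; set y := pad _ _; nra.
      by rewrite -mulN1r hM e1 mul1r.
    by rewrite le_max (hB b (g, Some p)).
  apply: le_trans (ler_pM _ _ h1 h2) _; rewrite ?nm_ge0 ?prodr_ge0 //.
  by rewrite /e le_eqVlt; apply/orP; left; apply/eqP; field; rewrite (gt_eqF Bs).
rewrite (bigD1 (1%g : G)) //=.
have hr : \prod_(g : G | g != 1%g) \prod_(j : option (seq_sub (primes m))) nm (g, j) d <= 1.
  apply: prodr_ile1 => g _; rewrite prodr_ge0 //=; apply: le_trans (hg g) _; lra.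
have h0 : 0 <= \prod_(j : option (seq_sub (primes m))) nm (1%g, j) d by rewrite prodr_ge0.
apply: le_lt_trans (ler_piMr h0 hr) _; apply: le_lt_trans (hg _) _; lra.
Qed.

Lemma Sunit_finite (u : nat -> L) :
  (forall n, [/\ Sint (u n), Sint (u n)^-1, Sint (1 - u n) & Sint (1 - u n)^-1]) ->
  (forall n, u n != 0 /\ 1 - u n != 0) -> ~ injective u.
Proof.
apply: (finitely_many_unit_solutions nm_ge0 nm0 nm1 nm_eq0 nmM nmD _ Sint1 SintB SintM
  prod_nm_ge1 bounded_not_inj).
by move=> z /eqP; rewrite intK_eq0 => /eqP.
Qed.
End Places.

Theorem Sunit_equation_finite (L : splittingFieldType rat) (m : nat) (u : nat -> L) :
  (0 < m)%N ->
  (forall n, [/\ Sint m (u n), Sint m (u n)^-1, Sint m (1 - u n) & Sint m (1 - u n)^-1]) ->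
  (forall n, u n != 0 /\ 1 - u n != 0) -> ~ injective u.
Proof.
move=> m0; pose R : realType := Rdefinitions.R.
have [emb] := number_field_embedding L (complex.complex R : numClosedFieldType).
have /choice [pad padP] : forall l : nat, exists pad : L -> R, prime l ->
  [/\ forall x, 0 <= pad x, pad 0 = 0, forall x, pad x = 0 -> x = 0,
      forall x y, pad (x * y) = pad x * pad y &
      forall x y, pad (x + y) <= Num.max (pad x) (pad y)] /\
  [/\ pad l%:R = l%:R^-1, forall n, coprime l n -> pad n%:R = 1 &
      forall z : int, pad z%:~R <= 1].
  move=> l; have [pl|npl] := boolP (prime l); last by exists (fun=> 0).
  have l0 : (l%:R : L) != 0 by rewrite (intK_eq0 L l) -lt0n prime_gt0.
  have [V [hV nV]] := exists_valring l0 (fun z => intr_nonunit L z pl).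
  have [pad [[h1 h2 h3 h4 h5] [h6 h7]]] := exists_padic_abs R hV pl nV.
  exists pad => _; split=> //; split=> // [n co|z]; last exact: h7 (vr_int hV z).
  have [n0 Vn VVn] := vunit_coprime hV pl nV co.
  apply/eqP; rewrite eq_le h7 //=.
  have p1 : pad 1 = 1.
    have : pad 1 != 0 by apply/negP => /eqP /h3 /eqP; rewrite oner_eq0.
    by move=> /mulfI; apply; rewrite -h4 !mulr1.
  have := h4 n%:R n%:R^-1; rewrite divff // p1 => ->.
  by rewrite ler_piMr ?h1 ?h7.
exact: (Sunit_finite m0 emb padP).
Qed.

Lemma unit_multiplier_seq (L : fieldExtType rat) (T : seq L) :
  exists2 m : nat, (0 < m)%N & forall V, valring V -> V (m%:R)^-1 ->
    forall t, t \in T -> t != 0 -> vunit V t.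
Proof.
elim: T => [|x T [m m0 hm]]; first by exists 1%N.
have [n n0 hn] : exists2 n : nat, (0 < n)%N & forall V, valring V -> V (n%:R : L)^-1 -> x != 0 -> vunit V x.
  have [->|x0] := eqVneq x 0; first by exists 1%N.
  by have [n n0 hn] := unit_multiplier x0; exists n => // V hV h _; apply: hn.
exists (n * m)%N; first by rewrite muln_gt0 n0.
have n0' : (n%:R : L) != 0 by rewrite (intK_eq0 L n) -lt0n.
have m0' : (m%:R : L) != 0 by rewrite (intK_eq0 L m) -lt0n.
move=> V hV hnm t; rewrite inE => /orP[/eqP ->|tT] t0.
  apply: hn => //; have := vrM hV (vr_nat hV m) hnm.
  by rewrite natrM invfM mulrCA divff // mulr1.
apply: hm => //; have := vrM hV (vr_nat hV n) hnm.
by rewrite natrM invfM mulrA divff // mul1r.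
Qed.

Lemma vmax_comp (F E : fieldType) (h : {rmorphism F -> E}) (V : E -> Prop) x :
  vmax (fun x => V (h x)) x <-> vmax V (h x).
Proof.
rewrite /vmax fmorphV; split=> -[e|]; try by right.
  by left; rewrite e rmorph0.
by left; apply: (fmorph_inj h); rewrite e rmorph0.
Qed.

Lemma ptopt_eq (F : fieldType) (P Q : F * F) :
  P != 0 -> Q != 0 -> pdet P Q = 0 -> ptopt P = ptopt Q.
Proof.
case: P => x y; case: Q => x' y' P0 Q0; rewrite /pdet /ptopt /= => /eqP; rewrite subr_eq0 => /eqP e.
have [y0|y0] := eqVneq y 0; have [y'0|y'0] := eqVneq y' 0 => //.
- move: e; rewrite y0 mul0r => /eqP; rewrite mulf_eq0 (negPf y'0) orbF => /eqP x0.
  by rewrite x0 y0 eqxx in P0.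
- move: e; rewrite y'0 mulr0 => /esym/eqP; rewrite mulf_eq0 (negPf y0) /= => /eqP x0.
  by rewrite x0 y'0 eqxx in Q0.
by congr Some; apply/eqP; rewrite eqr_div // e mulrC.
Qed.

(** * Zsigmondy indices and S-units *)

Section ResiduePrime.
Variables (K : fieldExtType rat) (V : K -> Prop) (q : nat).
Hypothesis hV : valring V.
Hypothesis pq : prime q.
Hypothesis nVq : ~ V (q%:R)^-1.

Definition vprime_ideal (x : K) : Prop := integral x /\ vmax V x.

Lemma vprime_idealP : prime_ideal vprime_ideal.
Proof.
have iV x : integral x -> V x := vr_integral_mem hV.
split; first by move=> x [].
split; first by split; [apply/integralP/integral0 | left].
split.
  move=> x y [ix mx] [iy my]; split; last exact: vmaxD.
  by apply/integralP/integral_add; apply/integralP.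
split.
  move=> a x ia [ix mx]; split; last by apply: vmaxMl => //; apply: iV.
  by apply/integralP/integral_mul; apply/integralP.
split; first by case=> _ /(vmax1 hV).
split.
  move=> x y ix iy [_ mxy]; have [] := vmax_prime hV (iV _ ix) (iV _ iy) mxy => ?; by [left|right].
exists q%:R; split; last by rewrite (intK_eq0 K q) -lt0n prime_gt0.
by split; [apply/integralP/integral_nat | right].
Qed.

Variables (f g : {poly K}) (gam alpha : K).
Hypothesis cop : coprimep f g.
Let d := ratdeg f g.
Hypothesis d0 : (0 < d)%N.
Hypothesis Vgam : V gam.

(** The bridge between ideals and reduction. If the difference [w] is finite but not in the maximal
    ideal, [vr_fraction] writes [w^-1 = b / c] with [b], [c] integral and [c] a unit of [V]; then
    [c = w * b] is in the numerator ideal but not in the prime. *)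
Lemma ideal_dvd_vcong n : vprim V (hiter d f g n (alpha, 1)) ->
  ideal_dvd vprime_ideal (numer_ideal f g gam alpha n) <->
  vcong V (hiter d f g n (alpha, 1)) (gam, 1).
Proof.
have iV x : integral x -> V x := vr_integral_mem hV.
rewrite /ideal_dvd /numer_ideal (rat_iter_ptopt cop d0) -/d.
case: (hiter _ _ _ _ _) => x y [/= Vx Vy nm]; rewrite /vcong /pdet /ptopt /= mulr1.
split=> [h|h].
  apply: contrapT => nxy; case: eqP h => [y0|/eqP y0] h.
    have /h [_ /(vmax1 hV)//] : integral (1 : K) /\ True by split=> //; apply/integralP/integral1.
  set w := x / y - gam in h.
  have wE : x - y * gam = y * w by rewrite /w mulrBr mulrCA divff // mulr1.
  have nw : ~ vmax V w by move=> mw; apply: nxy; rewrite wE; apply: vmaxMl.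
  have w0 : w != 0 by apply/eqP => w0; apply: nw; left.
  have Vw : V w^-1 by apply: contrapT => ?; apply: nw; right.
  have [b [c [ib ic uc e]]] := vr_fraction hV pq nVq Vw.
  have /h [_ mc] : integral c /\ exists b, integral b /\ c = w * b.
    by split=> //; exists b; split=> //; rewrite e mulVKf.
  exact: vmax_unit uc mc.
have ny : ~ vmax V y.
  move=> my; apply: nm; split=> //; rewrite -[x](subrK (y * gam)).
  by apply: vmaxD => //; apply: vmaxMr.
have [y0 _ Vy'] := nvmax_unit Vy ny.
move=> t [it]; rewrite (negPf y0) => -[b [ib e]]; split=> //.
rewrite e; apply: vmaxMr => //; first exact: iV.
have -> : x / y - gam = y^-1 * (x - y * gam) by rewrite mulrBr mulKf // mulrC.
exact: vmaxMl.
Qed.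

Lemma zsigmondy_vcong n : (forall i, vprim V (hiter d f g i (alpha, 1))) ->
  in_zsigmondy f g gam alpha n -> vcong V (hiter d f g n (alpha, 1)) (gam, 1) ->
  exists2 i, (1 <= i < n)%N & vcong V (hiter d f g i (alpha, 1)) (gam, 1).
Proof.
move=> pr [n1 nprim] cn; apply: contrapT => H; apply: nprim; exists vprime_ideal.
split; first exact: vprime_idealP.
split; first exact/(ideal_dvd_vcong (pr n)).
move=> i hi /(ideal_dvd_vcong (pr i)) ci; by apply: H; exists i.
Qed.
End ResiduePrime.

Lemma ratdeg_map (K : fieldExtType rat) (L : fieldExtType rat) (h : {rmorphism K -> L}) (f g : {poly K}) :
  ratdeg (map_poly h f) (map_poly h g) = ratdeg f g.
Proof. by rewrite /ratdeg !size_map_poly. Qed.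

Lemma map_pdet (F E : fieldType) (h : {rmorphism F -> E}) (P Q : F * F) :
  h (pdet P Q) = pdet (h P.1, h P.2) (h Q.1, h Q.2).
Proof. by rewrite /pdet rmorphB !rmorphM. Qed.

Lemma period_pdet (K : fieldExtType rat) (f g : {poly K}) (gam : K) (r : nat) :
  coprimep f g -> (0 < ratdeg f g)%N ->
  rat_iter f g r (Some gam) = Some gam <->
  pdet (hiter (ratdeg f g) f g r (gam, 1)) (gam, 1) = 0.
Proof.
move=> cop d0; rewrite (rat_iter_ptopt cop d0).
have : vprim (@allV K) (hiter (ratdeg f g) f g r (gam, 1)).
  by apply: vprim_hiter => //; apply/vprim_all; apply/eqP => -[_ /eqP]; rewrite oner_eq0.
case: (hiter _ _ _ _ _) => x y /vprim_all P0; rewrite /ptopt /pdet /= mulr1.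
case: eqVneq => [y0|y0].
  split=> // e; rewrite y0 mul0r subr0 in e; by rewrite e y0 eqxx in P0.
split=> [[<-]|/eqP]; first by rewrite mulrCA divff // mulr1 subrr.
by rewrite subr_eq0 => /eqP ->; rewrite mulrAC divff // mul1r.
Qed.

Lemma preimage_configuration (K : fieldExtType rat) (f g : {poly K}) (gam : K) (k : nat) :
  let d := ratdeg f g in
  coprimep f g -> (2 <= d)%N -> is_period f g gam k -> ~ polynomial_type f g gam ->
  exists (L : splittingFieldType rat) (h : {rmorphism K -> L}) (j : nat) (t1 t2 t3 : L),
    [/\ t1 != t2, t1 != t3, t2 != t3 & forall t, t \in [:: t1; t2; t3] ->
      pdet (hiter d (map_poly h f) (map_poly h g) (j + k) (t, 1)) (h gam, 1) = 0 /\
      pdet (hiter d (map_poly h f) (map_poly h g) j (t, 1)) (h gam, 1) != 0].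
Proof.
move=> d cop d2 per npt; have d0 : (0 < d)%N by apply: ltnW.
have [tau] := number_field_embedding K algC.
have [b [pb nb cb]] := exists_other_preimage tau cop d0 per npt.
have [sf sg] := ratdeg_size f g; have top := ratdeg_top d0.
have [k0 [hk _]] := per.
have pc : vprim (@allV algC) (tau gam, 1).
  by apply/vprim_all; apply/eqP => -[_ /eqP]; rewrite oner_eq0.
have cc : vcong (@allV algC) (hiter d (map_poly tau f) (map_poly tau g) k (tau gam, 1)) (tau gam, 1).
  apply/vcong_all; have := map_hiter f g tau k (gam, 1); rewrite /= rmorph1 => <-.
  have /(period_pdet _ _ cop d0) /(congr1 tau) := hk.
  by rewrite map_pdet /= rmorph1 rmorph0.
have cop' : coprimep (map_poly tau f) (map_poly tau g) by rewrite coprimep_map.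
have sf' : (size (map_poly tau f) <= d.+1)%N by rewrite size_map_poly.
have sg' : (size (map_poly tau g) <= d.+1)%N by rewrite size_map_poly.
have top' : (map_poly tau f)`_d != 0 \/ (map_poly tau g)`_d != 0.
  by rewrite !coef_map !fmorph_eq0.
have [j [s1 [s2 [s3 [n12 n13 n23 hs]]]]] := three_preimages cop' sf' sg' top' d2 pb pc cc cb nb.
have [L [jC [h [jh lift]]]] := galois_number_field tau [:: s1; s2; s3].
have [t1 e1] : exists t, jC t = s1 by apply: lift; rewrite !inE eqxx.
have [t2 e2] : exists t, jC t = s2 by apply: lift; rewrite !inE eqxx orbT.
have [t3 e3] : exists t, jC t = s3 by apply: lift; rewrite !inE eqxx !orbT.
exists L, h, j, t1, t2, t3.
have mapE (p : {poly K}) : map_poly jC (map_poly h p) = map_poly tau p.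
  by rewrite -map_poly_comp; apply: eq_map_poly => x /=; rewrite jh.
have key n t : jC (pdet (hiter d (map_poly h f) (map_poly h g) n (t, 1)) (h gam, 1)) =
    pdet (hiter d (map_poly tau f) (map_poly tau g) n (jC t, 1)) (tau gam, 1).
  have := map_hiter (map_poly h f) (map_poly h g) jC n (t, 1).
  by rewrite map_pdet /= ratdeg_map !mapE rmorph1 jh => ->.
split; [by apply: contraNneq n12 => tt; rewrite -e1 tt e2 |
  by apply: contraNneq n13 => tt; rewrite -e1 tt e3 |
  by apply: contraNneq n23 => tt; rewrite -e2 tt e3 |].
move=> t ht; have js : jC t \in [:: s1; s2; s3].
  by move: ht; rewrite !inE => /or3P[] /eqP ->; rewrite (e1, e2, e3) eqxx ?orbT.
have [/vcong_all a1 a2] := hs _ js; split.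
  by apply: (fmorph_inj jC); rewrite key rmorph0.
by apply/eqP => z; apply: a2; apply/vcong_all; rewrite -key z rmorph0.
Qed.

Lemma vprim_comp (F E : fieldType) (h : {rmorphism F -> E}) (V : E -> Prop) P :
  vprim (fun x => V (h x)) P <-> vprim V (h P.1, h P.2).
Proof.
split=> -[h1 h2 h3]; split=> // -[a b]; apply: h3.
  by split; apply/(vmax_comp h V).
by split; apply/(vmax_comp h V).
Qed.

Lemma vcong_comp (F E : fieldType) (h : {rmorphism F -> E}) (V : E -> Prop) P Q :
  vcong (fun x => V (h x)) P Q <-> vcong V (h P.1, h P.2) (h Q.1, h Q.2).
Proof. by rewrite /vcong -map_pdet; apply: vmax_comp. Qed.

Section SunitSequence.
Variables (K : fieldExtType rat) (f g : {poly K}) (gam alpha : K) (k : nat).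
Let d := ratdeg f g.
Hypothesis cop : coprimep f g.
Hypothesis d0 : (0 < d)%N.
Hypothesis per : is_period f g gam k.
Variables (L : splittingFieldType rat) (h : {rmorphism K -> L}) (j : nat) (ts : seq L).
Local Notation "p ^h" := (map_poly h p) (at level 2, format "p ^h").
Hypothesis hts : forall t, t \in ts ->
  pdet (hiter d f^h g^h (j + k) (t, 1)) (h gam, 1) = 0 /\
  pdet (hiter d f^h g^h j (t, 1)) (h gam, 1) != 0.

(* [m] makes everything relevant to the good reduction of [phi] and of the finitely many
   points involved a unit at the good valuation rings. *)
Lemma zsigmondy_Sunits (T : seq L) : exists2 m : nat, (0 < m)%N &
  (forall V, good_valring m V -> forall t, t \in T -> t != 0 -> vunit V t) /\
  (forall V, good_valring m V -> forall q, in_zsigmondy f g gam alpha (q + (j + k)) ->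
    forall t, t \in ts -> vunit V (pdet (hiter d f^h g^h q (h alpha, 1)) (t, 1))).
Proof.
have [k0 [hk hr]] := per.
have [sf sg] := ratdeg_size f g; have top := ratdeg_top d0.
have /Bezout_eq1_coprimepP [[u v] /= bez] : coprimep f^h g^h by rewrite coprimep_map.
(* Inverting [dets] keeps the period of [gam] equal to [k] after reduction, and [dets'] keeps
   [phi^j(t)] away from [gam]. The entry [r = 0] is zero, which is harmless: only nonzero elements
   become units. *)
pose dets := [seq pdet (hiter d f^h g^h r (h gam, 1)) (h gam, 1) | r <- iota 0 k].
pose dets' := [seq pdet (hiter d f^h g^h j (t, 1)) (h gam, 1) | t <- ts].
pose all_elts : seq L := f^h ++ g^h ++ u ++ v ++ [:: h alpha; h gam] ++ ts ++ dets ++ dets' ++ T.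
have [m m0 hm] := unit_multiplier_seq all_elts; exists m => //; split.
  move=> V [hV _ mV] t tT; apply: hm => //.
  by rewrite /all_elts !mem_cat tT !orbT.
move=> V [hV [l pl nVl] mV] q zq t tts.
have VT x : x \in all_elts -> V x.
  move=> xT; have [->|x0] := eqVneq x 0; first exact: vr0.
  by have [] := hm V hV mV x xT x0.
have Vcoef (p : {poly L}) : {subset (p : seq L) <= all_elts} -> forall i, V p`_i.
  move=> sub i; have [si|si] := ltnP i (size p); last by rewrite nth_default //; apply: vr0.
  by apply/VT/sub/mem_nth.
have Vf : forall i, V f^h`_i by apply: Vcoef => x hx; rewrite /all_elts !mem_cat hx.
have Vg : forall i, V g^h`_i by apply: Vcoef => x hx; rewrite /all_elts !mem_cat hx !orbT.
have Vu : forall i, V u`_i by apply: Vcoef => x hx; rewrite /all_elts !mem_cat hx !orbT.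
have Vv : forall i, V v`_i by apply: Vcoef => x hx; rewrite /all_elts !mem_cat hx !orbT.
have Va : V (h alpha) by apply: VT; rewrite /all_elts !mem_cat !inE eqxx !orbT.
have Vc : V (h gam) by apply: VT; rewrite /all_elts !mem_cat !inE eqxx !orbT.
have Vt : V t by apply: VT; rewrite /all_elts !mem_cat tts !orbT.
have sf' : (size f^h <= d.+1)%N by rewrite size_map_poly.
have sg' : (size g^h <= d.+1)%N by rewrite size_map_poly.
have topV : vunit V f^h`_d \/ vunit V g^h`_d.
  have in_top (p : {poly L}) : {subset (p : seq L) <= all_elts} -> p`_d != 0 -> vunit V p`_d.
    move=> sub pd; apply: hm => //; apply/sub/mem_nth.
    by rewrite ltnNge; apply: contraNN pd => s; rewrite nth_default.
  case: top => hd; [left | right]; apply: in_top; rewrite ?coef_map ?fmorph_eq0 //.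
    by move=> x hx; rewrite /all_elts !mem_cat hx.
  by move=> x hx; rewrite /all_elts !mem_cat hx !orbT.
have fin x : V x -> vprim V (x, 1).
  by move=> Vx; split=> //=; [apply: vr1 | case=> _ /(vmax1 hV)].
have pP i : vprim V (hiter d f^h g^h i (h alpha, 1)).
  by apply: (vprim_iter hV sf' sg' Vf Vg Vu Vv bez topV); apply: fin.
have [D1 D2] := hts tts.
have avoid : ~ vcong V (hiter d f^h g^h q (h alpha, 1)) (t, 1).
  apply: (avoid_preimage (k := k) (j := j) (c := (h gam, 1)) hV sf' sg' Vf Vg Vu Vv bez topV) => //.
  - exact: fin.
  - exact: fin.
  - exact: fin.
  - have /(period_pdet _ _ cop d0) /(congr1 h) := hk.
    have := map_hiter f g h k (gam, 1); rewrite map_pdet /= rmorph1 rmorph0 => -> e.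
    by left.
  - move=> r hrk; apply: vmax_unit; apply: hm => //.
      have ri : r \in iota 0 k by rewrite mem_iota; case/andP: hrk.
      by rewrite /all_elts !mem_cat (map_f (fun r => pdet (hiter d f^h g^h r (h gam, 1)) (h gam, 1)) ri) ?orbT.
    have := map_hiter f g h r (gam, 1); rewrite /= rmorph1 => <-.
    have -> : (h gam, 1) = (h (gam, 1 : K).1, h (gam, 1 : K).2) by rewrite /= rmorph1.
    rewrite -map_pdet fmorph_eq0; apply/eqP => /(period_pdet _ _ cop d0); exact: hr.
  - by left.
  - apply: vmax_unit; apply: hm => //.
    by rewrite /all_elts !mem_cat (map_f (fun t => pdet (hiter d f^h g^h j (t, 1)) (h gam, 1))) ?orbT.
  - have mapP i : (h (hiter d f g i (alpha, 1)).1, h (hiter d f g i (alpha, 1)).2) =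
        hiter d f^h g^h i (h alpha, 1).
      by have := map_hiter f g h i (alpha, 1); rewrite /= rmorph1.
    have mapc i : vcong (fun x => V (h x)) (hiter d f g i (alpha, 1)) (gam, 1) <->
        vcong V (hiter d f^h g^h i (h alpha, 1)) (h gam, 1).
      by rewrite -mapP; have := vcong_comp h V (hiter d f g i (alpha, 1)) (gam, 1); rewrite /= rmorph1.
    have nV' : ~ V (h (l%:R)^-1) by rewrite fmorphV rmorph_nat.
    have pK i : vprim (fun x => V (h x)) (hiter d f g i (alpha, 1)).
      by apply/(vprim_comp h V); rewrite mapP.
    move=> /mapc cn.
    have [i hi /mapc ci] := zsigmondy_vcong (valring_comp h hV) pl nV' cop d0 Vc pK zq cn.
    by exists i.
apply: nvmax_unit => //; rewrite /pdet /= mulr1.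
by have [h1 h2 _] := pP q; apply: (vrB hV) => //; apply: (vrM hV).
Qed.
End SunitSequence.

(** * From infinitely many Zsigmondy indices to infinitely many unit solutions *)

Theorem theorem2 (K : fieldExtType rat) (f g : {poly K}) (gam alpha : K) :
  coprimep f g ->
  (2 <= ratdeg f g)%N ->
  periodic f g gam ->
  ~ polynomial_type f g gam ->
  wandering f g alpha ->
  exists N : nat, forall n : nat, in_zsigmondy f g gam alpha n -> (n < N)%N.
Proof.
move=> cop d2 [k per] npt wand; apply: contrapT => infinite.
set d := ratdeg f g in d2; have d0 : (0 < d)%N by apply: ltnW.
have [L [h [j [t1 [t2 [t3 [n12 n13 n23 hts]]]]]]] := preimage_configuration cop d2 per npt.
(* The shift [j + k] is the number of steps by which [avoid_preimage] moves back along the orbit. *)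
have often N : exists q, (N <= q)%N /\ in_zsigmondy f g gam alpha (q + (j + k)).
  apply: contrapT => no; apply: infinite; exists (N + (j + k))%N => n zn.
  rewrite ltnNge; apply/negP => hn; apply: no; exists (n - (j + k))%N.
  have hjk : (j + k <= n)%N by apply: leq_trans hn; rewrite leq_addl.
  by rewrite subnK //; split=> //; rewrite leq_subRL // addnC.
have /choice [pick hpick] := often.
pose q := fix q i := if i is i'.+1 then pick (q i').+1 else pick 0%N.
have zq i : in_zsigmondy f g gam alpha (q i + (j + k)) by case: i => [|i]; [case: (hpick 0%N) | case: (hpick (q i).+1)].
have q_mono : {homo q : i i' / (i < i')%N}.
  by apply: (homo_ltn ltn_trans) => i /=; case: (hpick (q i).+1).
have q_inj : injective q.
  move=> i i' e; case: (ltngtP i i') => // /q_mono; by rewrite e ltnn.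
have [m m0 [hT hD]] := zsigmondy_Sunits alpha cop d0 per hts [:: t1 - t2; t2 - t3; t3 - t1].
pose D i t := pdet (hiter d (map_poly h f) (map_poly h g) (q i) (h alpha, 1)) (t, 1).
have unitD i t : t \in [:: t1; t2; t3] -> forall V, good_valring m V -> vunit V (D i t).
  by move=> ht V gV; apply: hD.
have tn12 : t1 - t2 != 0 by rewrite subr_eq0.
have tn23 : t2 - t3 != 0 by rewrite subr_eq0.
have tn31 : t3 - t1 != 0 by rewrite subr_eq0 eq_sym.
(* One good ring, above a prime larger than [m], is needed to pass from unit to nonzero: without
   any, being a unit at all good rings would say nothing. *)
have [V0 gV0] : exists V, good_valring (L := L) m V.
  have [p mp pp] := prime_above m.
  have p0 : (p%:R : L) != 0 by rewrite (intK_eq0 L p) -lt0n prime_gt0.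
  have [V [hV nV]] := exists_valring p0 (fun z => intr_nonunit L z pp).
  exists V; split=> //; first by exists p.
  have [] // : vunit V (m%:R : L).
  apply: (vunit_coprime hV pp nV); rewrite prime_coprime //.
  by apply/negP => /dvdn_leq; rewrite m0 leqNgt mp => /(_ isT).
have D0 i t : t \in [:: t1; t2; t3] -> D i t != 0.
  by move=> ht; have [] := unitD i t ht V0 gV0.
have i1 : t1 \in [:: t1; t2; t3] by rewrite !inE eqxx.
have i2 : t2 \in [:: t1; t2; t3] by rewrite !inE eqxx orbT.
have i3 : t3 \in [:: t1; t2; t3] by rewrite !inE eqxx !orbT.
(* Siegel's identity [D(t1) (t2-t3) + D(t2) (t3-t1) + D(t3) (t1-t2) = 0], divided by its last
   term. *)
pose w i := - (D i t1 * (t2 - t3)) / (D i t3 * (t1 - t2)).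
have w1 i : 1 - w i = - (D i t2 * (t3 - t1)) / (D i t3 * (t1 - t2)).
  rewrite /w; move: (D0 i t3 i3); rewrite /D; case: (hiter _ _ _ _ _) => x y.
  by rewrite /pdet /= !mulr1 => z; field; rewrite tn12 z.
have unit_ratio V a b c e : good_valring (L := L) m V -> vunit V a -> vunit V b -> vunit V c ->
    vunit V e -> vunit V (- (a * b) / (c * e)).
  move=> [hV _ _] ua ub uc ue; apply: vunitM => //; last by apply/vunitV/vunitM.
  have [x0 x1 x2] := vunitM hV ua ub; split; rewrite ?oppr_eq0 ?invrN //; exact: vrN.
have uw i V : good_valring m V -> vunit V (w i).
  by move=> gV; apply: unit_ratio => //; try exact: unitD; apply: hT => //; rewrite !inE eqxx ?orbT.
have uw1 i V : good_valring m V -> vunit V (1 - w i).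
  by move=> gV; rewrite w1; apply: unit_ratio => //; try exact: unitD; apply: hT => //; rewrite !inE eqxx ?orbT.
apply: (Sunit_equation_finite m0 (u := w)).
- by move=> i; split=> V gV; [case: (uw i V gV) | case: (uw i V gV) | case: (uw1 i V gV) | case: (uw1 i V gV)].
- by move=> i; split; [case: (uw i V0 gV0) | case: (uw1 i V0 gV0)].
move=> a b; rewrite /w => e; apply: q_inj; apply: wand.
rewrite !(rat_iter_ptopt cop d0).
have pr n : hiter (ratdeg f g) f g n (alpha, 1) != 0.
  apply/vprim_all/vprim_hiter => //; apply/vprim_all; apply/eqP => -[_ /eqP]; by rewrite oner_eq0.
apply: ptopt_eq; rewrite ?pr //; apply: (fmorph_inj h).
rewrite map_pdet rmorph0.
have mapP i : (h (hiter d f g i (alpha, 1)).1, h (hiter d f g i (alpha, 1)).2) =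
    hiter d (map_poly h f) (map_poly h g) i (h alpha, 1).
  by have := map_hiter f g h i (alpha, 1); rewrite /= rmorph1.
rewrite !mapP; have za := D0 a t3 i3; have zb := D0 b t3 i3; move: e za zb; rewrite /D.
case: (hiter _ _ _ (q a) _) => x y; case: (hiter _ _ _ (q b) _) => x' y'.
rewrite /pdet /= !mulr1 => e za zb.
(* Up to a constant, [w] is the Moebius function [(x - y t1) / (x - y t3)] of the orbit point,
   invertible as [t1 <> t3]; equal values give equal points of the orbit. *)
have /eqP : (t3 - t1) * (x * y' - y * x') = 0.
  set A := x - y * t1 in e; set B := x - y * t3 in e za.
  set A' := x' - y' * t1 in e; set B' := x' - y' * t3 in e zb.
  have l1 : (t2 - t3) * (A * B') = - (- (A * (t2 - t3)) / (B * (t1 - t2))) * (B * B' * (t1 - t2)).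
    by field; rewrite za tn12.
  have l2 : (t2 - t3) * (A' * B) = - (- (A' * (t2 - t3)) / (B' * (t1 - t2))) * (B * B' * (t1 - t2)).
    by field; rewrite zb tn12.
  have e' : A * B' = A' * B by apply: (mulfI tn23); rewrite l1 l2 e.
  transitivity (A' * B - A * B'); last by rewrite e' subrr.
  by rewrite /A /A' /B /B'; ring.
by rewrite mulf_eq0 (negPf tn31) => /eqP.
Qed.
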